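(* Let $(M,S,\omega)$ be a locally Lagrangian symplectic manifold of the elliptic type, with vertical foliation $\mathcal V$, $V=T\mathcal V=\operatorname{im}S$, and let $L$ be a Lagrangian submanifold of $(M,\omega)$. Let $V'$ be a Lagrangian distribution on $M$ with $TM=V'\oplus V$, let $J$ and $g$ be the associated almost complex structure and Riemannian metric, let $\nabla^0$ be the connection on $TM$ obtained from a $g$-metric connection of $V$ by the extension described in the context, and let $(b_i^j)$ be the matrices of local $1$-forms on $L$ which are the components of the second fundamental form of $L$ with respect to $\nabla^0$ and local $g$-orthonormal bases $(e_i)$ of $TL$, i.e. $$\nabla^0e_i=\lambda_i^je_j+b_i^j\,(Je_j)$$ along $L$. Then the first Maslov class $\mu_1(L)\in H^1(L,\mathbf R)$ is represented by the differential $1$-form $\frac1{2\pi}b_i^i$ (summation over $i$).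
   Context: Everything is $C^\infty$; repeated indices are summed. Locally Lagrangian symplectic manifolds. A tangent structure on a $2n$-dimensional manifold $M$ is $S\in\Gamma\,\mathrm{End}(TM)$ with $S^2=0$, $\operatorname{im}S=\ker S$, which is integrable (its Nijenhuis tensor vanishes). The distribution $V=\operatorname{im}S=\ker S$ is tangent to the vertical foliation $\mathcal V$. A locally Lagrangian symplectic manifold is a triple $(M,S,\omega)$ with $S$ a tangent structure and $\omega$ a symplectic form such that every point has a neighborhood $U$ and a function $\mathcal L\in C^\infty(U)$ with $\omega|_U=d(d\mathcal L\circ S)$; equivalently $\omega(X,SY)=\omega(Y,SX)$ for all vector fields $X,Y$. Then $\mathcal V$ is a Lagrangian foliation, and $([X]_V,[Y]_V)\mapsto\omega(SX,Y)$ is a pseudo-Euclidean metric on $TM/V$; the manifold is of the elliptic type if this metric is positive definite. Maslov classes. Let $(E,\sigma)$ be a symplectic vector bundle of rank $2n$ over a manifold, and $L_0,L_1$ Lagrangian subbundles. Choose a complex structure $J$ on $E$ calibrated by $\sigma$, i.e. $\sigma(Js_1,Js_2)=\sigma(s_1,s_2)$ and $g(s_1,s_2)=\sigma(s_1,Js_2)$ is positive definite. An $L_a$-orthogonal, $J$-unitary connection is a connection $\nabla^a$ on $E$ which preserves $g$, commutes with $J$ and preserves the subbundle $L_a$. The difference $\alpha=\nabla^1-\nabla^0$ is a $1$-form with values in the $J$-complex-linear endomorphisms of $E$; let $\alpha_j^i$ be its complex matrix entries with respect to local unitary bases of $E$ seen as a complex vector bundle by means of $J$ (a $g$-orthonormal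 basis $(e_i)$ of a Lagrangian subbundle gives the unitary basis $\epsilon_i=\frac1{\sqrt2}(e_i-\sqrt{-1}Je_i)$). The $1$-form $\frac{\sqrt{-1}}{2\pi}\alpha_i^i$ is closed and its de Rham class $\mu_1(E,L_0,L_1)$, the first Maslov class of the pair, does not depend on the choice of $J,\nabla^0,\nabla^1$. For a Lagrangian submanifold $L$ of $(M,S,\omega)$, one defines $\mu_1(L)=\mu_1(TM|_L,\,V|_L,\,TL)\in H^1(L,\mathbf R)$. The structures $J$, $g$, $\nabla^0$. Given a Lagrangian distribution $V'$ with $TM=V'\oplus V$, the restriction $S|_{V'}:V'\to V$ is an isomorphism; let $S':TM\to TM$ be defined by $S'|_V=(S|_{V'})^{-1}$ and $S'|_{V'}=0$. Then $J:=S'-S$ is an almost complex structure calibrated by $\omega$ (in the elliptic case), and $g(X,Y):=\omega(X,JY)$ is a Riemannian metric. Start with a connection $\nabla^0$ on the vector bundle $V$ which preserves $g|_V$ and extend it to $TM=V'\oplus V$ by $\nabla^0_X(S'Y)=S'(\nabla^0_XY)$ for $Y\in\Gamma V$; the result, again denoted $\nabla^0$, is a $V$-orthogonal, $J$-unitary connection, which one restricts to $TM|_L$. Since $L$ is Lagrangian, the $g$-normal bundle of $L$ is $J(TL)$, and for local $g$-orthonormal bases $(e_i)$ of $TL$ one has $\nabla^0e_i=\lambda_i^je_j+b_i^j(Je_j)$ with $1$-forms $\lambda_i^j,b_i^j$ on $L$ satisfying $\lambda_i^j+\lambda_j^i=0$, $b_i^j=b_j^i$. *)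

(* Defs.v *)
From HB Require Import structures.
From mathcomp Require Import all_boot all_order all_algebra.
From mathcomp Require Import all_classical all_reals all_analysis.
From mathcomp Require Import complex.

Set Implicit Arguments.
Unset Strict Implicit.
Unset Printing Implicit Defensive.

Import Order.TTheory GRing.Theory Num.Theory.
Import numFieldNormedType.Exports.

Local Open Scope classical_set_scope.
Local Open Scope ring_scope.

Section SmoothOn.
Context {R : realType} {V W : normedModType R}.

(* [Ck k U f]: [f] is of class C^k on the open set [U]; the values of [f]
   outside [U] are irrelevant. *)
Fixpoint Ck (k : nat) (U : set V) (f : V -> W) : Prop :=
  match k with
  | 0 => forall x, U x -> {for x, continuous f}
  | k'.+1 => (forall x, U x -> differentiable f x) /\
             (forall v, Ck k' U (fun x => 'd f x v))
  end.

Definition smooth_on (U : set V) (f : V -> W) : Prop := forall k, Ck k U f.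

End SmoothOn.

(* [fwd c] and [bwd c] are mutually inverse homeomorphisms between [dom c] and
   its image; their values elsewhere are irrelevant. *)
Record manifold (R : realType) (d : nat) := Manifold {
  carrier :> topologicalType;
  chart : Type;
  dom : chart -> set carrier;
  fwd : chart -> carrier -> 'rV[R]_d;
  bwd : chart -> 'rV[R]_d -> carrier;
  chart_at : carrier -> chart;
  mem_chart_at : forall p, dom (chart_at p) p;
  dom_open : forall c, open (dom c);
  cod_open : forall c, open (fwd c @` dom c);
  fwdK : forall c p, dom c p -> bwd c (fwd c p) = p;
  fwd_continuous : forall c p, dom c p -> {for p, continuous (fwd c)};
  bwd_continuous :
    forall c y, (fwd c @` dom c) y -> {for y, continuous (bwd c)};
  transition_smooth : forall c c',
    smooth_on (fwd c @` (dom c `&` dom c')) (fwd c' \o bwd c);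
  manifold_hausdorff : hausdorff_space carrier;
  manifold_second_countable : @second_countable carrier
}.

Arguments chart {R d} _.
Arguments dom {R d} [_] c _.
Arguments fwd {R d} [_] c _.
Arguments bwd {R d} [_] c _.
Arguments chart_at {R d} [_] p.

Section Tangent.
Context {R : realType} {d : nat} {M : manifold R d}.

(* A tangent vector at [p] is the family of its components in all the charts
   around [p] (and 0 for the other charts), the components in two charts being
   related by the differential of the transition map. *)
Definition is_tangent (p : M) (v : chart M -> 'rV[R]_d) : Prop :=
  (forall c, ~ dom c p -> v c = 0) /\
  (forall c c', dom c p -> dom c' p ->
    v c' = 'd (fwd c' \o bwd c) (fwd c p) (v c)).

Definition tangent_pred (p : M) : {pred (chart M -> 'rV[R]_d)} :=
  fun v => `[< is_tangent p v >].

Fact tangent_submod_closed p : submod_closed (tangent_pred p).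
Proof.
split=> [|a u v].
  by apply/asboolP; split=> // c c' _ _; rewrite !fctE linear0.
move=> /asboolP[u0 u1] /asboolP[v0 v1]; apply/asboolP.
split=> [c cp|c c' cp c'p]; rewrite !fctE.
  by rewrite u0 // v0 // scaler0 addr0.
by rewrite linearP (u1 c c') // (v1 c c').
Qed.

HB.instance Definition _ p := GRing.isSubmodClosed.Build R
  (chart M -> 'rV[R]_d) (tangent_pred p) (tangent_submod_closed p).

Record tangent (p : M) := Tangent {
  comp :> chart M -> 'rV[R]_d;
  compP : comp \in tangent_pred p
}.

HB.instance Definition _ p := [isSub for @comp p].
HB.instance Definition _ p := [Choice of tangent p by <:].
HB.instance Definition _ p := [SubChoice_isSubLmodule of tangent p by <:].

End Tangent.

Section TangentOf.
Context {R : realType} {d : nat} {M : manifold R d}.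

Lemma open_overlap (c c' : chart M) :
  open (fwd c @` (dom c `&` dom c')).
Proof.
rewrite openE => _ [p [cp c'p] <-]; rewrite /interior.
have cpI : (fwd c @` dom c) (fwd c p) by exists p.
have Nc : nbhs (fwd c p) (fwd c @` dom c).
  by apply: open_nbhs_nbhs; split=> //; exact: cod_open.
have Nc' : nbhs (fwd c p) (bwd c @^-1` dom c').
  apply: (bwd_continuous cpI); rewrite fwdK//.
  by apply: open_nbhs_nbhs; split=> //; exact: dom_open.
apply: filterS2 Nc Nc' => _ [q cq <-]; rewrite /preimage/= fwdK// => c'q.
by exists q.
Qed.

Lemma transition_diff (c c' : chart M) p : dom c p -> dom c' p ->
  differentiable (fwd c' \o bwd c) (fwd c p).
Proof. by move=> cp c'p; have [+ _] := transition_smooth c c' 1; apply; exists p. Qed.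

Lemma transition_comp (c0 c c' : chart M) p u :
  dom c0 p -> dom c p -> dom c' p ->
  'd (fwd c' \o bwd c0) (fwd c0 p) u =
  'd (fwd c' \o bwd c) (fwd c p) ('d (fwd c \o bwd c0) (fwd c0 p) u).
Proof.
move=> c0p cp c'p.
have d1 := transition_diff c0p cp.
have e1 : (fwd c \o bwd c0) (fwd c0 p) = fwd c p by rewrite /= fwdK.
have d2 : differentiable (fwd c' \o bwd c) ((fwd c \o bwd c0) (fwd c0 p)).
  by rewrite e1; exact: transition_diff.
transitivity ('d ((fwd c' \o bwd c) \o (fwd c \o bwd c0)) (fwd c0 p) u); last first.
  have := congr1 (fun f => f u) (diff_comp d1 d2).
  by rewrite e1.
have d3 := differentiable_comp d1 d2.
have d4 := transition_diff c0p c'p.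
apply: (etrans (esym (deriveE u d4))); apply: (etrans _ (deriveE u d3)).
apply: near_eq_derive.
have : nbhs (fwd c0 p) (fwd c0 @` (dom c0 `&` dom c)).
  by apply: open_nbhs_nbhs; split; [exact: open_overlap | exists p].
apply: filterS => _ [q [c0q cq] <-].
by rewrite /= (fwdK c0q) (fwdK cq).
Qed.

Definition tangent_of_comps (p : M) (u : 'rV[R]_d) (c : chart M) : 'rV[R]_d :=
  if pselect (dom c p)
  then 'd (fwd c \o bwd (chart_at p)) (fwd (chart_at p) p) u else 0.

Fact tangent_of_subproof p u : tangent_of_comps p u \in tangent_pred p.
Proof.
apply/asboolP; split=> [c|c c' cp c'p]; rewrite /tangent_of_comps.
  by case: pselect.
do 2 case: pselect => // ?.
by apply: transition_comp => //; exact: mem_chart_at.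
Qed.

(* the tangent vector at [p] with component [u] in the chart [chart_at p] *)
Definition tangent_of (p : M) (u : 'rV[R]_d) : tangent p :=
  Tangent (tangent_of_subproof p u).

End TangentOf.

Section Calculus.
Context {R : realType} {d : nat} {M : manifold R d}.

Definition smooth_fun {W : normedModType R} (U : set M) (f : M -> W) : Prop :=
  forall c : chart M, smooth_on (fwd c @` (U `&` dom c)) (f \o bwd c).

Definition smooth_near {W : normedModType R} (f : M -> W) (p : M) : Prop :=
  exists U, [/\ open U, U p & smooth_fun U f].

Definition dfun {W : normedModType R} (f : M -> W) (p : M) (v : tangent p) : W :=
  'd (f \o bwd (chart_at p)) (fwd (chart_at p) p) (v (chart_at p)).

Definition lie_bracket (X Y : forall p : M, tangent p) (p : M) : tangent p :=
  tangent_of p (dfun (fun q => Y q (chart_at p)) (X p)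
                - dfun (fun q => X q (chart_at p)) (Y p)).

End Calculus.

(* A section of the pull-back [h^*TM] of the tangent bundle of [M] along
   [h : N -> M] is a dependent function [forall x : N, tangent (h x)]: a vector
   field of [M] for [h = idfun], a section of [TM|_N] when [h] is the inclusion
   of a submanifold. *)

Section Pullback.
Context {R : realType} {d m : nat} {N : manifold R d} {M : manifold R m}.

Definition smooth_map (h : N -> M) : Prop :=
  continuous h /\
  forall c : chart M, smooth_fun (h @^-1` dom c) (fwd c \o h).

Definition push (h : N -> M) (x : N) (v : tangent x) : tangent (h x) :=
  tangent_of (h x) (dfun (fwd (chart_at (h x)) \o h) v).

Variable h : N -> M.

Notation section := (forall x : N, tangent (h x)).
Notation subbundles := (forall x : N, set (tangent (h x))).
Notation endo := (forall x : N, tangent (h x) -> tangent (h x)).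
Notation form2 := (forall x : N, tangent (h x) -> tangent (h x) -> R).

Definition smooth_section (U : set N) (s : section) : Prop :=
  forall c : chart M,
    smooth_fun (U `&` h @^-1` dom c) (fun x => s x c).

(* [s] is, near [x], a smooth section of [h^*TM] with values in [W] *)
Definition local_section (W : subbundles) (x : N) (s : section) : Prop :=
  exists U, [/\ open U, U x, smooth_section U s & forall y, U y -> W y (s y)].

Definition whole : subbundles := fun _ => setT.

Definition smooth_subbundle (k : nat) (W : subbundles) : Prop :=
  forall x : N, exists U (e : 'I_k -> section),
    [/\ open U, U x, forall i, smooth_section U (e i) &
        forall y, U y ->
          (forall u, W y u <-> exists a : 'I_k -> R,
             u = \sum_i a i *: e i y) /\
          (forall a : 'I_k -> R, \sum_i a i *: e i y = 0 -> forall i, a i = 0)].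

Definition smooth_endo (A : endo) : Prop :=
  (forall x, linear (A x)) /\
  (forall x s, local_section whole x s ->
     local_section whole x (fun y => A y (s y))).

Definition lagrangian_subspace (sigma : form2) (x : N)
    (W : set (tangent (h x))) : Prop :=
  forall u, W u <-> forall w, W w -> sigma x u w = 0.

End Pullback.

Arguments whole {R d m N M} h _ _.

Definition local_vfield {R : realType} {d : nat} {N : manifold R d} (x : N)
    (X : forall y : N, tangent y) : Prop :=
  local_section (whole (@idfun N)) x X.

Section Connections.
Context {R : realType} {d m : nat} {N : manifold R d} {M : manifold R m}.
Variable h : N -> M.

Notation section := (forall x : N, tangent (h x)).
Notation subbundles := (forall x : N, set (tangent (h x))).
Notation endo := (forall x : N, tangent (h x) -> tangent (h x)).
Notation form2 := (forall x : N, tangent (h x) -> tangent (h x) -> R).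
Notation conn := (forall x : N, tangent x -> section -> tangent (h x)).

(* A connection on a subbundle [W] of [h^*TM] is given as a differential
   operator on local sections: [D x v s] is the derivative of [s] at [x] along
   [v]; it is only meaningful when [s] is a smooth section of [W] near [x].
   Locality needs no separate axiom: apply [conn_leibniz] with [f] the
   indicator function of a neighbourhood of [x]. *)
Record connection (W : subbundles) (D : conn) : Prop := Connection {
  conn_linear : forall x s, local_section W x s ->
    linear (fun v : tangent x => D x v s);
  conn_add : forall x (v : tangent x) s t,
    local_section W x s -> local_section W x t ->
    D x v (fun y => s y + t y) = D x v s + D x v t;
  conn_leibniz : forall x (v : tangent x) (f : N -> R) s,
    smooth_near f x -> local_section W x s ->
    D x v (fun y => f y *: s y) = dfun f v *: s x + f x *: D x v s;
  conn_smooth : forall x (X : forall y : N, tangent y) s,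
    local_vfield x X -> local_section W x s ->
    local_section W x (fun y => D y (X y) s)
}.

Definition preserves_metric (W : subbundles) (g : form2) (D : conn) : Prop :=
  forall x (v : tangent x) s t, local_section W x s -> local_section W x t ->
    dfun (fun y => g y (s y) (t y)) v =
    g x (D x v s) (t x) + g x (s x) (D x v t).

Definition metric_of (sigma : form2) (J : endo) : form2 :=
  fun x u w => sigma x u (J x w).
Arguments metric_of : clear implicits.

Record calibrated (sigma : form2) (J : endo) : Prop := Calibrated {
  calibrated_smooth : smooth_endo J;
  calibratedK : forall x u, J x (J x u) = - u;
  calibrated_compat : forall x u w, sigma x (J x u) (J x w) = sigma x u w;
  calibrated_pos : forall x u, u != 0 -> 0 < metric_of sigma J x u u
}.

Record orthogonal_unitary (sigma : form2) (J : endo) (W : subbundles)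
    (D : conn) : Prop := OrthogonalUnitary {
  ou_connection : connection (whole h) D;
  ou_metric : preserves_metric (whole h) (metric_of sigma J) D;
  ou_J : forall x (v : tangent x) s, local_section (whole h) x s ->
    D x v (fun y => J y (s y)) = J x (D x v s);
  ou_subbundle : forall x (v : tangent x) s, local_section W x s ->
    W x (D x v s)
}.

End Connections.

Arguments connection {R d m N M} h W D.
Arguments preserves_metric {R d m N M} h W g D.
Arguments metric_of {R d m N M h} sigma J x u w.

Section Forms.
Context {R : realType} {d : nat} {N : manifold R d}.

Notation vfield := (forall x : N, tangent x).
Notation form1 := (forall x : N, tangent x -> R).
Notation form2 := (forall x : N, tangent x -> tangent x -> R).

Definition is_form1 (theta : form1) : Prop :=
  (forall x, scalar (theta x)) /\
  (forall x X, local_vfield x X -> smooth_near (fun y => theta y (X y)) x).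

Definition ext_d1 (theta : form1) (X Y : vfield) (x : N) : R :=
  dfun (fun y => theta y (Y y)) (X x) - dfun (fun y => theta y (X y)) (Y x)
  - theta x (lie_bracket X Y x).

Definition closed_form1 (theta : form1) : Prop :=
  is_form1 theta /\
  forall x X Y, local_vfield x X -> local_vfield x Y -> ext_d1 theta X Y x = 0.

(* The elements of H^1(N, R) are represented as sets of closed 1-forms. *)
Definition deRham_class (theta : form1) : set form1 :=
  [set eta | [/\ closed_form1 theta, closed_form1 eta &
     exists2 f : N -> R, smooth_fun setT f &
       forall x (v : tangent x), eta x v - theta x v = dfun f v]].

Definition is_form2 (w : form2) : Prop :=
  [/\ forall x u, scalar (w x u),
      forall x u v, w x u v = - w x v u &
      forall x X Y, local_vfield x X -> local_vfield x Y ->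
        smooth_near (fun y => w y (X y) (Y y)) x].

Definition ext_d2 (w : form2) (X Y Z : vfield) (x : N) : R :=
  dfun (fun y => w y (Y y) (Z y)) (X x)
  + dfun (fun y => w y (Z y) (X y)) (Y x)
  + dfun (fun y => w y (X y) (Y y)) (Z x)
  - w x (lie_bracket X Y x) (Z x)
  - w x (lie_bracket Y Z x) (X x)
  - w x (lie_bracket Z X x) (Y x).

Record symplectic (w : form2) : Prop := Symplectic {
  symplectic_form : is_form2 w;
  symplectic_closed : forall x X Y Z,
    local_vfield x X -> local_vfield x Y -> local_vfield x Z ->
    ext_d2 w X Y Z x = 0;
  symplectic_nondeg : forall x u, (forall v, w x u v = 0) -> u = 0
}.

End Forms.

Section Maslov.
Local Open Scope complex_scope.
Context {R : realType} {d k : nat} {N : manifold R d} {M : manifold R k.*2}.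
Variable h : N -> M.

Notation section := (forall x : N, tangent (h x)).
Notation endo := (forall x : N, tangent (h x) -> tangent (h x)).
Notation form2 := (forall x : N, tangent (h x) -> tangent (h x) -> R).
Notation conn := (forall x : N, tangent x -> section -> tangent (h x)).

(* A local unitary basis of [h^*TM], which has complex rank [k] for the
   complex structure [J] and carries the hermitian metric [g - i sigma]. *)
Definition unitary_frame (sigma : form2) (J : endo) (U : set N)
    (e : 'I_k -> section) : Prop :=
  [/\ open U, forall i, smooth_section U (e i) &
      forall x, U x -> forall i j,
        metric_of sigma J x (e i x) (e j x) = (i == j)%:R /\
        sigma x (e i x) (e j x) = 0].

(* [theta] is the 1-form [sqrt(-1)/(2 pi) alpha^i_i], where
   [alpha = D1 - D0] has the complex entries [A i j] with respect to [e];
   a complex scalar [a + i b] acts on [h^*TM] as [a + b J]. *)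
Definition is_maslov_form (sigma : form2) (J : endo) (D0 D1 : conn)
    (theta : forall x : N, tangent x -> R) : Prop :=
  forall (U : set N) (e : 'I_k -> section)
    (A : 'I_k -> 'I_k -> forall x : N, tangent x -> R[i]),
  unitary_frame sigma J U e ->
  (forall x (v : tangent x) i, U x ->
     D1 x v (e i) - D0 x v (e i) =
     \sum_j (complex.Re (A i j x v) *: e j x
             + complex.Im (A i j x v) *: J x (e j x))) ->
  forall x (v : tangent x), U x ->
    (theta x v)%:C = (0 +i* 1) / (2 * pi)%:C * \sum_i A i i x v.

(* The first Maslov class of [(h^*TM, sigma, L0, L1)], as an element of
   H^1(N, R): since the class of the Maslov form is independent of [J], [D0] and
   [D1], all the classes collected here are one and the same. *)
Definition first_maslov_class (sigma : form2)
    (L0 L1 : forall x : N, set (tangent (h x))) :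
    set (forall x : N, tangent x -> R) :=
  [set eta | exists J D0 D1 theta,
     [/\ calibrated sigma J,
         orthogonal_unitary sigma J L0 D0,
         orthogonal_unitary sigma J L1 D1,
         is_maslov_form sigma J D0 D1 theta &
         deRham_class theta eta]].

End Maslov.

Section LocallyLagrangian.
Context {R : realType} {n : nat} {M : manifold R n.*2}.

Notation vfield := (forall p : M, tangent p).
Notation endo := (forall p : M, tangent p -> tangent p).
Notation form2 := (forall p : M, tangent p -> tangent p -> R).
Notation distribution := (forall p : M, set (tangent p)).

Definition nijenhuis (S : endo) (X Y : vfield) (p : M) : tangent p :=
  let SX := fun q => S q (X q) in
  let SY := fun q => S q (Y q) in
  lie_bracket SX SY p - S p (lie_bracket SX Y p) - S p (lie_bracket X SY p)
  + S p (S p (lie_bracket X Y p)).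

Definition vertical (S : endo) : distribution :=
  fun p u => exists v, u = S p v.
Arguments vertical : clear implicits.

Record tangent_structure (S : endo) : Prop := TangentStructure {
  ts_smooth : smooth_endo (h := @idfun M) S;
  ts_square : forall p u, S p (S p u) = 0;
  ts_exact : forall p u, S p u = 0 -> vertical S p u;
  ts_integrable : forall p X Y, local_vfield p X -> local_vfield p Y ->
    nijenhuis S X Y p = 0
}.

Record locally_lagrangian (S : endo) (w : form2) : Prop := LocallyLagrangian {
  ll_tangent_structure : tangent_structure S;
  ll_symplectic : symplectic w;
  ll_lagrangian : forall p, exists U (Lag : M -> R),
    [/\ open U, U p, smooth_fun U Lag &
        forall q X Y, U q -> local_vfield q X -> local_vfield q Y ->
          w q (X q) (Y q) = ext_d1 (fun r u => dfun Lag (S r u)) X Y q]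
}.

Definition elliptic (S : endo) (w : form2) : Prop :=
  forall p u, ~ vertical S p u -> 0 < w p (S p u) u.

Record lagrangian_distribution (w : form2) (W : distribution) : Prop :=
  LagrangianDistribution {
    ld_smooth : smooth_subbundle (h := @idfun M) n W;
    ld_lagrangian : forall p, lagrangian_subspace (h := @idfun M) w (W p)
  }.

Definition complementary (W1 W2 : distribution) : Prop :=
  (forall p u, exists u1 u2, [/\ W1 p u1, W2 p u2 & u = u1 + u2]) /\
  (forall p u, W1 p u -> W2 p u -> u = 0).

(* [S'] vanishes on [V'] and its restriction to [V = im S] is the inverse of
   [S : V' -> V]. *)
Definition inverse_structure (S : endo) (V' : distribution) (S' : endo) : Prop :=
  (forall p, linear (S' p)) /\
  (forall p u, V' p u -> S' p (S p u) = u /\ S' p u = 0).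

Definition assoc_J (S S' : endo) : endo := fun p u => S' p u - S p u.

Definition assoc_metric (w : form2) (S S' : endo) : form2 :=
  fun p u v => w p u (assoc_J S S' v).

(* [D0], a connection on [TM], is the extension of the connection [DV] on
   [V = im S] that commutes with [S'] on the sections of [V]. *)
Definition extends_vertical (S S' : endo)
    (DV D0 : forall p : M, tangent p -> vfield -> tangent p) : Prop :=
  forall p (v : tangent p) Y,
    local_section (h := @idfun M) (vertical S) p Y ->
    D0 p v Y = DV p v Y /\
    D0 p v (fun q => S' q (Y q)) = S' p (DV p v Y).

End LocallyLagrangian.

Arguments vertical {R n M} S p u.

Section LagrangianSubmanifold.
Context {R : realType} {n : nat} {M : manifold R n.*2} {L : manifold R n}.
Variable iota : L -> M.

Notation endo := (forall p : M, tangent p -> tangent p).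
Notation form2 := (forall p : M, tangent p -> tangent p -> R).
Notation vfield := (forall p : M, tangent p).

Definition image_tangent (x : L) : set (tangent (iota x)) :=
  [set u | exists v : tangent x, u = push iota v].
Arguments image_tangent : clear implicits.

Record lagrangian_submanifold (w : form2) : Prop := LagrangianSubmanifold {
  ls_smooth : smooth_map iota;
  ls_injective : injective iota;
  ls_immersion : forall x : L, injective (fun v : tangent x => push iota v);
  ls_lagrangian : forall x,
    lagrangian_subspace (h := iota) (fun y => w (iota y)) (image_tangent x)
}.

Definition maslov_mu1 (S : endo) (w : form2) :
    set (forall x : L, tangent x -> R) :=
  first_maslov_class (h := iota) (fun x => w (iota x))
    (fun x => vertical S (iota x)) image_tangent.

Definition restricts (D0 : forall p : M, tangent p -> vfield -> tangent p)
    (DL : forall x : L, tangent x ->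
            (forall y : L, tangent (iota y)) -> tangent (iota x)) : Prop :=
  forall x (v : tangent x) Y, local_vfield (iota x) Y ->
    DL x v (fun y => Y (iota y)) = D0 (iota x) (push iota v) Y.

(* [e] is a local basis of [TL] over [U], orthonormal for the metric induced
   by [g]. *)
Definition orthonormal_frame (g : form2) (U : set L)
    (e : 'I_n -> forall x : L, tangent x) : Prop :=
  [/\ open U, forall i, smooth_section (h := @idfun L) U (e i) &
      forall x, U x -> forall i j,
        g (iota x) (push iota (e i x)) (push iota (e j x)) = (i == j)%:R].

(* [D e_i = lam_i^j e_j + b_i^j J e_j] over [U] *)
Definition gauss_decomposition
    (DL : forall x : L, tangent x ->
            (forall y : L, tangent (iota y)) -> tangent (iota x))
    (J : endo) (U : set L) (e : 'I_n -> forall x : L, tangent x)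
    (lam b : 'I_n -> 'I_n -> forall x : L, tangent x -> R) : Prop :=
  forall x (v : tangent x) i, U x ->
    DL x v (fun y => push iota (e i y)) =
    \sum_j (lam i j x v *: push iota (e j x)
            + b i j x v *: J (iota x) (push iota (e j x))).

(* [theta] is the 1-form given on the domain of every local orthonormal basis
   by [b_i^i / (2 pi)]. *)
Definition is_trace_form (g : form2) (J : endo)
    (DL : forall x : L, tangent x ->
            (forall y : L, tangent (iota y)) -> tangent (iota x))
    (theta : forall x : L, tangent x -> R) : Prop :=
  forall U e lam b,
    orthonormal_frame g U e -> gauss_decomposition DL J U e lam b ->
    forall x (v : tangent x), U x ->
      theta x v = (2 * pi)^-1 * \sum_i b i i x v.

End LagrangianSubmanifold.

Arguments image_tangent {R n M L} iota x u.
Arguments restricts {R n M L} iota D0 DL.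
Arguments is_trace_form {R n M L} iota g J DL theta.

(* Main.v *)
From mathcomp Require Import all_boot all_order all_algebra.
From mathcomp Require Import all_classical all_reals all_analysis.
From mathcomp Require Import complex.
From mathcomp Require Import ring lra.
Require Import Defs.

(** For a calibrated [J], real frames [e] of [L0] and [t] of [L1] are complex
    bases of the ambient bundle, so that [t = C e] for a complex matrix [C].  As
    the connections preserve [L0] and [L1], their matrices in the frames [e] and
    [t] are real; differentiating [t = C e] identifies the Maslov form with
    [(2 pi)^-1 Im (d det C / det C) = (2 pi)^-1 d (arg (det C))].  It is therefore
    closed.

    Given a second structure [J'], with [t = C' e], the determinant of
    [(1 - s) C + s C'] never vanishes for [0 <= s <= 1], by positivity of both
    metrics.  The variation of its argument along the path does not depend on the
    frames, hence is a global smooth function, whose differential is [2 pi] times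
    the difference of the two Maslov forms.

    For the given [J] and [D0], one takes for [D1] the [J]-linear connection which
    is the projection of [D0] along [J (TL)] on the sections of [TL]: then
    [D1 e_i - D0 e_i = - b_i^j J e_j], of complex trace [- i b_i^i]. *)

Set Implicit Arguments.
Unset Strict Implicit.
Unset Printing Implicit Defensive.

Import Order.TTheory GRing.Theory Num.Theory.
Import numFieldNormedType.Exports.

Local Open Scope classical_set_scope.
Local Open Scope ring_scope.

(** The Maslov class is encoded as the set of all forms reached from arbitrary auxiliary data, so
    its equality with one de Rham class already contains the independence of the complex structure
    and of both connections. Only matrices are interpolated, never complex structures or
    connections, which keeps this step pointwise linear algebra. The determinant is a polynomial in
    the path parameter: its argument is lifted by factoring it into linear factors, the end value of
    the lift is unique by the intermediate value theorem, and smooth dependence on the point comes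
    from comparing neighbouring paths through a product with positive real part.

    Changing the real frames multiplies the determinants by a real factor that may be negative.
    Multiplying each path by the conjugate of its initial determinant turns this factor into a
    square, so the orientations of the frames disappear.

    A Maslov form is tested on unitary frames, while the determinants live on frames of the two
    subbundles; the trace of the difference tensor in an arbitrary complex basis links the two. *)

Local Notation Re := complex.Re.
Local Notation Im := complex.Im.

(** * Functions of class C^k *)

Section CkTheory.
Context {R : realType} {V : normedModType R}.

Lemma near_eq_diff (W : normedModType R) (f g : V -> W) x v :
  differentiable f x -> differentiable g x ->
  (\forall y \near x, f y = g y) -> 'd f x v = 'd g x v.
Proof.
move=> df dg fg.
by rewrite -(deriveE v df) -(deriveE v dg); apply: near_eq_derive.
Qed.

(** The expansion with zero differential has no remainder near [x]. This lets differentiability pass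
    between functions that agree only near a point, by adding their difference. *)
Lemma is_diff_near0 (W : normedModType R) (f : V -> W) x :
  (\forall y \near x, f y = 0) -> differentiable f x.
Proof.
move=> f0; have fx0 : f x = 0 by exact: nbhs_singleton f0.
have fE : f \o shift x = cst (f x) + \0 +o_ 0 id.
  apply/eqaddoP => _/posnumP[e].
  rewrite [\forall y \near _, _ <= _](near_shift x) sub0r.
  apply: filterS f0 => y fy0 /=.
  by rewrite !fctE /= subrK fy0 fx0 !addr0 subrr normr0 mulr_ge0.
have dE : 'd f x = \0 :> (V -> W).
  by apply: diff_unique fE => //; exact: cst_continuous.
by apply/diff_locallyP; rewrite dE; split=> //; exact: cst_continuous.
Qed.

Lemma near_eq_differentiable (W : normedModType R) (f g : V -> W) x :
  (\forall y \near x, f y = g y) -> differentiable f x -> differentiable g x.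
Proof.
move=> fg df; rewrite (_ : g = f + (g - f)); last by rewrite addrC subrK.
apply: differentiableD; first exact: df.
apply: is_diff_near0.
by apply: filterS fg => y fgy; rewrite !fctE fgy subrr.
Qed.

Lemma Ck_sub (W : normedModType R) k (U U' : set V) (f : V -> W) :
  U' `<=` U -> Ck k U f -> Ck k U' f.
Proof.
move=> sU; elim: k f => [|k IH] f /=; first by move=> Uf x /sU/Uf.
by move=> [df Cf]; split=> [x /sU/df//|v]; exact: IH.
Qed.

Lemma smooth_on_sub (W : normedModType R) (U U' : set V) (f : V -> W) :
  U' `<=` U -> smooth_on U f -> smooth_on U' f.
Proof. by move=> sU Uf k; exact: Ck_sub (Uf k). Qed.

Lemma Ck_pred (W : normedModType R) k (U : set V) (f : V -> W) :
  Ck k.+1 U f -> Ck k U f.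
Proof.
elim: k f => [|k IH] f [df Cf]; first by move=> x /df/differentiable_continuous.
by split=> // v; exact: IH.
Qed.

Lemma Ck_cover (W : normedModType R) k (U : set V) (f : V -> W) :
  (forall x, U x -> exists2 U', U' x & Ck k U' f) -> Ck k U f.
Proof.
elim: k f => [|k IH] f /= H; first by move=> x /H[U' U'x]; exact.
split=> [x /H[U' U'x [+ _]]|v]; first exact.
by apply: IH => x /H[U' U'x [_ +]]; exists U'.
Qed.

Lemma smooth_on_cover (W : normedModType R) (U : set V) (f : V -> W) :
  (forall x, U x -> exists2 U', U' x & smooth_on U' f) -> smooth_on U f.
Proof.
by move=> H k; apply: Ck_cover => x /H[U' U'x U'f]; exists U'.
Qed.

Lemma smooth_on_diff (W : normedModType R) (U : set V) (f : V -> W) x :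
  smooth_on U f -> U x -> differentiable f x.
Proof. by move=> /(_ 1%N)[+ _] Ux; apply. Qed.

Lemma smooth_on_d (W : normedModType R) (U : set V) (f : V -> W) v :
  smooth_on U f -> smooth_on U (fun x => 'd f x v).
Proof. by move=> Uf k; have [_] := Uf k.+1; exact. Qed.

Lemma near_open_eq (T : topologicalType) (W : Type) (U : set T) (f g : T -> W) x :
  open U -> {in U, f =1 g} -> U x -> \forall y \near x, f y = g y.
Proof.
move=> oU fg Ux; have : nbhs x U by exact: open_nbhs_nbhs.
by apply: filterS => y Uy; apply: fg; rewrite inE.
Qed.

(** Openness of [U] makes agreement on [U] an agreement of germs, which the differentials inherit at
    every order. *)
Lemma Ck_eq (W : normedModType R) k (U : set V) (f g : V -> W) :
  open U -> {in U, f =1 g} -> Ck k U f -> Ck k U g.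
Proof.
move=> oU; elim: k f g => [|k IH] f g fg /=.
  move=> Uf x Ux; have fgx := near_open_eq oU fg Ux.
  move: (Uf x Ux); rewrite /prop_for /continuous_at -(nbhs_singleton fgx).
  by apply: cvg_trans; apply: near_eq_cvg; apply: filterS fgx => y ->.
move=> [df Cf]; have dg x : U x -> differentiable g x.
  move=> Ux; apply: (near_eq_differentiable _ (df x Ux)).
  exact: near_open_eq Ux.
split=> [|v]; first exact: dg.
apply: IH (Cf v) => x; rewrite inE => Ux.
by apply: near_eq_diff; [exact: df|exact: dg|exact: near_open_eq Ux].
Qed.

Lemma smooth_on_eq (W : normedModType R) (U : set V) (f g : V -> W) :
  open U -> {in U, f =1 g} -> smooth_on U f -> smooth_on U g.
Proof. by move=> oU fg Uf k; exact: Ck_eq (Uf k). Qed.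

Lemma Ck_cst (W : normedModType R) k (U : set V) (a : W) : Ck k U (fun _ => a).
Proof.
elim: k a => [|k IH] a /=; first by move=> x _; exact: cvg_cst.
split=> [x _|v]; first exact: differentiable_cst.
rewrite (_ : (fun x => _) = (fun _ => 0)) //.
by apply/funext => x; rewrite diff_cst.
Qed.

Lemma Ck_linear (W W' : normedModType R) k (U : set V) (f : V -> W)
    (l : {linear W -> W'}) :
  open U -> continuous l -> Ck k U f -> Ck k U (l \o f).
Proof.
move=> oU cl; elim: k f => [|k IH] f /=.
  by move=> Uf x Ux; apply: continuous_comp; [exact: Uf | exact: cl].
move=> [df Cf]; have dl y : differentiable l y by exact: linear_differentiable.
split=> [x Ux|v]; first exact: differentiable_comp (df x Ux) (dl _).
apply: Ck_eq (IH _ (Cf v)) => // x; rewrite inE => Ux /=.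
have := congr1 (@^~ v) (diff_comp (df x Ux) (dl (f x))).
by rewrite (diff_lin _ cl) => ->.
Qed.

Lemma CkD (W : normedModType R) k (U : set V) (f g : V -> W) :
  open U -> Ck k U f -> Ck k U g -> Ck k U (fun x => f x + g x).
Proof.
move=> oU; elim: k f g => [|k IH] f g /=.
  by move=> Uf Ug x Ux; apply: cvgD; [exact: Uf|exact: Ug].
move=> [df Cf] [dg Cg]; split=> [x Ux|v].
  by apply: differentiableD; [exact: df|exact: dg].
apply: Ck_eq (IH _ _ (Cf v) (Cg v)) => // x; rewrite inE => Ux /=.
by rewrite [RHS](congr1 (@^~ v) (diffD (df x Ux) (dg x Ux))).
Qed.

Lemma Ck_sum (W : normedModType R) k (U : set V) (I : Type) (r : seq I)
    (P : pred I) (F : I -> V -> W) :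
  open U -> (forall i, P i -> Ck k U (F i)) ->
  Ck k U (fun x => \sum_(i <- r | P i) F i x).
Proof.
move=> oU H; elim: r => [|i r IH].
  by under eq_fun do rewrite big_nil; exact: Ck_cst.
have [Pi|nPi] := boolP (P i).
  by under eq_fun do rewrite big_cons Pi; apply: CkD => //; exact: H.
by under eq_fun do rewrite big_cons (negbTE nPi).
Qed.

Lemma CkM k (U : set V) (f g : V -> R) :
  open U -> Ck k U f -> Ck k U g -> Ck k U (fun x => f x * g x).
Proof.
move=> oU; elim: k f g => [|k IH] f g Cf Cg.
  by move=> x Ux; apply: cvgM; [exact: Cf|exact: Cg].
have [[df C'f] [dg C'g]] := (Cf, Cg); split=> [x Ux|v].
  by apply: differentiableM; [exact: df|exact: dg].
apply: (@Ck_eq _ _ _ (fun x => f x * 'd g x v + g x * 'd f x v)) => //.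
  move=> x; rewrite inE => Ux /=.
  by rewrite [RHS](congr1 (@^~ v) (diffM (df x Ux) (dg x Ux))).
by apply: CkD => //; apply: IH; [exact: Ck_pred|exact: C'g|
  exact: Ck_pred|exact: C'f].
Qed.

Lemma CkZl (W : normedModType R) k (U : set V) (f : V -> R) (w : W) :
  open U -> Ck k U f -> Ck k U (fun x => f x *: w).
Proof.
move=> oU; elim: k f => [|k IH] f /=.
  by move=> Uf x Ux; apply: cvgZr_tmp; exact: Uf.
move=> [df Cf]; split=> [x Ux|v].
  by apply: differentiableZl; exact: df.
apply: Ck_eq (IH _ (Cf v)) => // x; rewrite inE => Ux /=.
by rewrite [RHS](congr1 (@^~ v) (diffZl w (df x Ux))).
Qed.

(** Bundled as a linear map so that [Ck_linear] and the differential of a linear map apply to matrix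
    entries. *)
Definition coordl m n (i : 'I_m) (j : 'I_n) : {linear 'M[R]_(m, n) -> R}.
Proof.
exists (fun N : 'M[R]_(_, _) => N i j); do 2![eexists]; do ?[constructor];
  by rewrite ?mxE// => ? *; rewrite ?mxE//; move=> ?; rewrite !mxE.
Defined.

Lemma Ck_coord m n k (U : set V) (f : V -> 'M[R]_(m, n)) i j :
  open U -> Ck k U f -> Ck k U (fun x => f x i j).
Proof.
by move=> oU; apply: (Ck_linear (l := coordl i j)) => //; exact: coord_continuous.
Qed.

Lemma diff_coord m n (f : V -> 'M[R]_(m, n)) i j x v : differentiable f x ->
  'd (fun x => f x i j) x v = 'd f x v i j.
Proof.
move=> df.
have cl : continuous (coordl i j) by exact: coord_continuous.
have dl : differentiable (coordl i j) (f x) by exact: linear_differentiable.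
have := congr1 (@^~ v) (diff_comp df dl).
by rewrite (diff_lin _ cl) => ->.
Qed.

Lemma Ck_row n k (U : set V) (f : V -> 'rV[R]_n) : open U ->
  (forall j, Ck k U (fun x => f x 0 j)) -> Ck k U f.
Proof.
move=> oU H.
apply: (@Ck_eq _ _ _ (fun x => \sum_j f x 0 j *: delta_mx 0 j)) => //.
  by move=> x _; rewrite -row_sum_delta.
by apply: Ck_sum => // j _; exact: CkZl.
Qed.
End CkTheory.

(** * Composition, inverses and elementary functions of class C^k *)

Section CkComp.
Context {R : realType} {V : normedModType R}.
Implicit Types U : set V.

Lemma diff_compE (W Z : normedModType R) (f : V -> W) (g : W -> Z) x v :
  differentiable f x -> differentiable g (f x) ->
  'd (g \o f) x v = 'd g (f x) ('d f x v).
Proof. by move=> df dg; rewrite [LHS](congr1 (@^~ v) (diff_comp df dg)). Qed.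

Lemma diff_rowE m (W : normedModType R) (g : 'rV[R]_m -> W) x v :
  'd g x v = \sum_j v 0 j *: 'd g x (delta_mx 0 j).
Proof.
rewrite {1}(row_sum_delta v) linear_sum; apply: eq_bigr => j _.
by rewrite linearZ.
Qed.

Lemma diff_realE (W : normedModType R) (g : R -> W) (x v : R) :
  'd g x v = v *: 'd g x 1.
Proof. by rewrite -linearZ /= -[X in _ = 'd g x X]/(v * 1) mulr1. Qed.

(** [Ck] only speaks of derivatives in fixed directions, while the chain rule differentiates [g] in
    the moving direction ['d f x v]. Expanding this direction in a basis with continuous coordinates
    yields products of scalar functions, and the induction applies to the derivatives of [g] along
    basis vectors. *)
Lemma Ck_comp_basis (W : normedModType R) (I : Type) (r : seq I) (b : I -> W)
    (l : I -> {linear W -> R}) k U (U' : set W) (f : V -> W) (g : W -> R) :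
  (forall w, w = \sum_(i <- r) l i w *: b i) -> (forall i, continuous (l i)) ->
  open U -> (forall x, U x -> U' (f x)) ->
  Ck k U f -> Ck k U' g -> Ck k U (g \o f).
Proof.
move=> bE cl oU UU'; elim: k g => [|k IH] g Cf Cg.
  by move=> x Ux; apply: continuous_comp; [exact: Cf|exact/Cg/UU'].
have [[df C'f] [dg C'g]] := (Cf, Cg); split=> [x Ux|v].
  by apply: differentiable_comp; [exact: df|exact/dg/UU'].
apply: (@Ck_eq _ _ _ _ _ (fun x => \sum_(i <- r) l i ('d f x v) * 'd g (f x) (b i))) => //.
  move=> x; rewrite inE => Ux.
  rewrite [RHS]diff_compE; [|exact: df|exact/dg/UU'].
  rewrite [in RHS](bE ('d f x v)) linear_sum; apply: eq_bigr => i _.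
  by rewrite linearZ.
apply: Ck_sum => // i _; apply: CkM => //.
  by apply: (Ck_linear (l := l i)) => //; exact: C'f.
by apply: (IH (fun y => 'd g y (b i))); [exact: Ck_pred|exact: C'g].
Qed.

Lemma Ck_comp m k U (U' : set 'rV[R]_m) (f : V -> 'rV[R]_m) (g : 'rV[R]_m -> R) :
  open U -> (forall x, U x -> U' (f x)) ->
  Ck k U f -> Ck k U' g -> Ck k U (g \o f).
Proof.
apply: (Ck_comp_basis (l := coordl 0) (b := delta_mx 0)) => [w|i].
  exact: row_sum_delta.
exact: coord_continuous.
Qed.

Lemma Ck_comp_real k U (U' : set R) (f : V -> R) (g : R -> R) :
  open U -> (forall x, U x -> U' (f x)) ->
  Ck k U f -> Ck k U' g -> Ck k U (g \o f).
Proof.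
apply: (@Ck_comp_basis R^o unit [:: tt] (fun=> 1) (fun=> idfun)) => [w|_ w].
  by rewrite big_seq1 -[RHS]/(w * 1) mulr1.
exact: cvg_id.
Qed.

(** The derivative of the inverse is a product of two copies of the inverse itself with a derivative
    of [f], so regularity is gained one order at a time. *)
Lemma Ck_inv k U (f : V -> R) :
  open U -> (forall x, U x -> f x != 0) ->
  Ck k U f -> Ck k U (fun x => (f x)^-1).
Proof.
move=> oU f0; elim: k => [|k IH] Cf.
  by move=> x Ux; apply: cvgV; [exact: f0|exact: Cf].
have [df C'f] := Cf; split=> [x Ux|v].
  by apply: differentiableV; [exact: df|exact: f0].
apply: (@Ck_eq _ _ _ _ _
   (fun x => (- 1) * ((f x)^-1 * ((f x)^-1 * 'd f x v)))) => //.
  move=> x; rewrite inE => Ux.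
  rewrite [RHS](congr1 (@^~ v) (diffV (df x Ux) (f0 x Ux))).
  rewrite -[RHS]/(- f x ^- 2 * 'd f x v).
  by rewrite [RHS]mulNr -exprVn expr2 mulN1r mulrA.
have CIH := IH (Ck_pred Cf).
apply: CkM => //; first exact: Ck_cst.
by do 2!apply: CkM => //; exact: C'f.
Qed.

(** Bootstrapping: the derivative [F] is as regular as [f] is already known to be, hence [f] gains
    one order. Square root and arctangent are both obtained in this way. *)
Lemma Ck_real_ode (f : R -> R) (F : R -> R) k (U : set R) : open U ->
  (forall x, U x -> differentiable f x) ->
  (forall x, U x -> 'D_1 f x = F x) ->
  (forall k', Ck k' U f -> Ck k' U F) -> Ck k U f.
Proof.
move=> oU df fF CF; elim: k => [|k IH].
  by move=> x /df/differentiable_continuous.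
split=> // v; apply: (@Ck_eq _ _ _ _ _ (fun x => F x * v)) => //.
  move=> x; rewrite inE => Ux; rewrite -fF // deriveE; last exact: df.
  by rewrite [RHS]diff_realE mulrC.
by apply: CkM; [|exact: CF|exact: Ck_cst].
Qed.
End CkComp.

Section CkReal.
Context {R : realType}.

Lemma Ck_id k (U : set R) : Ck k U (fun x : R => x).
Proof.
case: k => [|k]; first by move=> x _.
split=> [x _|v]; first exact: (@differentiable_comp _ _ _ _ id id).
rewrite (_ : (fun x => _) = (fun _ => v)); first exact: Ck_cst.
by apply/funext => x; rewrite (diff_val).
Qed.

Lemma Ck_sqrt k : Ck k [set x : R | 0 < x] Num.sqrt.
Proof.
have oU : open [set x : R | 0 < x] by exact: open_gt.
have ds (x : R) : 0 < x -> is_derive x 1 Num.sqrt (2 * Num.sqrt x)^-1.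
  by move=> x0; exact: is_derive1_sqrt.
apply: (@Ck_real_ode _ _ (fun x => (2 * Num.sqrt x)^-1)) => //.
- by move=> x /= /ds ?; exact/derivable1_diffP.
- by move=> x /= /ds ?; exact: derive_val.
- move=> k' Cs; apply: Ck_inv => //.
    by move=> x /= x0; rewrite mulf_neq0 // gt_eqF ?sqrtr_gt0.
  by apply: CkM => //; exact: Ck_cst.
Qed.

Lemma Ck_atan k (U : set R) : Ck k U atan.
Proof.
apply: (@Ck_sub _ _ _ _ setT) => //.
apply: (@Ck_real_ode _ _ (fun x => (1 + x ^+ 2)^-1)) => //.
- exact: openT.
- by move=> x _; exact/derivable1_diffP.
- by move=> x _; exact: derive_val.
- move=> k' _; apply: Ck_inv; first exact: openT.
    by move=> x _; rewrite gt_eqF // ltr_wpDr ?sqr_ge0.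
  apply: CkD; [exact: openT|exact: Ck_cst|].
  by under eq_fun do rewrite expr2; apply: CkM; [exact: openT|exact: Ck_id..].
Qed.
End CkReal.

(** * Symmetry of second derivatives *)

Section Schwarz.
Context {R : realType} {V : normedModType R}.

Lemma is_derive_line (f : V -> R) (a u : V) (s : R) :
  differentiable f (a + s *: u) ->
  is_derive s 1 (fun s : R => f (a + s *: u)) ('d f (a + s *: u) u).
Proof.
move=> df.
have dl : is_diff s (fun t : R => a + t *: u) (fun t => t *: u).
  have -> : (fun t : R => t *: u) = cst 0 + (fun t => t *: u).
    by apply/funext => t; rewrite fctE add0r.
  exact: is_diffD.
have dc : differentiable (f \o (fun t : R => a + t *: u)) s.
  exact: differentiable_comp.
apply: DeriveDef; first exact: diff_derivable.
by rewrite deriveE // diff_compE // diff_val scale1r.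
Qed.

(** The mean value theorem is used twice: for the increment of [f] by [h *: v] as a function of the
    position along [u], then for the derivative along [u] as a function of the position along
    [v]. *)
Lemma second_difference (f : V -> R) (U : set V) (x u v : V) (h : R) :
  Ck 2 U f -> 0 < h ->
  (forall s t : R, 0 <= s <= h -> 0 <= t <= h -> U (x + s *: u + t *: v)) ->
  exists s t : R, [/\ 0 <= s <= h, 0 <= t <= h &
    f (x + h *: u + h *: v) - f (x + h *: u) - f (x + h *: v) + f x
    = h ^+ 2 * 'd (fun y => 'd f y u) (x + s *: u + t *: v) v].
Proof.
move=> [df Cf] h0 HU; have h00 : 0 <= h <= h by rewrite lexx ltW.
have z0 : (0 : R) <= 0 <= h by rewrite lexx ltW.
have HU0 s : 0 <= s <= h -> U (x + s *: u).
  by move=> sh; have := HU s 0 sh z0; rewrite scale0r addr0.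
pose g (s : R) := f ((x + h *: v) + s *: u) - f (x + s *: u).
pose g' (s : R) := 'd f ((x + h *: v) + s *: u) u - 'd f (x + s *: u) u.
have dg s : 0 <= s <= h -> is_derive s 1 g (g' s).
  move=> sh; apply: is_deriveB.
    by apply: is_derive_line; apply: df; rewrite addrAC; exact: HU.
  by apply: is_derive_line; apply: df; exact: HU0.
have [s /[!in_itv]/= sh gE] : exists2 c, c \in `[0, h]%R &
    g h - g 0 = g' c * (h - 0).
  apply: MVT_segment; first exact: ltW.
    by move=> s /[!in_itv]/= /andP[s0 sh]; apply: dg; rewrite !ltW.
  apply: derivable_within_continuous => s /[!in_itv]/= sh.
  by have := dg s sh => ?.
pose k (t : R) := 'd f (x + s *: u + t *: v) u.
have dk t : 0 <= t <= h -> is_derive t 1 k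
    ('d (fun y => 'd f y u) (x + s *: u + t *: v) v).
  move=> th; apply: (is_derive_line (f := fun y => 'd f y u)).
  by have [+ _] := Cf u; apply; exact: HU.
have [t /[!in_itv]/= th kE] : exists2 c, c \in `[0, h]%R &
    k h - k 0 = 'd (fun y => 'd f y u) (x + s *: u + c *: v) v * (h - 0).
  apply: MVT_segment; first exact: ltW.
    by move=> t /[!in_itv]/= /andP[t0 th]; apply: dk; rewrite !ltW.
  apply: derivable_within_continuous => t /[!in_itv]/= th.
  by have := dk t th => ?.
exists s, t; split=> //.
have gE' : g h - g 0 =
    f (x + h *: u + h *: v) - f (x + h *: u) - f (x + h *: v) + f x.
  rewrite /g !scale0r !addr0 [x + h *: v + _]addrAC opprB -addrA; ring.
have kE' : k h - k 0 = g' s.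
  by rewrite /k /g' scale0r addr0 [x + h *: v + _]addrAC.
by rewrite -gE' gE -kE' kE subr0 expr2 -mulrA mulrC.
Qed.

(** The second difference is symmetric in [u] and [v], so the two mixed derivatives take a common
    value at two points of a small parallelogram; continuity of both at [x] then identifies them
    there. *)
Lemma schwarz (f : V -> R) (U : set V) (x u v : V) :
  open U -> U x -> smooth_on U f ->
  'd (fun y => 'd f y u) x v = 'd (fun y => 'd f y v) x u.
Proof.
move=> oU Ux Sf; set A := fun u v y => 'd (fun y => 'd f y u) y v : R.
have cA u' v' : {for x, continuous (A u' v')}.
  have Sd : smooth_on U (A u' v') by do 2!apply: smooth_on_d.
  exact: (Sd 0%N).
suff H (e : R) (e0 : 0 < e) : `|A u v x - A v u x| <= e + e.
  apply/eqP; rewrite -subr_eq0 -normr_le0; apply/ler_addgt0Pr => e e0.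
  by rewrite add0r (splitr e); apply: H; rewrite divr_gt0.

have : \forall y \near x, [/\ U y, `|A u v x - A u v y| <= e &
    `|A v u x - A v u y| <= e].
  near=> y; split; near: y.
  - exact: open_nbhs_nbhs.
  - by have /cvgrPdist_le := cA u v; apply.
  - by have /cvgrPdist_le := cA v u; apply.
move=> /nbhs_normP[r /= r0 Hr].
(* The summand 1 keeps the denominator positive when both vectors vanish; the final halving gives
   the strict inequality that places the whole parallelogram in the ball of radius [r]. *)
pose h := r / (`|u| + `|v| + 1) / 2.
have den0 : 0 < `|u| + `|v| + 1 by rewrite ltr_wpDl // addr_ge0.
have h0 : 0 < h by rewrite !divr_gt0.
have Hin (s t : R) : 0 <= s <= h -> 0 <= t <= h ->
    [/\ U (x + s *: u + t *: v),
      `|A u v x - A u v (x + s *: u + t *: v)| <= e &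
      `|A v u x - A v u (x + s *: u + t *: v)| <= e].
  move=> /andP[s0 sh] /andP[t0 th]; apply: Hr => /=.
  rewrite -addrA opprD addrA subrr add0r normrN.
  apply: (le_lt_trans (ler_normD _ _)); rewrite !normrZ !ger0_norm //.
  have : s * `|u| + t * `|v| <= h * (`|u| + `|v| + 1).
    rewrite 2!mulrDr mulr1 -[X in X <= _]addr0; apply: lerD; last exact: ltW.
    by apply: lerD; apply: ler_wpM2r.
  move=> /le_lt_trans; apply.
  rewrite /h mulrAC divfK ?gt_eqF // ltr_pdivrMr // ltr_pMr // ltr1n.
  done.
have C2 : Ck 2 U f by exact: Sf.
have [s [t [sh th E1]]] := second_difference C2 h0
  (fun s t sh th => let: And3 p _ _ := Hin s t sh th in p).
have [t' [s' [th' sh' E2]]] := second_difference (u := v) (v := u) C2 h0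
  (fun t s th sh => let: And3 p _ _ := Hin s t sh th in
     eq_ind _ U p _ (addrAC _ _ _)).
have AE : A u v (x + s *: u + t *: v) = A v u (x + s' *: u + t' *: v).
  have h20 : h ^+ 2 != 0 by rewrite expf_neq0 // gt_eqF.
  apply: (mulfI h20); rewrite -[LHS]E1 [x + s' *: u + _]addrAC -[RHS]E2.
  rewrite [x + h *: v + _]addrAC; ring.
have [_ + _] := Hin s t sh th; have [_ _ +] := Hin s' t' sh' th'.
rewrite -AE => H2 H1.
have -> : A u v x - A v u x = (A u v x - A u v (x + s *: u + t *: v)) -
  (A v u x - A u v (x + s *: u + t *: v)) by ring.
by apply: (le_trans (ler_normB _ _)); exact: lerD.
Unshelve. all: by end_near. Qed.
End Schwarz.

Lemma near_openP (T : topologicalType) (P : set T) (p : T) :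
  (\forall q \near p, P q) -> exists2 U, open U /\ U p & U `<=` P.
Proof. by rewrite /prop_near1 nbhsE => -[U [oU Up] UP]; exists U. Qed.

(** In charts the base point [f x] is equal to the wanted coordinate only through [fwdK]; the
    equation as a hypothesis avoids rewriting inside a differential. *)
Lemma diff_compEy (R : realType) (V W Z : normedModType R) (f : V -> W)
    (g : W -> Z) x y v :
  f x = y -> differentiable f x -> differentiable g y ->
  'd (g \o f) x v = 'd g y ('d f x v).
Proof. by move=> <-; exact: diff_compE. Qed.

Lemma differentiable_compy (R : realType) (V W Z : normedModType R)
    (f : V -> W) (g : W -> Z) x y :
  f x = y -> differentiable f x -> differentiable g y ->
  differentiable (g \o f) x.
Proof. by move=> <-; exact: differentiable_comp. Qed.

(** * Smooth functions on manifolds *)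

Section SmoothNear.
Context {R : realType} {d : nat} {M : manifold R d}.

Lemma open_fwd (c : chart M) (U : set M) : open U -> open (fwd c @` (U `&` dom c)).
Proof.
move=> oU; rewrite openE => _ [p [Up cp] <-]; rewrite /interior.
have cpI : (fwd c @` dom c) (fwd c p) by exists p.
have Nc : nbhs (fwd c p) (fwd c @` dom c).
  by apply: open_nbhs_nbhs; split=> //; exact: cod_open.
have NU : nbhs (fwd c p) (bwd c @^-1` U).
  by apply: (bwd_continuous cpI); rewrite fwdK//; exact: open_nbhs_nbhs.
apply: filterS2 Nc NU => _ [q cq <-]; rewrite /preimage/= fwdK// => Uq.
by exists q.
Qed.

Lemma nbhs_dom (c : chart M) p : dom c p -> nbhs p (dom c).
Proof. by move=> cp; apply: open_nbhs_nbhs; split=> //; exact: dom_open. Qed.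

Lemma smooth_fun_sub (W : normedModType R) (U U' : set M) (f : M -> W) :
  U' `<=` U -> smooth_fun U f -> smooth_fun U' f.
Proof.
move=> sU sf c; apply: smooth_on_sub (sf c) => _ [p [/sU Up cp] <-].
by exists p.
Qed.

Lemma smooth_fun_cover (W : normedModType R) (U : set M) (f : M -> W) :
  (forall p, U p -> exists2 U', U' p & smooth_fun U' f) -> smooth_fun U f.
Proof.
move=> H c; apply: smooth_on_cover => _ [p [/H[U' U'p sf] cp] <-].
by exists (fwd c @` (U' `&` dom c)) => //; exists p.
Qed.

Lemma smooth_fun_near (W : normedModType R) (U : set M) (f : M -> W) :
  (forall p, U p -> smooth_near f p) -> smooth_fun U f.
Proof.
by move=> H; apply: smooth_fun_cover => p /H[U' [_ U'p sf]]; exists U'.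
Qed.

Lemma smooth_nearS (W : normedModType R) (f : M -> W) p :
  smooth_near f p -> \forall q \near p, smooth_near f q.
Proof.
move=> [U [oU Up sf]]; have : nbhs p U by exact: open_nbhs_nbhs.
by apply: filterS => q Uq; exists U.
Qed.

Lemma smooth_fun_eq (W : normedModType R) (U : set M) (f g : M -> W) :
  open U -> {in U, f =1 g} -> smooth_fun U f -> smooth_fun U g.
Proof.
move=> oU fg sf c; apply: smooth_on_eq (sf c); first exact: open_fwd.
by move=> _ /[!inE] -[p [Up cp] <-] /=; rewrite fwdK // fg ?inE.
Qed.

Lemma smooth_near_eq (W : normedModType R) (f g : M -> W) p :
  (\forall q \near p, f q = g q) -> smooth_near f p -> smooth_near g p.
Proof.
move=> /near_openP[U' [oU' U'p] fg] [U [oU Up sf]].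
exists (U `&` U'); split=> //; first exact: openI.
apply: (@smooth_fun_eq _ _ f); first exact: openI.
  by move=> q /[!inE] -[_ /fg].
by apply: smooth_fun_sub sf => q [].
Qed.

Lemma smooth_near_in_chart (W : normedModType R) (f : M -> W) p c :
  dom c p -> smooth_near f p -> exists O, [/\ open O, O (fwd c p),
    O `<=` fwd c @` dom c & smooth_on O (f \o bwd c)].
Proof.
move=> cp [U [oU Up sf]]; exists (fwd c @` (U `&` dom c)); split=> //.
- exact: open_fwd.
- by exists p.
- by move=> _ [q [_ cq] <-]; exists q.
Qed.

Lemma smooth_near_diff (W : normedModType R) (f : M -> W) p c :
  dom c p -> smooth_near f p -> differentiable (f \o bwd c) (fwd c p).
Proof.
move=> cp /(smooth_near_in_chart cp) [B [oB Bp _ sf]].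
exact: smooth_on_diff sf Bp.
Qed.

Lemma smooth_near_continuous (W : normedModType R) (f : M -> W) p :
  smooth_near f p -> {for p, continuous f}.
Proof.
move=> sf; have cp := mem_chart_at p; set c := chart_at p in cp.
have cf := differentiable_continuous (smooth_near_diff cp sf).
have ff : {for p, continuous ((f \o bwd c) \o fwd c)}.
  by apply: continuous_comp; [exact: fwd_continuous|exact: cf].
move: ff; rewrite /prop_for /continuous_at /= fwdK //.
apply: cvg_trans; apply: near_eq_cvg.
by apply: filterS (nbhs_dom cp) => q cq /=; rewrite fwdK.
Qed.

Lemma smooth_near_rowP m (f : M -> 'rV[R]_m) p :
  smooth_near f p <-> forall j, smooth_near (fun q => f q 0 j) p.
Proof.
split=> [[U [oU Up sf]] j|H].
  by exists U; split=> // c k; apply: Ck_coord; [exact: open_fwd|exact: sf].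
have /near_openP[U [oU Up] sU] :
    \forall q \near p, forall j, smooth_near (fun q => f q 0 j) q.
  by apply: filter_forall => j; exact/smooth_nearS/H.
exists U; split=> // c k; apply: Ck_row => [|j]; first exact: open_fwd.
have sj : smooth_fun U (fun q => f q 0 j).
  by apply: smooth_fun_near => q /sU; apply.
exact: sj.
Qed.

Lemma smooth_near_cst (W : normedModType R) (a : W) p :
  smooth_near (fun _ : M => a) p.
Proof. by exists setT; split=> // [|c k]; [exact: openT|exact: Ck_cst]. Qed.

Lemma smooth_near2 (W W' : normedModType R) (f : M -> W) (g : M -> W') p :
  smooth_near f p -> smooth_near g p ->
  exists U, [/\ open U, U p, smooth_fun U f & smooth_fun U g].
Proof.
move=> [U [oU Up sf]] [U' [oU' U'p sg]]; exists (U `&` U'); split=> //.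
- exact: openI.
- by apply: smooth_fun_sub sf => q [].
- by apply: smooth_fun_sub sg => q [].
Qed.

Lemma smooth_nearD (W : normedModType R) (f g : M -> W) p :
  smooth_near f p -> smooth_near g p -> smooth_near (fun q => f q + g q) p.
Proof.
move=> sf sg; have [U [oU Up Uf Ug]] := smooth_near2 sf sg.
exists U; split=> // c k.
by apply: CkD; [exact: open_fwd|exact: Uf|exact: Ug].
Qed.

Lemma smooth_nearM (f g : M -> R) p :
  smooth_near f p -> smooth_near g p -> smooth_near (fun q => f q * g q) p.
Proof.
move=> sf sg; have [U [oU Up Uf Ug]] := smooth_near2 sf sg.
exists U; split=> // c k.
by apply: CkM; [exact: open_fwd|exact: Uf|exact: Ug].
Qed.

Lemma smooth_nearN (f : M -> R) p :
  smooth_near f p -> smooth_near (fun q => - f q) p.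
Proof.
move=> sf; under eq_fun do rewrite -mulN1r.
by apply: smooth_nearM => //; exact: smooth_near_cst.
Qed.

Lemma smooth_nearB (f g : M -> R) p :
  smooth_near f p -> smooth_near g p -> smooth_near (fun q => f q - g q) p.
Proof. by move=> sf sg; apply: smooth_nearD => //; exact: smooth_nearN. Qed.

Lemma smooth_near_sum (I : Type) (r : seq I) (P : pred I) (F : I -> M -> R) p :
  (forall i, P i -> smooth_near (F i) p) ->
  smooth_near (fun q => \sum_(i <- r | P i) F i q) p.
Proof.
move=> H; elim: r => [|i r IH].
  by under eq_fun do rewrite big_nil; exact: smooth_near_cst.
have [Pi|nPi] := boolP (P i).
  by under eq_fun do rewrite big_cons Pi; apply: smooth_nearD => //; exact: H.
by under eq_fun do rewrite big_cons (negbTE nPi).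
Qed.

Lemma smooth_near_prod (I : Type) (r : seq I) (P : pred I) (F : I -> M -> R) p :
  (forall i, P i -> smooth_near (F i) p) ->
  smooth_near (fun q => \prod_(i <- r | P i) F i q) p.
Proof.
move=> H; elim: r => [|i r IH].
  by under eq_fun do rewrite big_nil; exact: smooth_near_cst.
have [Pi|nPi] := boolP (P i).
  by under eq_fun do rewrite big_cons Pi; apply: smooth_nearM => //; exact: H.
by under eq_fun do rewrite big_cons (negbTE nPi).
Qed.

Lemma smooth_near_comp_real (f : M -> R) (g : R -> R) (U' : set R) p :
  (\forall q \near p, U' (f q)) -> smooth_on U' g ->
  smooth_near f p -> smooth_near (fun q => g (f q)) p.
Proof.
move=> /near_openP[U1 [oU1 U1p] sU1] sg [U [oU Up sf]].
have oI : open (U `&` U1) by exact: openI.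
exists (U `&` U1); split=> // c k.
apply: (@Ck_comp_real _ _ _ _ U' (f \o bwd c) g); [exact: open_fwd| | |exact: sg].
- by move=> _ [q [[_ /sU1 U'q] cq] <-] /=; rewrite fwdK.
- apply: Ck_sub (sf c k) => _ [q [[Uq _] cq] <-].
  by exists q.
Qed.

Lemma smooth_nearV (f : M -> R) p :
  f p != 0 -> smooth_near f p -> smooth_near (fun q => (f q)^-1) p.
Proof.
move=> f0 sf; apply: (@smooth_near_comp_real _ (fun x => x^-1)
  [set x : R | x != 0]) (sf).
  have := smooth_near_continuous sf; apply.
  apply: open_nbhs_nbhs; split=> //; exact: open_neq.
by move=> k; apply: Ck_inv => //; do ?[exact: open_neq|exact: Ck_id].
Qed.

Lemma smooth_near_sqrt (f : M -> R) p :
  0 < f p -> smooth_near f p -> smooth_near (fun q => Num.sqrt (f q)) p.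
Proof.
move=> f0 sf; apply: (@smooth_near_comp_real _ _ [set x : R | 0 < x]) (sf).
  have := smooth_near_continuous sf; apply.
  apply: open_nbhs_nbhs; split=> //; exact: open_gt.
by move=> k; exact: Ck_sqrt.
Qed.

Lemma smooth_near_atan (f : M -> R) p :
  smooth_near f p -> smooth_near (fun q => atan (f q)) p.
Proof.
move=> sf; apply: (@smooth_near_comp_real _ _ setT) (sf).
  exact: nearW.
by move=> k; exact: Ck_atan.
Qed.

End SmoothNear.

(** * Tangent vectors and their components in charts *)

Section TangentTheory.
Context {R : realType} {d : nat} {M : manifold R d}.

Lemma compD (p : M) (u v : tangent p) c : (u + v) c = u c + v c.
Proof. by []. Qed.

Lemma compZ (p : M) a (u : tangent p) c : (a *: u) c = a *: u c.
Proof. by []. Qed.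

Lemma comp0 (p : M) c : (0 : tangent p) c = 0.
Proof. by []. Qed.

Lemma comp_sum (p : M) (I : Type) (r : seq I) (P : pred I)
    (F : I -> tangent p) c :
  (\sum_(i <- r | P i) F i) c = \sum_(i <- r | P i) F i c.
Proof. by elim/big_rec2: _ => // i y1 y2 _ <-. Qed.

Lemma comp_trans (p : M) (v : tangent p) c c' : dom c p -> dom c' p ->
  v c' = 'd (fwd c' \o bwd c) (fwd c p) (v c).
Proof. by case: v => v /= /asboolP[_]; exact. Qed.

(** The transition rule recovers the components in all other charts around [p], and those in charts
    away from [p] are zero by convention. *)
Lemma comp_inj (p : M) (u v : tangent p) c : dom c p -> u c = v c -> u = v.
Proof.
move=> cp uv; apply: val_inj; apply/funext => c' /=.
have [c'p|nc'p] := pselect (dom c' p).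
  by rewrite (comp_trans u cp c'p) uv -comp_trans.
by case: u uv => u /= /asboolP[u0 _] _; case: v => v /= /asboolP[v0 _];
  rewrite u0 // v0.
Qed.

Lemma transition_id (c : chart M) p v : dom c p ->
  'd (fwd c \o bwd c) (fwd c p) v = v.
Proof.
move=> cp; rewrite (@near_eq_diff _ _ _ _ id); first by rewrite diff_val.
- exact: transition_diff.
- exact: ex_diff.
- have : nbhs (fwd c p) (fwd c @` dom c).
    by apply: open_nbhs_nbhs; split; [exact: cod_open|exists p].
  by apply: filterS => _ [q cq <-] /=; rewrite fwdK.
Qed.

Lemma tangent_ofE (p : M) u : tangent_of p u (chart_at p) = u.
Proof.
have cp := mem_chart_at p; rewrite /tangent_of /= /tangent_of_comps.
by case: pselect => // ?; exact: transition_id.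
Qed.

(** Unlike [tangent_of], the component is prescribed in a chosen chart. As [chart_at] varies with
    the point without any regularity, this is what yields smooth coordinate fields. *)
Definition tangent_in (c : chart M) (p : M) (u : 'rV[R]_d) : tangent p :=
  tangent_of p ('d (fwd (chart_at p) \o bwd c) (fwd c p) u).

Lemma tangent_inE (c : chart M) p u : dom c p -> tangent_in c p u c = u.
Proof.
move=> cp; rewrite (comp_trans _ (mem_chart_at p) cp) tangent_ofE.
by rewrite -transition_comp ?transition_id //; exact: mem_chart_at.
Qed.

End TangentTheory.

(** * Derivatives of functions along tangent vectors *)

Section Dfun.
Context {R : realType} {d : nat} {M : manifold R d}.

Lemma dfun_is_linear (W : normedModType R) (f : M -> W) (p : M) :
  linear (dfun f (p := p)).
Proof. by move=> a u v; rewrite /dfun compD compZ linearP. Qed.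

Lemma dfun0 (W : normedModType R) (f : M -> W) (p : M) :
  dfun f (0 : tangent p) = 0.
Proof. by rewrite /dfun comp0 linear0. Qed.

(** Frees the derivative from the preferred chart [chart_at p], which may jump as [p] moves; the
    chain rule for the transition map gives the change of chart. *)
Lemma dfun_chart (f : M -> R) p c (v : tangent p) :
  dom c p -> smooth_near f p ->
  dfun f v = 'd (f \o bwd c) (fwd c p) (v c).
Proof.
move=> cp sf; rewrite /dfun; set c' := chart_at p.
have c'p : dom c' p by exact: mem_chart_at.
have d1 := transition_diff cp c'p.
have e1 : (fwd c' \o bwd c) (fwd c p) = fwd c' p by rewrite /= fwdK.
have d2 : differentiable (f \o bwd c') (fwd c' p) by exact: smooth_near_diff.
rewrite (comp_trans v cp c'p); apply: (etrans (esym (diff_compEy (v c) e1 d1 d2))).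
apply: near_eq_diff; [exact: differentiable_compy e1 d1 d2|exact: smooth_near_diff|].
have : nbhs (fwd c p) (fwd c @` (dom c' `&` dom c)).
  by apply: open_nbhs_nbhs; split; [exact/open_fwd/dom_open|exists p].
by apply: filterS => _ [q [c'q cq] <-] /=; rewrite !fwdK.
Qed.

Lemma near_bwd (c : chart M) p (P : set M) : dom c p ->
  (\forall q \near p, P q) -> \forall y \near fwd c p, P (bwd c y).
Proof.
move=> cp Pp.
have := @bwd_continuous _ _ M c (fwd c p) (ex_intro2 _ _ p cp erefl).
rewrite /prop_for /continuous_at fwdK //; exact.
Qed.

Lemma dfun_eq (W : normedModType R) (f g : M -> W) p (v : tangent p) :
  smooth_near f p -> (\forall q \near p, f q = g q) -> dfun f v = dfun g v.
Proof.
move=> sf fg; have cp := mem_chart_at p.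
apply: near_eq_diff; do ?exact: smooth_near_diff.
  by apply: smooth_near_diff => //; exact: smooth_near_eq fg sf.
exact: (near_bwd cp fg).
Qed.

Lemma dfun_cst (W : normedModType R) (a : W) p (v : tangent p) :
  dfun (fun _ : M => a) v = 0.
Proof. by rewrite /dfun (diff_cst a). Qed.

Lemma dfun_near_cst (f : M -> R) (a : R) p (v : tangent p) :
  (\forall q \near p, f q = a) -> dfun f v = 0.
Proof.
move=> fa; have af : \forall q \near p, a = f q by apply: filterS fa => q ->.
by rewrite -(dfun_eq v (@smooth_near_cst _ _ _ _ a p) af) dfun_cst.
Qed.

Lemma dfunD (W : normedModType R) (f g : M -> W) p (v : tangent p) :
  smooth_near f p -> smooth_near g p ->
  dfun (fun q => f q + g q) v = dfun f v + dfun g v.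
Proof.
move=> sf sg; have cp := mem_chart_at p.
by rewrite /dfun [LHS](congr1 (@^~ (v (chart_at p)))
  (diffD (smooth_near_diff cp sf) (smooth_near_diff cp sg))).
Qed.

Lemma dfunM (f g : M -> R) p (v : tangent p) :
  smooth_near f p -> smooth_near g p ->
  dfun (fun q => f q * g q) v = f p * dfun g v + g p * dfun f v.
Proof.
move=> sf sg; have cp := mem_chart_at p.
rewrite /dfun [LHS](congr1 (@^~ (v (chart_at p)))
  (diffM (smooth_near_diff cp sf) (smooth_near_diff cp sg))).
by rewrite /= fwdK.
Qed.

Lemma dfunN (f : M -> R) p (v : tangent p) :
  smooth_near f p -> dfun (fun q => - f q) v = - dfun f v.
Proof.
move=> sf; under eq_fun do rewrite -mulN1r.
by rewrite dfunM ?dfun_cst ?mulr0 ?addr0 ?mulN1r //; exact: smooth_near_cst.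
Qed.

Lemma dfunB (f g : M -> R) p (v : tangent p) :
  smooth_near f p -> smooth_near g p ->
  dfun (fun q => f q - g q) v = dfun f v - dfun g v.
Proof.
by move=> sf sg; rewrite dfunD ?dfunN //; exact: smooth_nearN.
Qed.

Lemma dfun_sum (I : Type) (r : seq I) (P : pred I) (F : I -> M -> R) p
    (v : tangent p) :
  (forall i, P i -> smooth_near (F i) p) ->
  dfun (fun q => \sum_(i <- r | P i) F i q) v =
  \sum_(i <- r | P i) dfun (F i) v.
Proof.
move=> H; elim: r => [|i r IH].
  by rewrite big_nil; under eq_fun do rewrite big_nil; rewrite dfun_cst.
have [Pi|nPi] := boolP (P i).
  rewrite big_cons Pi; under eq_fun do rewrite big_cons Pi.
  by rewrite dfunD ?IH //; [exact: H|exact: smooth_near_sum].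
rewrite big_cons (negbTE nPi); under eq_fun do rewrite big_cons (negbTE nPi).
exact: IH.
Qed.

Lemma dfun_comp_real (f : M -> R) (g : R -> R) p (v : tangent p) :
  smooth_near f p -> differentiable g (f p) ->
  dfun (fun q => g (f q)) v = dfun f v * 'd g (f p) 1.
Proof.
move=> sf dg; have cp := mem_chart_at p.
have df := smooth_near_diff cp sf.
have e1 : (f \o bwd (chart_at p)) (fwd (chart_at p) p) = f p by rewrite /= fwdK.
by rewrite /dfun [LHS](diff_compEy _ e1 df dg) [LHS]diff_realE.
Qed.

Lemma dfun_row m (f : M -> 'rV[R]_m) p (v : tangent p) j :
  smooth_near f p -> dfun (fun q => f q 0 j) v = dfun f v 0 j.
Proof.
by move=> sf; apply: diff_coord; apply: smooth_near_diff => //;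
  exact: mem_chart_at.
Qed.

End Dfun.

(** * Pull-back of functions along smooth maps *)

Section SmoothMaps.
Context {R : realType} {d : nat} {N : manifold R d}.

Lemma smooth_near_comp_row m (f : N -> 'rV[R]_m) (g : 'rV[R]_m -> R)
    (U' : set 'rV[R]_m) p :
  (\forall q \near p, U' (f q)) -> smooth_on U' g ->
  smooth_near f p -> smooth_near (fun q => g (f q)) p.
Proof.
move=> /near_openP[U1 [oU1 U1p] sU1] sg [U [oU Up sf]].
have oI : open (U `&` U1) by exact: openI.
exists (U `&` U1); split=> // c k.
apply: (@Ck_comp _ _ _ _ _ U' (f \o bwd c) g); [exact: open_fwd| | |exact: sg].
- by move=> _ [q [[_ /sU1 U'q] cq] <-] /=; rewrite fwdK.
- apply: Ck_sub (sf c k) => _ [q [[Uq _] cq] <-].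
  by exists q.
Qed.

Lemma dfun_comp_row m (f : N -> 'rV[R]_m) (g : 'rV[R]_m -> R) p
    (v : tangent p) :
  smooth_near f p -> differentiable g (f p) ->
  dfun (fun q => g (f q)) v = 'd g (f p) (dfun f v).
Proof.
move=> sf dg; have cp := mem_chart_at p.
have df := smooth_near_diff cp sf.
have e1 : (f \o bwd (chart_at p)) (fwd (chart_at p) p) = f p by rewrite /= fwdK.
by rewrite /dfun [LHS](diff_compEy _ e1 df dg).
Qed.

Context {m : nat} {M : manifold R m}.
Variable h : N -> M.
Hypothesis sh : smooth_map h.

Lemma smooth_map_near (P : set M) x :
  (\forall p \near h x, P p) -> \forall y \near x, P (h y).
Proof. by move: sh => [ch _] HP; apply: (ch x P). Qed.

Lemma near_dom_map (c : chart M) x : dom c (h x) -> \forall y \near x, dom c (h y).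
Proof. by move=> cx; apply: smooth_map_near; exact: nbhs_dom. Qed.

Lemma smooth_near_fwd (c : chart M) x :
  dom c (h x) -> smooth_near (fwd c \o h) x.
Proof.
move=> cx; have /near_openP[U [oU Ux] sU] := near_dom_map cx.
exists U; split=> //; apply: smooth_fun_sub (sh.2 c).
by move=> y /sU.
Qed.

Lemma smooth_near_pull (f : M -> R) x :
  smooth_near f (h x) -> smooth_near (fun y => f (h y)) x.
Proof.
move=> sf; have cx := mem_chart_at (h x); set c := chart_at _ in cx.
have [B [oB Bx _ sB]] := smooth_near_in_chart cx sf.
apply: (@smooth_near_eq _ _ _ _ (fun y => (f \o bwd c) (fwd c (h y)))).
  by apply: filterS (near_dom_map cx) => y cy /=; rewrite fwdK.
apply: (smooth_near_comp_row _ sB); last exact: smooth_near_fwd.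
apply: (smooth_map_near (P := fun p => B (fwd c p))).
by apply: (fwd_continuous cx); apply: open_nbhs_nbhs.
Qed.

Lemma dfun_push (f : M -> R) x (v : tangent x) :
  smooth_near f (h x) -> dfun (fun y => f (h y)) v = dfun f (push h v).
Proof.
move=> sf; have cx := mem_chart_at (h x); set c := chart_at _ in cx.
have [B [oB Bx _ sB]] := smooth_near_in_chart cx sf.
transitivity (dfun (fun y => (f \o bwd c) (fwd c (h y))) v).
  apply: dfun_eq; first exact: smooth_near_pull.
  by apply: filterS (near_dom_map cx) => y cy /=; rewrite fwdK.
rewrite (dfun_comp_row (f := fwd c \o h)); first last.
- exact: smooth_near_diff.
- exact: smooth_near_fwd.
- by rewrite /push [RHS]/dfun tangent_ofE.
Qed.

Lemma push_is_linear x : linear (push h (x := x)).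
Proof.
move=> a u v; apply: (comp_inj (mem_chart_at (h x))).
by rewrite compD compZ !tangent_ofE dfun_is_linear.
Qed.

End SmoothMaps.

Lemma smooth_map_id (R : realType) (d : nat) (M : manifold R d) :
  smooth_map (@idfun M).
Proof.
split=> [x|c]; first exact: cvg_id.
by move=> c'; apply: smooth_on_sub (transition_smooth c' c) => _ [p [cp c'p] <-];
  exists p.
Qed.

(** * Sections, frames and connections *)

Section LocalSections.
Context {R : realType} {d m : nat} {N : manifold R d} {M : manifold R m}.
Variable h : N -> M.
Hypothesis sh : smooth_map h.

Notation section := (forall x : N, tangent (h x)).
Notation lsec := (local_section (whole h)).

Lemma local_sectionW (W : forall x : N, set (tangent (h x))) x s :
  local_section W x s <-> lsec x s /\ \forall y \near x, W y (s y).
Proof.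
split=> [[U [oU Ux sU WU]]|[[U [oU Ux sU _]] /near_openP[U' [oU' U'x] sU']]].
  by split; [exists U | apply: filterS (open_nbhs_nbhs (conj oU Ux)) => y /WU].
exists (U `&` U'); split=> //; first exact: openI.
  by move=> c; apply: smooth_fun_sub (sU c) => y [[Uy _] cy].
by move=> y [_ /sU'].
Qed.

Lemma smooth_near_section (s : section) x c : dom c (h x) -> lsec x s ->
  smooth_near (fun y => s y c) x.
Proof.
move=> cx [U [oU Ux sU _]].
have /near_openP[U' [oU' U'x] sU'] := near_dom_map sh cx.
exists (U `&` U'); split=> //; first exact: openI.
by apply: smooth_fun_sub (sU c) => y [Uy /sU'].
Qed.

Lemma smooth_near_comp (s : section) x c j : dom c (h x) -> lsec x s ->
  smooth_near (fun y => s y c 0 j) x.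
Proof. by move=> cx /(smooth_near_section cx)/smooth_near_rowP. Qed.

(** In any other chart the components are combinations of the given ones, with coefficients the
    partial derivatives of the transition map, evaluated along [h]. *)
Lemma local_section_comp (s : section) x c : dom c (h x) ->
  (forall j, smooth_near (fun y => s y c 0 j) x) -> lsec x s.
Proof.
move=> cx /smooth_near_rowP[U [oU Ux sU]].
have /near_openP[U' [oU' U'x] sU'] := near_dom_map sh cx.
exists (U `&` U'); split=> //; first exact: openI.
move=> c'; apply: smooth_fun_near => y [[Uy /sU' cy] c'y].
apply/smooth_near_rowP => i; pose D := fwd c @` (dom c `&` dom c').
apply: (@smooth_near_eq _ _ _ _ (fun z => \sum_j s z c 0 j *
    'd (fwd c' \o bwd c) (fwd c (h z)) (delta_mx 0 j) 0 i)).
  near=> z.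
  have cz : dom c (h z) by near: z; exact: near_dom_map.
  have c'z : dom c' (h z) by near: z; exact: near_dom_map.
  rewrite (comp_trans _ cz c'z) [in RHS]diff_rowE summxE.
  by apply: eq_bigr => j _; rewrite mxE.
apply: smooth_near_sum => j _; apply: smooth_nearM.
  suff : smooth_near (fun y => s y c) y by move/smooth_near_rowP; apply.
  by exists U; split.
apply: (@smooth_near_comp_row _ _ _ _ (fwd c \o h)
  (fun z => 'd (fwd c' \o bwd c) z (delta_mx 0 j) 0 i) D).
- near=> z; exists (h z) => //; split; near: z; exact: near_dom_map.
- move=> k; apply: Ck_coord; first exact: open_overlap.
  exact/smooth_on_d/transition_smooth.
- exact: smooth_near_fwd.
Unshelve. all: by end_near. Qed.

Lemma local_section_eq (s t : section) x :
  (\forall y \near x, s y = t y) -> lsec x s -> lsec x t.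
Proof.
move=> st ls; apply: (local_section_comp (mem_chart_at (h x))) => j.
apply: smooth_near_eq (smooth_near_comp j (mem_chart_at _) ls).
by apply: filterS st => y ->.
Qed.

Lemma local_sectionD (s t : section) x :
  lsec x s -> lsec x t -> lsec x (fun y => s y + t y).
Proof.
move=> ls lt; apply: (local_section_comp (mem_chart_at (h x))) => j.
under eq_fun do rewrite compD mxE.
by apply: smooth_nearD; apply: smooth_near_comp => //; exact: mem_chart_at.
Qed.

Lemma local_sectionZ (f : N -> R) (s : section) x :
  smooth_near f x -> lsec x s -> lsec x (fun y => f y *: s y).
Proof.
move=> sf ls; apply: (local_section_comp (mem_chart_at (h x))) => j.
under eq_fun do rewrite compZ mxE.
by apply: smooth_nearM => //; apply: smooth_near_comp => //; exact: mem_chart_at.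
Qed.

Lemma local_section0 x : lsec x (fun y => 0).
Proof.
apply: (local_section_comp (mem_chart_at (h x))) => j.
under eq_fun do rewrite comp0 mxE; exact: smooth_near_cst.
Qed.

Lemma local_section_sum (I : Type) (r : seq I) (P : pred I) (F : I -> section) x :
  (forall i, P i -> lsec x (F i)) ->
  lsec x (fun y => \sum_(i <- r | P i) F i y).
Proof.
move=> H; apply: (local_section_comp (mem_chart_at (h x))) => j.
under eq_fun do rewrite comp_sum summxE.
apply: smooth_near_sum => i Pi; apply: smooth_near_comp; first exact: mem_chart_at.
exact: H.
Qed.

Lemma smooth_sectionP (U : set N) (s : section) :
  open U -> (smooth_section U s <-> forall x, U x -> lsec x s).
Proof.
move=> oU; split=> [sU x Ux|H c]; first by exists U.
by apply: smooth_fun_near => y [Uy cy]; apply: smooth_near_section => //; exact: H.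
Qed.

Lemma local_sectionS (s : section) x :
  lsec x s -> \forall y \near x, lsec y s.
Proof.
move=> [U [oU Ux sU _]].
by apply: filterS (open_nbhs_nbhs (conj oU Ux)) => y Uy; exists U.
Qed.

End LocalSections.

(** * Vector fields and the Lie bracket *)

Section VectorFields.
Context {R : realType} {d : nat} {M : manifold R d}.

Notation vfield := (forall p : M, tangent p).

Lemma compN (p : M) (u : tangent p) c : (- u) c = - u c.
Proof. by []. Qed.

Lemma local_vfield_tangent_in (c : chart M) (u : 'rV[R]_d) p :
  dom c p -> local_vfield p (fun q => tangent_in c q u).
Proof.
move=> cp; apply: (local_section_comp (smooth_map_id M) cp) => j.
apply: (@smooth_near_eq _ _ _ _ (fun _ => u 0 j)).
  by apply: filterS (nbhs_dom cp) => q cq; rewrite tangent_inE.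
exact: smooth_near_cst.
Qed.

(** Closedness, integrability and connections are stated for fields; a field with constant
    components in one chart turns them into statements about single vectors. *)
Lemma vfield_extension p (v : tangent p) :
  exists2 X : vfield, local_vfield p X & X p = v.
Proof.
have cp := mem_chart_at p; exists (fun q => tangent_in (chart_at p) q (v (chart_at p))).
  exact: local_vfield_tangent_in.
by apply: (comp_inj cp); rewrite tangent_inE.
Qed.

Lemma smooth_near_dcoord (f : M -> R) p c u : dom c p -> smooth_near f p ->
  smooth_near (fun q => 'd (f \o bwd c) (fwd c q) u) p.
Proof.
move=> cp sf; have [B [oB Bp _ sB]] := smooth_near_in_chart cp sf.
apply: (@smooth_near_comp_row _ _ _ _ (fwd c)
  (fun z => 'd (f \o bwd c) z u) B).
- by apply: (fwd_continuous cp); exact: open_nbhs_nbhs.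
- exact: smooth_on_d.
- exact: (smooth_near_fwd (smooth_map_id M) cp).
Qed.

Lemma dfun_coord (f : M -> R) c (X : vfield) p : dom c p -> smooth_near f p ->
  \forall q \near p, dfun f (X q) =
    \sum_j X q c 0 j * 'd (f \o bwd c) (fwd c q) (delta_mx 0 j).
Proof.
move=> cp sf; near=> q.
have cq : dom c q by near: q; exact: nbhs_dom.
have sfq : smooth_near f q by near: q; exact: smooth_nearS.
by rewrite (dfun_chart _ cq sfq) diff_rowE.
Unshelve. all: by end_near. Qed.

Lemma smooth_near_dfun (f : M -> R) (X : vfield) p :
  smooth_near f p -> local_vfield p X ->
  smooth_near (fun q => dfun f (X q)) p.
Proof.
move=> sf lX; have cp := mem_chart_at p.
apply: (@smooth_near_eq _ _ _ _ (fun q => \sum_j X q (chart_at p) 0 j *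
  'd (f \o bwd (chart_at p)) (fwd (chart_at p) q) (delta_mx 0 j))).
  by apply: filterS (dfun_coord X cp sf) => q ->.
apply: smooth_near_sum => j _; apply: smooth_nearM.
  exact: (smooth_near_comp (smooth_map_id M)).
exact: smooth_near_dcoord.
Qed.

Lemma dfun_dcoord (f : M -> R) p u (v : tangent p) : smooth_near f p ->
  dfun (fun q => 'd (f \o bwd (chart_at p)) (fwd (chart_at p) q) u) v =
  'd (fun z => 'd (f \o bwd (chart_at p)) z u) (fwd (chart_at p) p)
    (v (chart_at p)).
Proof.
move=> sf; have cp := mem_chart_at p; set c := chart_at p in cp *.
have [B [oB Bp Bc sB]] := smooth_near_in_chart cp sf.
apply: near_eq_diff.
- exact: (smooth_near_diff cp (smooth_near_dcoord u cp sf)).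
- by apply: (smooth_on_diff _ Bp); exact: smooth_on_d.
- apply: filterS (open_nbhs_nbhs (conj oB Bp)) => z /Bc[q cq <-] /=.
  by rewrite fwdK.
Qed.

(** Separates the second-order part, the Hessian of [f] in the chart, from the part that
    differentiates the components of [Y]; only the latter survives in a commutator. *)
Lemma dfun_dfun (f : M -> R) (X Y : vfield) p :
  smooth_near f p -> local_vfield p X -> local_vfield p Y ->
  dfun (fun q => dfun f (Y q)) (X p) =
    \sum_j Y p (chart_at p) 0 j *
      'd (fun z => 'd (f \o bwd (chart_at p)) z (delta_mx 0 j))
        (fwd (chart_at p) p) (X p (chart_at p))
    + dfun f (tangent_of p (dfun (fun q => Y q (chart_at p)) (X p))).
Proof.
move=> sf lX lY; have cp := mem_chart_at p.
rewrite (dfun_eq _ (smooth_near_dfun sf lY) (dfun_coord Y cp sf)).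
have sY j : smooth_near (fun q => Y q (chart_at p) 0 j) p.
  exact: (smooth_near_comp (smooth_map_id M)).
rewrite dfun_sum; last first.
  by move=> j _; apply: smooth_nearM => //; exact: smooth_near_dcoord.
rewrite [X in _ + X](dfun_chart _ cp sf) tangent_ofE [X in _ + X]diff_rowE.
rewrite -big_split /=.
apply: eq_bigr => j _.
rewrite dfunM //; last exact: smooth_near_dcoord.
rewrite dfun_dcoord //; congr (_ + _); rewrite mulrC; congr (_ * _).
by apply: dfun_row; exact: (smooth_near_section (smooth_map_id M)).
Qed.

(** [lie_bracket] is defined by components in one chart; the Hessian terms of the two iterated
    derivatives cancel by [schwarz]. *)
Lemma dfun_bracket (f : M -> R) (X Y : vfield) p :
  smooth_near f p -> local_vfield p X -> local_vfield p Y ->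
  dfun f (lie_bracket X Y p) =
  dfun (fun q => dfun f (Y q)) (X p) - dfun (fun q => dfun f (X q)) (Y p).
Proof.
move=> sf lX lY; have cp := mem_chart_at p.
rewrite !dfun_dfun //; set c := chart_at p in cp *; set F := f \o bwd c.
have -> : \sum_j Y p c 0 j * 'd (fun z => 'd F z (delta_mx 0 j)) (fwd c p) (X p c) =
    \sum_j X p c 0 j * 'd (fun z => 'd F z (delta_mx 0 j)) (fwd c p) (Y p c).
  under eq_bigr do rewrite [X in _ * X]diff_rowE mulr_sumr.
  rewrite exchange_big /=; apply: eq_bigr => i _.
  rewrite [X in _ = _ * X]diff_rowE mulr_sumr; apply: eq_bigr => j _.
  have [B [oB Bp Bc sB]] := smooth_near_in_chart cp sf.
  rewrite [LHS]mulrCA; congr (_ * (_ * _)).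
  exact: schwarz oB Bp sB.
rewrite addrAC opprD addrA subrr add0r addrC.
rewrite !(dfun_chart _ cp sf) !tangent_ofE.
by rewrite -[RHS](linearB ('d F (fwd c p))).
Qed.

Lemma lie_bracketC (X Y : vfield) p : lie_bracket X Y p = - lie_bracket Y X p.
Proof.
by apply: (comp_inj (mem_chart_at p)); rewrite compN !tangent_ofE opprB.
Qed.

End VectorFields.

(** * Closedness from local primitives *)

Section LocallyExact.
Context {R : realType} {d : nat} {N : manifold R d}.

Definition exact_near (theta : forall x : N, tangent x -> R) (x : N) : Prop :=
  exists2 f : N -> R, smooth_near f x &
    \forall y \near x, forall v : tangent y, theta y v = dfun f v.

(** Near each point [theta] is a differential, and [ext_d1] of a differential vanishes by
    [dfun_bracket]. Smoothness of [theta] comes with the primitive, so a form chosen pointwise can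
    be treated. *)
Lemma closed_of_exact_near (theta : forall x : N, tangent x -> R) :
  (forall x, exact_near theta x) -> closed_form1 theta.
Proof.
move=> H; split; first split.
- move=> x a u v; have [f _ /nbhs_singleton E] := H x.
  by rewrite !E dfun_is_linear.
- move=> x X lX; have [f sf E] := H x.
  by apply: smooth_near_eq (smooth_near_dfun sf lX); apply: filterS E => y ->.
- move=> x X Y lX lY; have [f sf E] := H x.
  have dE (Z Z' : forall y : N, tangent y) : local_vfield x Z ->
      dfun (fun y => theta y (Z y)) (Z' x) = dfun (fun y => dfun f (Z y)) (Z' x).
    move=> lZ; apply/esym/dfun_eq; first exact: smooth_near_dfun.
    by apply: filterS E => y ->.
  rewrite /ext_d1 !dE // (nbhs_singleton E) dfun_bracket //.
  by rewrite subrr.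
Qed.

End LocallyExact.

Section SmoothMatrices.
Context {R : realType} {d : nat} {N : manifold R d}.

Lemma near_neq0 (f : N -> R) x :
  smooth_near f x -> f x != 0 -> \forall y \near x, f y != 0.
Proof.
move=> sf f0; apply: (smooth_near_continuous sf (t := [set z | z != 0])).
by apply: open_nbhs_nbhs; split=> //; exact: open_neq.
Qed.

Lemma near_gt0 (f : N -> R) x :
  smooth_near f x -> 0 < f x -> \forall y \near x, 0 < f y.
Proof.
move=> sf f0; apply: (smooth_near_continuous sf (t := [set z | 0 < z])).
by apply: open_nbhs_nbhs; split=> //; exact: open_gt.
Qed.

Lemma smooth_near_det n (A : N -> 'M[R]_n) x :
  (forall i j, smooth_near (fun y => A y i j) x) ->
  smooth_near (fun y => \det (A y)) x.
Proof.
move=> sA; apply: smooth_near_sum => s _; apply: smooth_nearM.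
  exact: smooth_near_cst.
by apply: smooth_near_prod => i _.
Qed.

(** Near [x] the determinant stays nonzero, so [invmx] is the adjugate divided by the determinant, a
    rational expression in the entries. *)
Lemma smooth_near_invmx n (A : N -> 'M[R]_n) x i j :
  (forall i j, smooth_near (fun y => A y i j) x) -> A x \in unitmx ->
  smooth_near (fun y => invmx (A y) i j) x.
Proof.
move=> sA uA; have sd := smooth_near_det sA.
apply: (@smooth_near_eq _ _ _ _ (fun y => (\det (A y))^-1 * cofactor (A y) j i)).
  have : \forall y \near x, \det (A y) != 0.
    by apply: near_neq0 => //; rewrite -unitfE.
  apply: filterS => y dy.
  by rewrite /invmx unitmxE unitfE dy !mxE.
apply: smooth_nearM; first by apply: smooth_nearV => //; rewrite -unitfE.
apply: smooth_nearM; first exact: smooth_near_cst.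
by apply: smooth_near_det => k l; under eq_fun do rewrite !mxE; exact: sA.
Qed.
End SmoothMatrices.

(** * Rewriting rules for maps known to be linear only by a hypothesis *)

Section PropLinear.
Context {R : realType} {V W : lmodType R}.
Implicit Types (f : V -> W) (g : V -> R).

Lemma plinD f : linear f -> {morph f : u v / u + v}.
Proof. by move=> lf u v; have := lf 1 u v; rewrite !scale1r. Qed.

Lemma plin0 f : linear f -> f 0 = 0.
Proof. by move=> lf; apply: (addIr (f 0)); rewrite -plinD // !add0r. Qed.

Lemma plinZ f : linear f -> forall a, {morph f : u / a *: u}.
Proof. by move=> lf a u; have := lf a u 0; rewrite !addr0 (plin0 lf) addr0. Qed.

Lemma plinN f : linear f -> {morph f : u / - u}.
Proof. by move=> lf u; rewrite -scaleN1r plinZ // scaleN1r. Qed.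

Lemma plinB f : linear f -> {morph f : u v / u - v}.
Proof. by move=> lf u v; rewrite plinD // plinN. Qed.

Lemma plin_sum f : linear f ->
  forall (I : Type) (r : seq I) (P : pred I) (F : I -> V),
  f (\sum_(i <- r | P i) F i) = \sum_(i <- r | P i) f (F i).
Proof. by move=> lf I r P F; exact: (big_morph f (plinD lf) (plin0 lf)). Qed.

Lemma pscaD g : scalar g -> {morph g : u v / u + v}.
Proof. by move=> lg u v; have := lg 1 u v; rewrite scale1r mul1r. Qed.

Lemma psca0 g : scalar g -> g 0 = 0.
Proof. by move=> lg; apply: (addIr (g 0)); rewrite -pscaD // !add0r. Qed.

Lemma pscaZ g : scalar g -> forall a, {morph g : u / a *: u >-> a * u}.
Proof. by move=> lg a u; have := lg a u 0; rewrite !addr0 (psca0 lg) addr0. Qed.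

Lemma pscaN g : scalar g -> {morph g : u / - u}.
Proof. by move=> lg u; rewrite -scaleN1r pscaZ // mulN1r. Qed.

Lemma psca_sum g : scalar g ->
  forall (I : Type) (r : seq I) (P : pred I) (F : I -> V),
  g (\sum_(i <- r | P i) F i) = \sum_(i <- r | P i) g (F i).
Proof. by move=> lg I r P F; exact: (big_morph g (pscaD lg) (psca0 lg)). Qed.

End PropLinear.

(** * Frames and tensors tested on frames *)

Section Frames.
Context {R : realType}.

Definition indep (V : lmodType R) (I : finType) (e : I -> V) : Prop :=
  forall a : I -> R, \sum_i a i *: e i = 0 -> forall i, a i = 0.

(** The dimension of the manifold is written as [#|I|] so that the matrix is square for any index
    type, in particular for the sum types indexing a frame and its image under [S] or [J]. *)
Definition frame_mx (I : finType) (M : manifold R #|I|) (c : chart M) (p : M)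
    (e : I -> tangent p) : 'M[R]_#|I| :=
  \matrix_(i, j) e (enum_val i) c 0 j.

Lemma frame_mx_sum (I : finType) (M : manifold R #|I|) (c : chart M) (p : M)
    (e : I -> tangent p) (a : 'rV[R]_#|I|) :
  (\sum_i a 0 (enum_rank i) *: e i) c = a *m frame_mx c e.
Proof.
rewrite comp_sum mulmx_sum_row (reindex (@enum_val I I)) /=; last first.
  by apply: onW_bij; exact: enum_val_bij.
apply: eq_bigr => i _; rewrite enum_valK; congr (_ *: _).
by apply/rowP => j; rewrite !mxE.
Qed.

Lemma indep_frame_mx (I : finType) (M : manifold R #|I|) (c : chart M) (p : M)
    (e : I -> tangent p) : dom c p -> indep e <-> frame_mx c e \in unitmx.
Proof.
move=> cp; split=> [ie|ue a a0 i].
  rewrite -row_free_unit; apply/inj_row_free => a a0; apply/rowP => i.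
  rewrite mxE -(enum_valK i).
  apply: (ie (fun i => a 0 (enum_rank i))); apply: (comp_inj cp).
  by rewrite frame_mx_sum a0.
pose b : 'rV[R]_#|I| := \row_j a (enum_val j).
have aE j : b 0 (enum_rank j) = a j by rewrite mxE enum_rankK.
rewrite -aE; suff -> : b = 0 by rewrite mxE.
apply: (can_inj (mulmxK ue)); rewrite mul0mx -frame_mx_sum.
by under eq_bigr do rewrite aE; rewrite a0.
Qed.

Lemma indep_span m (M : manifold R m) (I : finType) (p : M)
    (e : I -> tangent p) : m = #|I| -> indep e ->
  forall u, exists a : I -> R, u = \sum_i a i *: e i.
Proof.
move=> mI; subst m => ie u; have cp := mem_chart_at p.
have ue : frame_mx (chart_at p) e \in unitmx by apply/indep_frame_mx.
exists (fun i => (u (chart_at p) *m invmx (frame_mx (chart_at p) e)) 0 (enum_rank i)).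
by apply: (comp_inj cp); rewrite frame_mx_sum mulmxKV.
Qed.

Context {d m : nat} {N : manifold R d} {M : manifold R m}.
Variable h : N -> M.
Hypothesis sh : smooth_map h.

Notation section := (forall x : N, tangent (h x)).
Notation lsec := (local_section (whole h)).

(** The matrix of components of the frame is invertible at [x], hence nearby; multiplying the
    components of [s] by its inverse gives the coefficients, which are smooth. *)
Lemma frame_near (I : finType) (e : I -> section) x : m = #|I| ->
  (forall i, lsec x (e i)) -> indep (e^~ x) ->
  (\forall y \near x, indep (e^~ y)) /\
  forall s, lsec x s -> exists a : I -> N -> R,
    (forall i, smooth_near (a i) x) /\
    \forall y \near x, s y = \sum_i a i y *: e i y.
Proof.
move=> mI; subst m => le ie; have cx := mem_chart_at (h x).
set c := chart_at _ in cx; pose F y := frame_mx c (e^~ y).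
have sF i j : smooth_near (fun y => F y i j) x.
  by under eq_fun do rewrite mxE; exact: smooth_near_comp.
have uF : F x \in unitmx by apply/indep_frame_mx.
have nF : \forall y \near x, dom c (h y) /\ F y \in unitmx.
  near=> y; split; first by near: y; exact: near_dom_map.
  rewrite unitmxE unitfE; near: y.
  apply: near_neq0; first exact: smooth_near_det.
  by rewrite -unitfE -unitmxE.
split; first by apply: filterS nF => y [cy /(indep_frame_mx _ cy)].
move=> s ls; exists (fun i y => (s y c *m invmx (F y)) 0 (enum_rank i)).
split=> [i|].
  under eq_fun do rewrite mxE; apply: smooth_near_sum => j _.
  by apply: smooth_nearM; [exact: smooth_near_comp|exact: smooth_near_invmx].
apply: filterS nF => y [cy uy]; apply: (comp_inj cy).
by rewrite frame_mx_sum mulmxKV.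
Unshelve. all: by end_near. Qed.

Lemma smooth_endo_of_frames (A : forall x, tangent (h x) -> tangent (h x)) :
  (forall x, linear (A x)) ->
  (forall x, exists (I : finType) (e : I -> section), [/\ m = #|I|,
     forall i, lsec x (e i), indep (e^~ x) &
     forall i, lsec x (fun y => A y (e i y))]) ->
  smooth_endo A.
Proof.
move=> lA HA; split=> // x s ls.
have [I [e [mI le ie lAe]]] := HA x.
have [_ /(_ s ls)[a [sa saE]]] := frame_near mI le ie.
apply: (@local_section_eq _ _ _ _ _ _ sh (fun y => \sum_i a i y *: A y (e i y))).
  apply: filterS saE => y ->.
  by rewrite (plin_sum (lA y)); apply: eq_bigr => i _; rewrite (plinZ (lA y)).
by apply: local_section_sum => // i _; exact: local_sectionZ.
Qed.

Lemma smooth_form_of_frames (g : forall x, tangent (h x) -> tangent (h x) -> R)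
    x s t (I : finType) (e : I -> section) :
  (forall y u, scalar (g y u)) -> (forall y u, scalar (fun v => g y v u)) ->
  m = #|I| -> (forall i, lsec x (e i)) -> indep (e^~ x) ->
  (forall i j, smooth_near (fun y => g y (e i y) (e j y)) x) ->
  lsec x s -> lsec x t -> smooth_near (fun y => g y (s y) (t y)) x.
Proof.
move=> gr gl mI le ie sg ls lt.
have [_ H] := frame_near mI le ie.
have [a [sa aE]] := H s ls; have [b [sb bE]] := H t lt.
apply: (@smooth_near_eq _ _ _ _ (fun y =>
   \sum_i \sum_j a i y * (b j y * g y (e i y) (e j y)))).
  apply: filterS2 aE bE => y -> ->; rewrite (psca_sum (gl y _)).
  apply: eq_bigr => i _; rewrite (pscaZ (gl y _)) (psca_sum (gr y _)) -mulr_sumr.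
  by congr (_ * _); apply: eq_bigr => j _; rewrite (pscaZ (gr y _)).
apply: smooth_near_sum => i _; apply: smooth_near_sum => j _.
by apply: smooth_nearM => //; exact: smooth_nearM.
Qed.

Lemma pull_section (Y : forall p : M, tangent p) x :
  local_vfield (h x) Y -> lsec x (fun y => Y (h y)).
Proof.
move=> lY; apply: (local_section_comp sh (mem_chart_at (h x))) => j.
apply: (smooth_near_pull sh (f := fun p => Y p (chart_at (h x)) 0 j)).
exact: (smooth_near_comp (smooth_map_id M) _ (mem_chart_at _) lY).
Qed.

Lemma indep_coord (c : chart M) p : dom c p ->
  indep (fun j => tangent_in c p (delta_mx 0 j)).
Proof.
move=> cp a /(congr1 (fun v : tangent p => v c)); rewrite comp_sum comp0.
under eq_bigr do rewrite compZ tangent_inE //.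
move=> a0 i; have r0 : \row_j a j = 0.
  rewrite (row_sum_delta (\row_j a j)) -[RHS]a0.
  by apply: eq_bigr => j _; rewrite mxE.
by have := congr1 (fun v : 'rV_m => v 0 i) r0; rewrite !mxE.
Qed.

(** Tensors on [M] are known to be smooth only on vector fields of [M], whereas a section of the
    pull-back need not come from one. A frame made of restricted fields bridges the gap. *)
Lemma pull_coord_frame x : exists e : 'I_m -> forall p : M, tangent p,
  [/\ forall i, local_vfield (h x) (e i),
      forall i, lsec x (fun y => e i (h y)) & indep (fun i => e i (h x))].
Proof.
have cx := mem_chart_at (h x).
exists (fun j p => tangent_in (chart_at (h x)) p (delta_mx 0 j)); split.
- by move=> i; exact: local_vfield_tangent_in.
- by move=> i; apply: (pull_section (Y := fun p => tangent_in (chart_at (h x)) p _));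
    exact: local_vfield_tangent_in.
- exact: indep_coord.
Qed.

Lemma pull_endo (A : forall p : M, tangent p -> tangent p) :
  smooth_endo (h := @idfun M) A -> smooth_endo (h := h) (fun x => A (h x)).
Proof.
move=> [lA sA]; apply: smooth_endo_of_frames => [x|x]; first exact: lA.
have [e [le lhe ie]] := pull_coord_frame x.
exists 'I_m, (fun i y => e i (h y)); split=> //; first by rewrite card_ord.
move=> i; apply: (pull_section (Y := fun p => A p (e i p))).
  exact: (sA (h x) (e i) (le i)).
Qed.

Lemma pull_form2 (w : forall p : M, tangent p -> tangent p -> R) x s t :
  is_form2 w -> lsec x s -> lsec x t ->
  smooth_near (fun y => w (h y) (s y) (t y)) x.
Proof.
move=> [w1 w2 w3]; have [e [le lhe ie]] := pull_coord_frame x.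
apply: (smooth_form_of_frames (g := fun y => w (h y)) (s := s) (t := t)
  (e := fun i y => e i (h y))) => //.
- by move=> y u a v v'; rewrite !(w2 _ _ u) w1 opprD -mulrN.
- by rewrite card_ord.
- move=> i j; apply: (smooth_near_pull sh (f := fun p => w p (e i p) (e j p))).
  exact: w3.
Qed.

End Frames.

(** * Locality of connections and their properties tested on frames *)

Section ConnectionTheory.
Context {R : realType} {d m : nat} {N : manifold R d} {M : manifold R m}.
Variable h : N -> M.
Hypothesis sh : smooth_map h.

Notation section := (forall x : N, tangent (h x)).
Notation lsec := (local_section (whole h)).
Notation conn := (forall x : N, tangent x -> section -> tangent (h x)).

Lemma local_section_subE (W : forall x : N, set (tangent (h x))) x (s t : section) :
  (\forall y \near x, s y = t y) -> local_section W x s -> local_section W x t.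
Proof.
move=> st /local_sectionW[ls Ws]; apply/local_sectionW; split.
  exact: local_section_eq ls.
by apply: filterS2 st Ws => y ->.
Qed.

Lemma conn_local (W : forall x : N, set (tangent (h x))) (D : conn) x
    (v : tangent x) (s t : section) :
  connection h W D -> local_section W x s ->
  (\forall y \near x, s y = t y) -> D x v s = D x v t.
Proof.
move=> cD ls st; have lt := local_section_subE st ls.
have /near_openP[U [oU Ux] sU] := st.
(* [f] may jump at the boundary of [U], but it is constantly 1 near [x], which is all that
   [smooth_near f x] asks; and [f s = f t] holds at every point. *)
pose f (y : N) : R := if pselect (U y) then 1 else 0.
have f1 : \forall y \near x, 1 = f y.
  apply: filterS (open_nbhs_nbhs (conj oU Ux)) => y Uy.
  by rewrite /f; case: pselect.
have sf : smooth_near f x by apply: smooth_near_eq f1 _; exact: smooth_near_cst.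
have fx : f x = 1 by rewrite (nbhs_singleton f1).
have df : dfun f v = 0.
  by apply: (dfun_near_cst (a := 1)); apply: filterS f1 => y.
have fst : (fun y => f y *: s y) = (fun y => f y *: t y).
  apply: functional_extensionality_dep => y; rewrite /f.
  by case: pselect => [Uy|nUy] /=; [rewrite (sU y Uy)|rewrite !scale0r].
have := congr1 (D x v) fst.
by rewrite !(conn_leibniz cD) // df fx !scale0r !add0r !scale1r.
Qed.

Lemma conn_value (W : forall x : N, set (tangent (h x))) (D : conn) x
    (v : tangent x) (s : section) :
  connection h W D -> local_section W x s -> W x (D x v s).
Proof.
move=> cD ls; have [X lX <-] := vfield_extension v.
by have [U [_ Ux _]] := conn_smooth cD lX ls; exact.
Qed.

Variable D : conn.
Arguments D : clear implicits.
Hypothesis cD : connection h (whole h) D.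

Lemma conn0 x (v : tangent x) : D x v (fun _ => 0) = 0.
Proof.
have := conn_leibniz cD v (@smooth_near_cst _ _ _ _ (0 : R) x) (local_section0 sh x).
rewrite dfun_cst !scale0r add0r => <-; congr (D x v).
by apply: functional_extensionality_dep => y; rewrite scale0r.
Qed.

Lemma conn_sum x (v : tangent x) (I : Type) (r : seq I) (P : pred I)
    (F : I -> section) : (forall i, P i -> lsec x (F i)) ->
  D x v (fun y => \sum_(i <- r | P i) F i y) = \sum_(i <- r | P i) D x v (F i).
Proof.
move=> lF; elim: r => [|i r IH].
  rewrite big_nil -(conn0 v); congr (D x v).
  by apply: functional_extensionality_dep => y; rewrite big_nil.
have [Pi|nPi] := boolP (P i).
  rewrite big_cons Pi -IH -(conn_add cD); [|exact: lF|exact: local_section_sum].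
  by congr (D x v); apply: functional_extensionality_dep => y; rewrite big_cons Pi.
rewrite big_cons (negbTE nPi) -IH.
by congr (D x v); apply: functional_extensionality_dep => y;
  rewrite big_cons (negbTE nPi).
Qed.

Lemma conn_frame x (v : tangent x) (I : Type) (r : seq I) (P : pred I)
    (a : I -> N -> R) (e : I -> section) (s : section) :
  (forall i, P i -> smooth_near (a i) x) -> (forall i, P i -> lsec x (e i)) ->
  (\forall y \near x, s y = \sum_(i <- r | P i) a i y *: e i y) ->
  D x v s = \sum_(i <- r | P i) (dfun (a i) v *: e i x + a i x *: D x v (e i)).
Proof.
move=> sa le sE.
have lae i : P i -> lsec x (fun y => a i y *: e i y).
  by move=> Pi; apply: local_sectionZ; [|exact: sa|exact: le].
have ls : lsec x s.
  apply: (local_section_eq sh _ (local_section_sum sh r lae)).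
  by apply: filterS sE => y ->.
rewrite (conn_local v cD ls sE) conn_sum //.
by apply: eq_bigr => i Pi; rewrite (conn_leibniz cD) //; [exact: sa|exact: le].
Qed.

(** The commutator of the derivative with [J] is tensorial: in the Leibniz expansion the derivatives
    of the coefficients cancel. *)
Lemma conn_commutes_of_frame (J : forall x, tangent (h x) -> tangent (h x)) x
    (v : tangent x) (I : finType) (e : I -> section) :
  (forall y, linear (J y)) -> m = #|I| -> (forall i, lsec x (e i)) ->
  indep (e^~ x) -> (forall i, lsec x (fun y => J y (e i y))) ->
  (forall i, D x v (fun y => J y (e i y)) = J x (D x v (e i))) ->
  forall s, lsec x s -> D x v (fun y => J y (s y)) = J x (D x v s).
Proof.
move=> lJ mI le ie lJe DJ s ls; have [_ /(_ s ls)[a [sa sE]]] := frame_near sh mI le ie.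
have JsE : \forall y \near x, J y (s y) = \sum_i a i y *: J y (e i y).
  apply: filterS sE => y ->; rewrite (plin_sum (lJ y)).
  by apply: eq_bigr => i _; rewrite (plinZ (lJ y)).
rewrite (conn_frame v (fun i _ => sa i) (fun i _ => le i) sE).
rewrite (conn_frame v (e := fun i y => J y (e i y)) (fun i _ => sa i)
  (fun i _ => lJe i) JsE).
rewrite (plin_sum (lJ x)); apply: eq_bigr => i _.
by rewrite (plinD (lJ x)) !(plinZ (lJ x)) DJ.
Qed.

Variable g : forall x : N, tangent (h x) -> tangent (h x) -> R.
Arguments g : clear implicits.
Hypothesis gr : forall x u, scalar (g x u).
Hypothesis gC : forall x u v, g x u v = g x v u.
Hypothesis sg : forall x s t, lsec x s -> lsec x t ->
  smooth_near (fun y => g y (s y) (t y)) x.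

Let metric_at x (v : tangent x) (s t : section) :=
  dfun (fun y => g y (s y) (t y)) v = g x (D x v s) (t x) + g x (s x) (D x v t).

Let metric_atC x (v : tangent x) (s t : section) :
  metric_at v s t -> metric_at v t s.
Proof.
rewrite /metric_at => E; under eq_fun do rewrite gC.
by rewrite E addrC gC [X in _ + X]gC.
Qed.

Let metric_at_span x (v : tangent x) (I : finType) (e : I -> section) t :
  m = #|I| -> (forall i, lsec x (e i)) -> indep (e^~ x) -> lsec x t ->
  (forall i, metric_at v (e i) t) -> forall s, lsec x s -> metric_at v s t.
Proof.
move=> mI le ie lt H s ls; have [_ /(_ s ls)[a [sa sE]]] := frame_near sh mI le ie.
have gl y u : scalar (fun z => g y z u).
  by move=> b z z'; rewrite !(gC _ u) gr.
rewrite /metric_at (conn_frame v (fun i _ => sa i) (fun i _ => le i) sE).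
rewrite -(@dfun_eq _ _ _ _ (fun y => \sum_i a i y * g y (e i y) (t y))); first last.
- apply: filterS sE => y ->; rewrite (psca_sum (gl y (t y))).
  by apply: eq_bigr => i _; rewrite (pscaZ (gl y (t y))).
- by apply: smooth_near_sum => i _; apply: smooth_nearM => //; exact: sg.
rewrite dfun_sum; last first.
  by move=> i _; apply: smooth_nearM => //; exact: sg.
rewrite (nbhs_singleton sE) !(psca_sum (gl x _)) -big_split /=.
apply: eq_bigr => i _; rewrite dfunM //; last exact: sg.
rewrite H (pscaD (gl x _)) !(pscaZ (gl x _)); ring.
Qed.

(** The defect of the metric identity is linear over functions in each argument. The span argument
    is made once, for the first argument, and carried to the second by symmetry. *)
Lemma metric_of_frame x (v : tangent x) (I : finType) (e : I -> section) :
  m = #|I| -> (forall i, lsec x (e i)) -> indep (e^~ x) ->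
  (forall i j, dfun (fun y => g y (e i y) (e j y)) v =
    g x (D x v (e i)) (e j x) + g x (e i x) (D x v (e j))) ->
  forall s t, lsec x s -> lsec x t ->
  dfun (fun y => g y (s y) (t y)) v = g x (D x v s) (t x) + g x (s x) (D x v t).
Proof.
move=> mI le ie H s t ls lt; apply: (metric_at_span mI le ie lt) ls => i.
apply: metric_atC; apply: (metric_at_span mI le ie (le i)) lt => j.
exact: H.
Qed.

End ConnectionTheory.

Lemma dfun_scalar (R : realType) d (M : manifold R d) (f : M -> R) p :
  scalar (dfun f (p := p)).
Proof. exact: dfun_is_linear. Qed.

(** * The connection induced by a Lagrangian complement *)

Section Lagrangian.
Context {R : realType} {n : nat} {M : manifold R n.*2}.
Variables (S : forall p : M, tangent p -> tangent p)
  (w : forall p : M, tangent p -> tangent p -> R).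
Arguments S : clear implicits.
Arguments w : clear implicits.
Hypothesis ll : locally_lagrangian S w.

Lemma S_linear p : linear (S p).
Proof. exact: (ts_smooth (ll_tangent_structure ll)).1. Qed.

Arguments S_linear : clear implicits.

Lemma w_scalar p u : scalar (w p u).
Proof. by have [+ _ _] := symplectic_form (ll_symplectic ll); apply. Qed.

Lemma w_skew p u v : w p u v = - w p v u.
Proof. by have [_ + _] := symplectic_form (ll_symplectic ll); apply. Qed.

Lemma w_scalarl p u : scalar (fun v => w p v u).
Proof. by move=> a v v'; rewrite !(w_skew _ u) w_scalar opprD -mulrN. Qed.

Lemma S_square p u : S p (S p u) = 0.
Proof. exact: ts_square (ll_tangent_structure ll) p u. Qed.

(* With [theta = dLag \o S] one has [theta (S Y) = 0], so that
   [w (X, S Y) - w (Y, S X)] is the derivative of [Lag] along the Nijenhuis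
   tensor of [S]. *)
Lemma w_S_sym p u v : w p u (S p v) = w p v (S p u).
Proof.
have [U [Lag [oU Up sL wE]]] := ll_lagrangian ll p.
have [X lX Xp] := vfield_extension u; have [Y lY Yp] := vfield_extension v.
pose SX q := S q (X q); pose SY q := S q (Y q).
have sS := (ts_smooth (ll_tangent_structure ll)).2.
have lSX : local_vfield p SX by exact: (sS p X lX).
have lSY : local_vfield p SY by exact: (sS p Y lY).
have sLp : smooth_near Lag p by exists U.
have dL0 (Z : forall q : M, tangent q) (z : tangent p) :
    dfun (fun r => dfun Lag (S r (S r (Z r)))) z = 0.
  by under eq_fun do rewrite S_square dfun0; rewrite dfun_cst.
have := wE p X SY Up lX lSY; have := wE p Y SX Up lY lSX.
rewrite /SX /SY Xp Yp => -> ->; rewrite /ext_d1 !dL0.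
have N0 := ts_integrable (ll_tangent_structure ll) lX lY.
have /(congr1 (fun z : tangent p => dfun Lag z)) := N0.
rewrite /nijenhuis S_square addr0 dfun0.
have dLB z z' : dfun Lag (z - z' : tangent p) = dfun Lag z - dfun Lag z'.
  by rewrite (pscaD (dfun_scalar Lag (p := p)))
    (pscaN (dfun_scalar Lag (p := p))).
rewrite !dLB (dfun_bracket sLp lSX lSY) /SX /SY Xp Yp.
rewrite (lie_bracketC _ Y) (plinN (S_linear p)).
rewrite (pscaN (dfun_scalar Lag (p := p))).
lra.
Qed.

End Lagrangian.

Arguments S_linear {R n M S w} ll p.

(** * The almost complex structure of a Lagrangian complement *)

Section AssocStructure.
Context {R : realType} {n : nat} {M : manifold R n.*2}.
Variables (S : forall p : M, tangent p -> tangent p)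
  (w : forall p : M, tangent p -> tangent p -> R)
  (V' : forall p : M, set (tangent p))
  (S' : forall p : M, tangent p -> tangent p).
Arguments S : clear implicits.
Arguments w : clear implicits.
Arguments V' : clear implicits.
Arguments S' : clear implicits.
Hypotheses (ll : locally_lagrangian S w) (el : elliptic S w)
  (ld : lagrangian_distribution w V')
  (cVV' : complementary V' (vertical S)) (iS' : inverse_structure S V' S').

Let lS : forall p, linear (S p) := S_linear ll.
Arguments lS : clear implicits.
Let lS' : forall p, linear (S' p) := iS'.1.
Arguments lS' : clear implicits.
Let J := assoc_J S S'.
Arguments J : clear implicits.
Let wD p u := pscaD (w_scalar ll (p := p) u).
Let wDl p u := pscaD (w_scalarl ll (p := p) u).

Lemma S'_V' p u : V' p u -> S' p u = 0.
Proof. by move=> /(iS'.2 p u)[]. Qed.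

Lemma S'S_V' p u : V' p u -> S' p (S p u) = u.
Proof. by move=> /(iS'.2 p u)[]. Qed.

Lemma S'_in_V' p u : V' p (S' p u).
Proof.
have [u1 [_ [V'u1 [v ->] ->]]] := cVV'.1 p u.
rewrite (plinD (lS' p)) (S'_V' V'u1) add0r.
have [v1 [_ [V'v1 [z ->] ->]]] := cVV'.1 p v.
by rewrite (plinD (lS p)) (S_square ll) addr0 S'S_V'.
Qed.

Lemma S'_square p u : S' p (S' p u) = 0.
Proof. exact/S'_V'/S'_in_V'. Qed.

Lemma SS'_vertical p u : vertical S p u -> S p (S' p u) = u.
Proof.
move=> [v ->]; have [v1 [_ [V'v1 [z ->] ->]]] := cVV'.1 p v.
by rewrite (plinD (lS p)) (S_square ll) addr0 S'S_V'.
Qed.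

(** [S S'] and [S' S] are the projections onto [V] and [V'] of the splitting. *)
Lemma SS'_S'S p u : u = S p (S' p u) + S' p (S p u).
Proof.
have [u1 [u2 [V'u1 Vu2 ->]]] := cVV'.1 p u.
rewrite !(plinD (lS' p)) !(plinD (lS p)) (S'_V' V'u1) (plin0 (lS p)) add0r SS'_vertical //.
by case: Vu2 => v ->; rewrite (S_square ll) addr0 S'S_V' // addrC.
Qed.

Lemma w_V' p u v : V' p u -> V' p v -> w p u v = 0.
Proof. by move=> /(ld_lagrangian ld) H /H. Qed.

Lemma w_V p u v : vertical S p u -> vertical S p v -> w p u v = 0.
Proof.
by move=> [u' ->] [v' ->]; rewrite (w_S_sym ll) (S_square ll) (psca0 (w_scalar ll _)).
Qed.

Lemma assoc_J_linear p : linear (J p).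
Proof.
move=> a u v; rewrite /J /assoc_J lS lS' scalerBr opprD !addrA; congr (_ - _).
by rewrite addrAC.
Qed.

Arguments assoc_J_linear : clear implicits.

Lemma assoc_JK p u : J p (J p u) = - u.
Proof.
rewrite {2}(SS'_S'S u) /J /assoc_J (plinB (lS' p)) (plinB (lS p)).
by rewrite S'_square (S_square ll) sub0r subr0 opprD addrC.
Qed.

(** Both [V] and [V'] are isotropic, so only cross terms survive on either side; [w_S_sym] moves [S]
    across [w] and matches them. *)
Lemma assoc_J_compat p u v : w p (J p u) (J p v) = w p u v.
Proof.
have wS'S x y : w p (S' p x) (S p y) = - w p (S p (S' p x)) y.
  by rewrite (w_S_sym ll) (w_skew ll).
rewrite /J /assoc_J !wD !wDl !(pscaN (w_scalar ll _)) !(pscaN (w_scalarl ll _)).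
rewrite (w_V' (S'_in_V' u) (S'_in_V' v)) (w_V (u := S p u) (v := S p v));
  [|by exists u|by exists v].
rewrite opprK addr0 add0r (w_skew ll (S p u)) !opprK.
rewrite [in RHS](SS'_S'S u) wDl.
rewrite (w_S_sym ll (S' p u)) (w_S_sym ll (S' p v)) (w_skew ll v) opprK.
rewrite [LHS]addrC; congr (_ + _).
rewrite [in RHS](SS'_S'S v) wD.
rewrite (w_V' (S'_in_V' _) (S'_in_V' _)) addr0.
have vSu : vertical S p (S p u) by exists u.
by rewrite (w_S_sym ll (S' p (S p u))) (SS'_vertical vSu) (w_S_sym ll).
Qed.

(** The value is [w (S (S' u)) (S' u) + w (S u) u], two values of the elliptic form. If [u] is not
    vertical the second one is positive; if it is, then [S u = 0] and [S' u] cannot be vertical,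
    since [u = S (S' u)] would vanish. *)
Lemma assoc_metric_pos p u : u != 0 -> 0 < w p u (J p u).
Proof.
move=> u0; rewrite /J /assoc_J wD (pscaN (w_scalar ll _)).
rewrite {1}(SS'_S'S u) wDl (w_V' (S'_in_V' _) (S'_in_V' u)) addr0.
rewrite -(w_skew ll).
have [/(SS'_vertical (p := p)) uE|nVu] := pselect (vertical S p u); last first.
  apply: ltr_wpDl; last exact: el.
  have [/(SS'_vertical (p := p)) SS'|] := pselect (vertical S p (S' p u)).
    by rewrite -SS' S'_square (plin0 (lS p)) (psca0 (w_scalar ll _)).
  by move=> /el/ltW.
have -> : S p u = 0 by rewrite -uE (S_square ll).
rewrite (psca0 (w_scalarl ll _)) addr0; apply: el => -[z S'uE].
move: u0; rewrite -uE S'uE (S_square ll) eqxx //.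
Qed.

Lemma assoc_J_S p u : V' p u -> J p u = - S p u.
Proof. by move=> V'u; rewrite /J /assoc_J S'_V' // sub0r. Qed.

Lemma assoc_J_V p u : vertical S p u -> J p u = S' p u.
Proof. by move=> [v ->]; rewrite /J /assoc_J (S_square ll) subr0. Qed.

Lemma smooth_subbundle_mem k (W : forall p : M, set (tangent p)) :
  smooth_subbundle (h := @idfun M) k W -> forall p,
  exists e : 'I_k -> forall q : M, tangent q,
  [/\ forall i, local_vfield p (e i), \forall q \near p, forall i, W q (e i q),
      \forall q \near p, indep (e^~ q) &
      \forall q \near p, forall u, W q u -> exists a : 'I_k -> R, u = \sum_i a i *: e i q].
Proof.
move=> sW p; have [U [e [oU Up se eU]]] := sW p.
have nU : nbhs p U by exact: open_nbhs_nbhs.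
exists e; split.
- by move=> i; exists U; split.
- apply: filterS nU => q /eU[eW _] i; apply/eW.
  exists (fun j => (i == j)%:R); rewrite (bigD1 i) //= eqxx scale1r big1 ?addr0 //.
  by move=> j ji; rewrite eq_sym (negbTE ji) scale0r.
- by apply: filterS nU => q /eU[_].
- by apply: filterS nU => q /eU[eW _] u /eW.
Qed.

(** In a vanishing combination the [e] part lies in [V'] and the [S e] part in [V], so both vanish;
    [S] then kills a vector of [V'], which by exactness also lies in [V] and is therefore zero. *)
Lemma adapted_frame p : exists e : 'I_n -> forall q : M, tangent q,
  [/\ forall i, local_vfield p (e i), \forall q \near p, forall i, V' q (e i q) &
      \forall q \near p, indep (fun i : 'I_n + 'I_n =>
        match i with inl i => e i q | inr i => S q (e i q) end)].
Proof.
have [e [le Ve ie _]] := smooth_subbundle_mem (ld_smooth ld) p.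
exists e; split=> //; apply: filterS2 Ve ie => q Vq iq a.
have V'sum (b : 'I_n -> R) : V' q (\sum_i b i *: e i q).
  apply/(ld_lagrangian ld) => z V'z; rewrite (psca_sum (w_scalarl ll z)).
  by rewrite big1 // => i _; rewrite (pscaZ (w_scalarl ll z)) w_V' ?mulr0.
rewrite big_sumType /=.
have -> : \sum_i a (inr i) *: S q (e i q) = S q (\sum_i a (inr i) *: e i q).
  by rewrite (plin_sum (lS q)); apply: eq_bigr => i _; rewrite (plinZ (lS q)).
move=> /eqP; rewrite addr_eq0 => /eqP E.
have E0 : \sum_i a (inl i) *: e i q = 0.
  apply: (cVV'.2 q) => //; rewrite E; exists (- \sum_i a (inr i) *: e i q).
  by rewrite (plinN (lS q)).
have E1 : \sum_i a (inr i) *: e i q = 0.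
  apply: (cVV'.2 q) => //; apply: (ts_exact (ll_tangent_structure ll)).
  by apply/eqP; rewrite -oppr_eq0 -E E0.
by move=> [i|i]; [exact: (iq _ E0)|exact: (iq _ E1)].
Qed.

(** [S'] is given pointwise only, but on the adapted frame its values are [0] and the frame vectors
    [e i] themselves. *)
Lemma S'_smooth : smooth_endo (h := @idfun M) S'.
Proof.
apply: (smooth_endo_of_frames (smooth_map_id M)) => [p|p]; first exact: lS'.
have [e [le Ve ie]] := adapted_frame p.
have sS := (ts_smooth (ll_tangent_structure ll)).2.
exists ('I_n + 'I_n)%type, (fun i q =>
  match i with inl i => e i q | inr i => S q (e i q) end); split.
- by rewrite card_sum card_ord addnn.
- by move=> [i|i]; [exact: le|exact: (sS p (e i) (le i))].
- exact: nbhs_singleton ie.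
- move=> [i|i].
    apply: (local_section_eq (smooth_map_id M) _ (local_section0 (smooth_map_id M) p)).
    by apply: filterS Ve => q Vq; rewrite S'_V'.
  apply: (local_section_eq (smooth_map_id M) _ (le i)).
  by apply: filterS Ve => q Vq; rewrite S'S_V'.
Qed.

Lemma assoc_J_smooth : smooth_endo (h := @idfun M) J.
Proof.
split=> [p|p s ls]; first exact: assoc_J_linear.
have lS's := S'_smooth.2 p s ls.
have lSs := (ts_smooth (ll_tangent_structure ll)).2 p s ls.
have := local_sectionZ (smooth_map_id M) (@smooth_near_cst _ _ _ _ (-1 : R) p) lSs.
move=> /(local_sectionD (smooth_map_id M) lS's).
apply: (local_section_eq (smooth_map_id M)); apply: nearW => q.
by rewrite scaleN1r.
Qed.

End AssocStructure.

Lemma connN (R : realType) d m (N : manifold R d) (M : manifold R m) (h : N -> M)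
    (D : forall x : N, tangent x -> (forall y : N, tangent (h y)) -> tangent (h x))
    x (v : tangent x) s :
  connection h (whole h) D -> local_section (whole h) x s ->
  D x v (fun y => - s y) = - D x v s.
Proof.
move=> cD ls.
have := conn_leibniz cD v (@smooth_near_cst _ _ _ _ (-1 : R) x) ls.
rewrite dfun_cst scale0r add0r scaleN1r => <-; congr (D x v).
by apply: functional_extensionality_dep => y; rewrite scaleN1r.
Qed.

(** * The extended connection along the submanifold *)

Section RestrictedConnection.
Context {R : realType} {n : nat} {M : manifold R n.*2} {L : manifold R n}.
Variables (S : forall p : M, tangent p -> tangent p)
  (w : forall p : M, tangent p -> tangent p -> R)
  (V' : forall p : M, set (tangent p))
  (S' : forall p : M, tangent p -> tangent p)
  (iota : L -> M)
  (DV D0 : forall p : M, tangent p -> (forall q : M, tangent q) -> tangent p)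
  (DL : forall x : L, tangent x ->
     (forall y : L, tangent (iota y)) -> tangent (iota x)).
Arguments S : clear implicits.
Arguments w : clear implicits.
Arguments V' : clear implicits.
Arguments S' : clear implicits.
Arguments DL : clear implicits.
Arguments DV : clear implicits.
Arguments D0 : clear implicits.
Hypotheses (ll : locally_lagrangian S w) (el : elliptic S w)
  (ld : lagrangian_distribution w V')
  (cVV' : complementary V' (vertical S)) (iS' : inverse_structure S V' S').
Hypotheses (cDV : connection (@idfun M) (vertical S) DV)
  (gDV : preserves_metric (@idfun M) (vertical S) (assoc_metric w S S') DV)
  (cD0 : connection (@idfun M) (whole (@idfun M)) D0)
  (eD0 : extends_vertical S S' DV D0)
  (cDL : connection iota (whole iota) DL) (rDL : restricts iota D0 DL).
Hypothesis si : smooth_map iota.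

Let J (x : L) := assoc_J S S' (p := iota x).
Arguments J : clear implicits.
Let sigma (x : L) := w (iota x).
Let sid := smooth_map_id M.

Lemma calibrated_assoc : calibrated sigma J.
Proof.
split.
- exact: (pull_endo si (assoc_J_smooth ll ld cVV' iS')).
- by move=> x u; exact: (assoc_JK ll cVV' iS').
- by move=> x u v; exact: (assoc_J_compat ll ld cVV' iS').
- by move=> x u; exact: (assoc_metric_pos ll el ld cVV' iS').
Qed.

Let fr (e : 'I_n -> forall q : M, tangent q) (i : 'I_n + 'I_n) q :=
  match i with inl i => e i q | inr i => S q (e i q) end.

(** Near [p] the field [e i] equals [S'] applied to the vertical field [S (e i)], so the extension
    rule determines the derivatives of both by the same vertical vector [om]. *)
Lemma DL_on_frame p (e : 'I_n -> forall q : M, tangent q) i (v : tangent p) :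
  local_vfield p (e i) -> (\forall q \near p, V' q (e i q)) ->
  exists om, [/\ vertical S p om, DV p v (fun q => S q (e i q)) = om,
    D0 p v (fun q => S q (e i q)) = om & D0 p v (e i) = S' p om].
Proof.
move=> le Ve; have sS := (ts_smooth (ll_tangent_structure ll)).2.
have lSe : local_section (h := @idfun M) (vertical S) p (fun q => S q (e i q)).
  apply/local_sectionW; split; first exact: (sS p (e i) le).
  by apply: nearW => q; exists (e i q).
have [E1 E2] := eD0 v lSe.
exists (DV p v (fun q => S q (e i q))); split=> //.
  exact: (conn_value v cDV lSe).
rewrite -E2; apply: (conn_local sid v cD0) => //.
by apply: filterS Ve => q Vq; rewrite (S'S_V' iS' Vq).
Qed.

(** [restricts] determines [DL] only on restrictions of fields of [M]; the frame is therefore taken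
    on [M], and everything about [DL] at [v] is encoded in the vectors [om i]. *)
Lemma DL_frame x (v : tangent x) : exists (e : 'I_n + 'I_n -> forall q : M, tangent q)
    (om : 'I_n -> tangent (iota x)),
  [/\ forall i, local_vfield (iota x) (e i),
      \forall q \near iota x, indep (e^~ q),
      \forall q \near iota x, forall i,
         [/\ V' q (e (inl i) q), vertical S q (e (inr i) q) &
             e (inr i) q = S q (e (inl i) q)],
      forall i, vertical S (iota x) (om i) /\
         DV (iota x) (push iota v) (e (inr i)) = om i &
      forall i, DL x v (fun y => e (inr i) (iota y)) = om i /\
         DL x v (fun y => e (inl i) (iota y)) = S' (iota x) (om i)].
Proof.
have [e [le Ve ie]] := adapted_frame ll ld cVV' (iota x).
have sS := (ts_smooth (ll_tangent_structure ll)).2.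
have Ve' i : \forall q \near iota x, V' q (e i q) by apply: filterS Ve => q.
have [om Hom] := choice (fun i => DL_on_frame (push iota v) (le i) (Ve' i)).
have lfr i : local_vfield (iota x) (fr e i).
  by case: i => i; [exact: le|exact: (sS (iota x) (e i) (le i))].
exists (fr e), om; split=> //.
- apply: filterS Ve => q Vq i; split=> //; first exact: Vq.
  by exists (e i q).
- by move=> i; have [] := Hom i.
- move=> i; have [_ _ H1 H2] := Hom i.
  by rewrite (rDL v (lfr (inr i))) (rDL v (lfr (inl i))).
Qed.

Let g (x : L) (u v : tangent (iota x)) : R := sigma u (J x v).
Arguments g : clear implicits.

Let J_linear x : linear (J x).
Proof. exact: (assoc_J_linear ll iS'). Qed.

(** On the adapted frame [J] exchanges [e i] and [S (e i)] up to sign, and their derivatives [S' om]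
    and [om] are exchanged in the same way. *)
Lemma DL_J x (v : tangent x) s : local_section (whole iota) x s ->
  DL x v (fun y => J y (s y)) = J x (DL x v s).
Proof.
have [e [om [le ie Ve omV DLe]]] := DL_frame v.
have lhe i : local_section (whole iota) x (fun y => e i (iota y)).
  exact: pull_section.
have nV := smooth_map_near si Ve.
have JE i : \forall y \near x, J y (e (inl i) (iota y)) = - e (inr i) (iota y).
  apply: filterS nV => y /(_ i)[V'y _ ->]; exact: (assoc_J_S iS').
have JE' i : \forall y \near x, J y (e (inr i) (iota y)) = e (inl i) (iota y).
  apply: filterS nV => y /(_ i)[V'y Vy Ey].
  by rewrite /J (assoc_J_V S' ll) // Ey (S'S_V' iS').
move: s.
apply: (@conn_commutes_of_frame _ _ _ _ _ iota si DL cDL J x v ('I_n + 'I_n)%type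
  (fun i y => e i (iota y)) J_linear).
- by rewrite card_sum card_ord addnn.
- exact: lhe.
- exact: (nbhs_singleton ie).
- by move=> i; apply: calibrated_assoc.(calibrated_smooth).2; exact: lhe.
- have lJe i := calibrated_assoc.(calibrated_smooth).2 x _ (lhe i).
  case=> i.
    rewrite (conn_local si v cDL (lJe _) (JE i)).
    rewrite (connN v cDL (lhe (inr i))); have [-> ->] := DLe i; have [Vom _] := omV i.
    rewrite /J (assoc_J_S iS') ?(SS'_vertical ll cVV' iS') //.
    exact: (S'_in_V' ll cVV' iS').
  rewrite (conn_local si v cDL (lJe _) (JE' i)).
  have [-> ->] := DLe i; have [Vom _] := omV i.
  by rewrite /J (assoc_J_V S' ll).
Qed.

Let g_scalar x u : scalar (g x u).
Proof.
by move=> a v v'; rewrite /g /sigma J_linear (w_scalar ll).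
Qed.

Let gC x u v : g x u v = g x v u.
Proof.
rewrite /g -(calibrated_compat calibrated_assoc) (calibratedK calibrated_assoc).
by rewrite /sigma (pscaN (w_scalar ll _)) (w_skew ll) opprK.
Qed.

(** On the [V] half this is the metric property of [DV]. The isometry [J] carries it to the [V']
    half, since [S' om = J om]. Mixed products vanish with their derivatives, because [V] and [V']
    are orthogonal. *)
Lemma DL_metric : preserves_metric iota (whole iota) (metric_of sigma J) DL.
Proof.
move=> x v s t ls lt.
have [e [om [le ie Ve omV DLe]]] := DL_frame v.
have lhe i : local_section (whole iota) x (fun y => e i (iota y)).
  exact: pull_section.
have nV := smooth_map_near si Ve.
have sg y s' t' : local_section (whole iota) y s' -> local_section (whole iota) y t' ->
    smooth_near (fun z => g z (s' z) (t' z)) y.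
  move=> ls' lt'; apply: (pull_form2 (h := iota) si (symplectic_form (ll_symplectic ll))) => //.
  exact: calibrated_assoc.(calibrated_smooth).2.
have lV i : local_section (h := @idfun M) (vertical S) (iota x) (e (inr i)).
  apply/local_sectionW; split; first exact: le.
  by apply: filterS Ve => q /(_ i)[].
have lJM := assoc_J_smooth ll ld cVV' iS'.
have Hrr i j : dfun (fun y => g y (e (inr i) (iota y)) (e (inr j) (iota y))) v =
    g x (om i) (e (inr j) (iota x)) + g x (e (inr i) (iota x)) (om j).
  have := gDV (push iota v) (lV i) (lV j).
  rewrite (omV i).2 (omV j).2 => <-.
  apply: (dfun_push si (f := fun q => assoc_metric w S S' (e (inr i) q) (e (inr j) q))).
  apply: (pull_form2 sid (symplectic_form (ll_symplectic ll))); first exact: le.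
  exact: (lJM.2 (iota x) (e (inr j)) (le (inr j))).
have Jl i y : V' (iota y) (e (inl i) (iota y)) ->
    e (inr i) (iota y) = S (iota y) (e (inl i) (iota y)) ->
    J y (e (inr i) (iota y)) = e (inl i) (iota y).
  by move=> Vy ->; rewrite /J (assoc_J_V S' ll) ?(S'S_V' iS') //; exists (e (inl i) (iota y)).
have gJ y a b : g y (J y a) (J y b) = g y a b.
  by rewrite /g (calibrated_compat calibrated_assoc).
have g0 y a b : V' (iota y) a -> vertical S (iota y) b -> g y a b = 0.
  move=> Va Vb; rewrite /g /J (assoc_J_V S' ll) // /sigma (w_V' ld) //.
  exact: (S'_in_V' ll cVV' iS').
have Hlr i j : dfun (fun y => g y (e (inl i) (iota y)) (e (inr j) (iota y))) v =
    g x (S' (iota x) (om i)) (e (inr j) (iota x)) + g x (e (inl i) (iota x)) (om j).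
  have /(_ i)[V'i _ _] := nbhs_singleton nV.
  have /(_ j)[_ Vj _] := nbhs_singleton nV.
  rewrite !g0 ?addr0 //; [|exact: (omV j).1|exact: (S'_in_V' ll cVV' iS')].
  apply: (dfun_near_cst (a := 0)); apply: filterS nV => y Hy.
  by rewrite g0 //; [have [] := Hy i|have [] := Hy j].
apply: (@metric_of_frame _ _ _ _ _ iota si DL cDL g g_scalar gC sg x v
  ('I_n + 'I_n)%type (fun i y => e i (iota y)) _ lhe _ _ s t ls lt).
- by rewrite card_sum card_ord addnn.
- exact: (nbhs_singleton ie).
case=> i; case=> j.
- have [E1 E2] := DLe i; have [E3 E4] := DLe j; rewrite E2 E4.
  have [Vi _] := omV i; have [Vj _] := omV j.
  rewrite -(assoc_J_V S' ll Vi) -(assoc_J_V S' ll Vj).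
  have /(_ i)[V'i _ ei] := nbhs_singleton nV.
  have /(_ j)[V'j _ ej] := nbhs_singleton nV.
  rewrite -{1}(Jl j x V'j ej) -{1}(Jl i x V'i ei) !gJ -Hrr.
  apply/esym/dfun_eq; first by apply: sg; exact: lhe.
  apply: filterS nV => y Hy; have [Vi' _ ei'] := Hy i; have [Vj' _ ej'] := Hy j.
  by rewrite -[in RHS](Jl i y) // -[in RHS](Jl j y) // gJ.
- by have [_ ->] := DLe i; have [-> _] := DLe j; exact: Hlr.
- have [-> _] := DLe i; have [_ ->] := DLe j.
  under eq_fun do rewrite gC.
  by rewrite gC addrC [X in X + _]gC addrC Hlr addrC.
- by have [-> _] := DLe i; have [-> _] := DLe j; exact: Hrr.
Qed.

Lemma DL_vertical x (v : tangent x) s :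
  local_section (fun y => vertical S (iota y)) x s ->
  vertical S (iota x) (DL x v s).
Proof.
move=> /local_sectionW[ls Vs].
have [e [om [le ie Ve omV DLe]]] := DL_frame v.
have lhe i : local_section (whole iota) x (fun y => e i (iota y)).
  exact: pull_section.
have nV := smooth_map_near si Ve.
have nI := smooth_map_near si ie.
have mI : n.*2 = #|{: 'I_n + 'I_n}| by rewrite card_sum card_ord addnn.
have [_ /(_ s ls)[a [sa sE]]] := frame_near si mI lhe (nbhs_singleton nI).
(* [S] kills the vertical section and the [inr] part of its expansion, so the [inl] coefficients
   give a vanishing combination of the independent vectors [S (e i)]. *)
have a0 i : \forall y \near x, a (inl i) y = 0.
  apply: filterS3 Vs nV (filterI nI sE) => y Vsy Hy [iy sy].
  have Sy : S (iota y) (s y) = 0.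
    have [z ->] := Vsy.
    exact: (S_square ll).
  pose b (i : 'I_n + 'I_n) : R := match i with inl _ => 0 | inr i => a (inl i) y end.
  apply: (iy b _ (inr i)).
  rewrite big_sumType /= [X in X + _]big1 ?add0r; last first.
    by move=> j _; rewrite scale0r.
  apply: etrans _ Sy; rewrite sy (plin_sum (S_linear ll _)) big_sumType /=.
  rewrite [X in _ + X]big1 ?addr0; last first.
    move=> j _; rewrite (plinZ (S_linear ll _)); have [_ _ ->] := Hy j.
    by rewrite (S_square ll) scaler0.
  apply: eq_bigr => j _; rewrite (plinZ (S_linear ll _)).
  by have [_ _ ->] := Hy j.
rewrite (conn_frame si cDL v (fun i _ => sa i) (fun i _ => lhe i) sE).
have VZ b u : vertical S (iota x) u -> vertical S (iota x) (b *: u).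
  by move=> [z ->]; exists (b *: z); rewrite (plinZ (S_linear ll _)).
have VD u u' : vertical S (iota x) u -> vertical S (iota x) u' -> vertical S (iota x) (u + u').
  by move=> [z ->] [z' ->]; exists (z + z'); rewrite (plinD (S_linear ll _)).
apply: (big_ind (vertical S (iota x))) => //.
  by exists 0; rewrite (plin0 (S_linear ll _)).
case=> i _; last first.
  have [-> _] := DLe i; apply: VD; apply: VZ; last exact: (omV i).1.
  by have /(_ i)[] := nbhs_singleton nV.
rewrite (nbhs_singleton (a0 i)) (dfun_near_cst v (a0 i)).
by rewrite !scale0r addr0; exists 0; rewrite (plin0 (S_linear ll _)).
Qed.

Lemma DL_orthogonal_unitary :
  orthogonal_unitary sigma J (fun x => vertical S (iota x)) DL.
Proof. by split; [|exact: DL_metric|exact: DL_J|exact: DL_vertical]. Qed.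

End RestrictedConnection.

(** * Smooth orthonormalisation of frames *)

Section GramSchmidt.
Context {R : realType} {d m : nat} {N : manifold R d} {M : manifold R m}.
Variable h : N -> M.
Hypothesis sh : smooth_map h.

Notation section := (forall x : N, tangent (h x)).
Notation lsec := (local_section (whole h)).

Variable g : forall x : N, tangent (h x) -> tangent (h x) -> R.
Arguments g : clear implicits.
Hypothesis gr : forall (x : N) u, scalar (g x u).
Hypothesis gC : forall (x : N) u v, g x u v = g x v u.
Hypothesis gpos : forall (x : N) u, u != 0 -> 0 < g x u u.
Hypothesis sg : forall (x : N) s t, lsec x s -> lsec x t ->
  smooth_near (fun y => g y (s y) (t y)) x.

Let gl (x : N) u : scalar (fun v => g x v u).
Proof. by move=> b z z'; rewrite !(gC _ u) gr. Qed.

Lemma gram_schmidt k (e : 'I_k -> section) x :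
  (forall i, lsec x (e i)) -> (\forall y \near x, indep (e^~ y)) ->
  exists f : 'I_k -> section, (forall i, lsec x (f i)) /\
    \forall y \near x, (forall i j, g y (f i y) (f j y) = (i == j)%:R) /\
       forall i, exists c : 'I_k -> R, f i y = \sum_l c l *: e l y.
Proof.
move=> le ie.
(* The induction records triangularity: the first [j] vectors involve only the [e l] with [l < j].
   Hence the next remainder [r] has coefficient exactly 1 on [e j'] and is nonzero by independence.
   The family is indexed by [nat], with irrelevant values beyond [j]. *)
suff H j : (j <= k)%N -> exists f : nat -> section,
    (forall i, (i < j)%N -> lsec x (f i)) /\
    \forall y \near x,
      (forall i l, (i < j)%N -> (l < j)%N -> g y (f i y) (f l y) = (i == l)%:R) /\
      forall i, (i < j)%N -> exists c : 'I_k -> R,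
        (forall l : 'I_k, (j <= l)%N -> c l = 0) /\ f i y = \sum_l c l *: e l y.
  have [f [lf Hf]] := H k (leqnn k); exists (fun i : 'I_k => f i); split=> [i|].
    exact: lf.
  apply: filterS Hf => y [gf fc]; split=> [i j|i]; first by rewrite gf.
  by have [c [_ ->]] := fc i (ltn_ord i); exists c.
elim: j => [|j IH] jk.
  by exists (fun _ _ => 0); split=> //; exact: nearW.
have [f [lf Hf]] := IH (ltnW jk); pose j' : 'I_k := Ordinal jk.
pose r y := e j' y - \sum_(i < j) g y (e j' y) (f i y) *: f i y.
have lr : lsec x r.
  apply: (local_section_eq sh (s := fun y =>
    e j' y + \sum_(i < j) (-1 * g y (e j' y) (f i y)) *: f i y)).
    apply: nearW => y; rewrite /r -sumrN; congr (_ + _).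
    by apply: eq_bigr => i _; rewrite mulN1r scaleNr.
  apply: local_sectionD => //; apply: local_section_sum => // i _.
  apply: local_sectionZ => //; last exact: lf.
  by apply: smooth_nearM; [exact: smooth_near_cst|apply: sg => //; exact: lf].
have rE : \forall y \near x, exists2 c : 'I_k -> R,
    (forall l : 'I_k, (j < l)%N -> c l = 0) /\ c j' = 1 & r y = \sum_l c l *: e l y.
  apply: filterS Hf => y [_ fc].
  have [c Hc] := choice (fun i : 'I_j => fc i (ltn_ord i)).
  pose G (i : 'I_j) := g y (e j' y) (f i y).
  exists (fun l => (l == j')%:R - \sum_i G i * c i l); first split.
  - move=> l jl; rewrite big1 ?subr0 => [|i _]; last first.
      by rewrite (Hc i).1 ?mulr0 // ltnW.
    by rewrite (_ : l == j' = false) //; apply/negbTE; rewrite -val_eqE /= gtn_eqF.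
  - by rewrite eqxx big1 ?subr0 // => i _; rewrite (Hc i).1 ?mulr0 //.
  - under eq_bigr do rewrite scalerBl.
    rewrite sumrB (bigD1 j') //= eqxx scale1r big1 ?addr0; last first.
      by move=> l /negbTE->; rewrite scale0r.
    congr (_ - _); under [RHS]eq_bigr do rewrite scaler_suml.
    rewrite exchange_big /=; apply: eq_bigr => i _.
    rewrite {2}(Hc i).2 scaler_sumr; apply: eq_bigr => l _.
    by rewrite scalerA.
pose q y := g y (r y) (r y).
have q0 : \forall y \near x, 0 < q y.
  apply: filterS2 ie rE => y iy [c [_ c1] rc]; apply: gpos.
  apply/eqP => ry0; have := iy c; rewrite -rc ry0 => /(_ erefl j').
  by rewrite c1; apply/eqP; rewrite oner_eq0.
have sq : smooth_near q x by exact: sg.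
pose s y := (Num.sqrt (q y))^-1.
have ss : smooth_near s x.
  have qx := nbhs_singleton q0.
  apply: smooth_nearV; first by rewrite gt_eqF // sqrtr_gt0.
  exact: smooth_near_sqrt.
exists (fun i => if i == j then fun y => s y *: r y else f i); split.
  move=> i ij; case: eqP => [_|/eqP nij]; first exact: local_sectionZ.
  by apply: lf; rewrite ltn_neqAle nij.
have rf : \forall y \near x, forall i, (i < j)%N -> g y (r y) (f i y) = 0.
  apply: filterS Hf => y [gf _] i ij; rewrite /r (pscaD (gl _)) (pscaN (gl _)).
  rewrite (psca_sum (gl _)) (bigD1 (Ordinal ij)) //= (pscaZ (gl _)).
  rewrite gf // eqxx mulr1 big1 ?addr0 ?subrr // => l lj.
  rewrite (pscaZ (gl _)) gf // (_ : (l : nat) == i = false) ?mulr0 //.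
  by apply/negbTE; move: lj; rewrite -val_eqE.
apply: filterS3 Hf rf (filterI q0 rE) => y [gf fc] rfy [qy rEy].
have lt1 i : (i < j.+1)%N -> i != j -> (i < j)%N.
  by move=> ij nij; rewrite ltn_neqAle nij.
split=> [i l ij lj|i ij].
  case: (i =P j) => [->|/eqP nij]; case: (l =P j) => [->|/eqP nlj].
  - rewrite (pscaZ (gl _)) (pscaZ (gr _)) -/(q y) eqxx mulrA -invfM.
    by rewrite -expr2 sqr_sqrtr ?ltW // mulVf // gt_eqF.
  - by rewrite (pscaZ (gl _)) rfy ?mulr0 ?lt1 // eq_sym (negbTE nlj).
  - by rewrite (pscaZ (gr _)) gC rfy ?mulr0 ?lt1 // (negbTE nij).
  - by rewrite gf ?lt1.
case: (i =P j) => [_|/eqP nij].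
  have [c [c0 _] ->] := rEy.
  exists (fun l => s y * c l); split=> [l jl|]; first by rewrite c0 // mulr0.
  by rewrite scaler_sumr; apply: eq_bigr => l _; rewrite scalerA.
have [c [c0 ->]] := fc i (lt1 i ij nij).
by exists c; split=> // l jl; rewrite c0 // ltnW.
Qed.

End GramSchmidt.

(** * Maslov forms *)

Section ComplexFunctions.
Local Open Scope complex_scope.
Context {R : realType} {d : nat} {N : manifold R d}.
Implicit Types f g : N -> R[i].

Lemma cReD (a b : R[i]) : Re (a + b) = Re a + Re b.
Proof. by case: a; case: b. Qed.

Lemma cImD (a b : R[i]) : Im (a + b) = Im a + Im b.
Proof. by case: a; case: b. Qed.

Lemma cReM (a b : R[i]) : Re (a * b) = Re a * Re b - Im a * Im b.
Proof. by case: a; case: b. Qed.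

Lemma cImM (a b : R[i]) : Im (a * b) = Re a * Im b + Im a * Re b.
Proof. by case: a; case: b. Qed.

Definition csmooth f x := smooth_near (fun y => Re (f y)) x /\
  smooth_near (fun y => Im (f y)) x.

Definition cdfun f x (v : tangent x) : R[i] :=
  dfun (fun y => Re (f y)) v +i* dfun (fun y => Im (f y)) v.

Lemma csmooth_cst c x : csmooth (fun _ => c) x.
Proof. by split; exact: smooth_near_cst. Qed.

Lemma cdfun_cst c x (v : tangent x) : cdfun (fun _ => c) v = 0.
Proof. by rewrite /cdfun !dfun_cst. Qed.

Lemma csmoothD f g x : csmooth f x -> csmooth g x -> csmooth (fun y => f y + g y) x.
Proof.
move=> [f1 f2] [g1 g2]; split.
  by under eq_fun do rewrite cReD; exact: smooth_nearD.
by under eq_fun do rewrite cImD; exact: smooth_nearD.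
Qed.

Lemma cdfunD f g x (v : tangent x) : csmooth f x -> csmooth g x ->
  cdfun (fun y => f y + g y) v = cdfun f v + cdfun g v.
Proof.
move=> [f1 f2] [g1 g2]; rewrite /cdfun.
have -> : (fun y => Re (f y + g y)) = (fun y => Re (f y) + Re (g y)).
  by apply/funext => y; rewrite cReD.
have -> : (fun y => Im (f y + g y)) = (fun y => Im (f y) + Im (g y)).
  by apply/funext => y; rewrite cImD.
by rewrite !dfunD.
Qed.

Lemma csmoothM f g x : csmooth f x -> csmooth g x -> csmooth (fun y => f y * g y) x.
Proof.
move=> [f1 f2] [g1 g2]; split.
  by under eq_fun do rewrite cReM; apply: smooth_nearB; exact: smooth_nearM.
by under eq_fun do rewrite cImM; apply: smooth_nearD; exact: smooth_nearM.
Qed.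

Lemma cdfunM f g x (v : tangent x) : csmooth f x -> csmooth g x ->
  cdfun (fun y => f y * g y) v = f x * cdfun g v + cdfun f v * g x.
Proof.
move=> [f1 f2] [g1 g2]; rewrite /cdfun.
have -> : (fun y => Re (f y * g y)) = (fun y => Re (f y) * Re (g y) - Im (f y) * Im (g y)).
  by apply/funext => y; rewrite cReM.
have -> : (fun y => Im (f y * g y)) = (fun y => Re (f y) * Im (g y) + Im (f y) * Re (g y)).
  by apply/funext => y; rewrite cImM.
rewrite dfunB ?dfunD; do ?exact: smooth_nearM.
rewrite !dfunM //.
move: (dfun _ v) (dfun _ v) (dfun _ v) (dfun _ v) => a b a' b'.
case: (f x) => p q; case: (g x) => p' q' /=.
apply/eqP; rewrite eq_complex /=.
by apply/andP; split; apply/eqP; ring.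
Qed.

Lemma csmooth_sum (I : Type) (r : seq I) (P : pred I) (F : I -> N -> R[i]) x :
  (forall i, P i -> csmooth (F i) x) ->
  csmooth (fun y => \sum_(i <- r | P i) F i y) x.
Proof.
move=> H; elim: r => [|i r IH].
  by under eq_fun do rewrite big_nil; exact: csmooth_cst.
have [Pi|nPi] := boolP (P i).
  by under eq_fun do rewrite big_cons Pi; apply: csmoothD => //; exact: H.
by under eq_fun do rewrite big_cons (negbTE nPi).
Qed.

Lemma cdfun_sum (I : Type) (r : seq I) (P : pred I) (F : I -> N -> R[i]) x
    (v : tangent x) : (forall i, P i -> csmooth (F i) x) ->
  cdfun (fun y => \sum_(i <- r | P i) F i y) v = \sum_(i <- r | P i) cdfun (F i) v.
Proof.
move=> H; elim: r => [|i r IH].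
  by rewrite big_nil; under eq_fun do rewrite big_nil; rewrite cdfun_cst.
have [Pi|nPi] := boolP (P i).
  rewrite big_cons Pi; under eq_fun do rewrite big_cons Pi.
  by rewrite cdfunD ?IH //; [exact: H|exact: csmooth_sum].
rewrite big_cons (negbTE nPi); under eq_fun do rewrite big_cons (negbTE nPi).
exact: IH.
Qed.

Lemma csmooth_prod (I : Type) (r : seq I) (P : pred I) (F : I -> N -> R[i]) x :
  (forall i, P i -> csmooth (F i) x) ->
  csmooth (fun y => \prod_(i <- r | P i) F i y) x.
Proof.
move=> H; elim: r => [|i r IH].
  by under eq_fun do rewrite big_nil; exact: csmooth_cst.
have [Pi|nPi] := boolP (P i).
  by under eq_fun do rewrite big_cons Pi; apply: csmoothM => //; exact: H.
by under eq_fun do rewrite big_cons (negbTE nPi).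
Qed.

(** Uniqueness of the list makes the condition [j != i] remove exactly one factor. *)
Lemma cdfun_prod (I : eqType) (r : seq I) (F : I -> N -> R[i]) x
    (v : tangent x) : uniq r -> (forall i, csmooth (F i) x) ->
  cdfun (fun y => \prod_(i <- r) F i y) v =
  \sum_(i <- r) cdfun (F i) v * \prod_(j <- r | j != i) F j x.
Proof.
move=> ur H; elim: r ur => [|i r IH] /=.
  by rewrite big_nil; under eq_fun do rewrite big_nil; rewrite cdfun_cst.
move=> /andP[nir ur]; under eq_fun do rewrite big_cons.
rewrite cdfunM //; last by apply: csmooth_prod.
rewrite IH // big_cons addrC; congr (_ + _).
  rewrite big_cons eqxx /=; congr (_ * _); rewrite big_seq [RHS]big_seq_cond.
  apply: eq_bigl => j; case: (boolP (j \in r)) => //= jr.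
  by apply/esym/eqP => ji; move: nir; rewrite -ji jr.
rewrite mulr_sumr; apply: eq_big_seq => j jr.
rewrite big_cons mulrCA ifT //.
by apply/eqP => ij; move: nir; rewrite ij jr.
Qed.

Lemma csmooth_det n (C : N -> 'M[R[i]]_n) x :
  (forall i j, csmooth (fun y => C y i j) x) -> csmooth (fun y => \det (C y)) x.
Proof.
move=> sC; apply: csmooth_sum => s _; apply: csmoothM; first exact: csmooth_cst.
by apply: csmooth_prod => i _.
Qed.

(** Jacobi's formula: the derivative is the sum of the determinants [\det (Nx i)] with only row [i]
    differentiated, and expansion along that row produces the cofactors. *)
Lemma cdfun_det n (C : N -> 'M[R[i]]_n) x (v : tangent x) :
  (forall i j, csmooth (fun y => C y i j) x) ->
  cdfun (fun y => \det (C y)) v =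
  \tr ((\matrix_(i, j) cdfun (fun y => C y i j) v) *m \adj (C x)).
Proof.
move=> sC; rewrite cdfun_sum; last first.
  move=> s _; apply: csmoothM; first exact: csmooth_cst.
  by apply: csmooth_prod => i _.
pose Nx (i : 'I_n) := \matrix_(l, j)
  (if l == i then cdfun (fun y => C y l j) v else C x l j).
transitivity (\sum_i \det (Nx i)).
  rewrite /determinant exchange_big /=; apply: eq_bigr => s _.
  rewrite cdfunM; [|exact: csmooth_cst|by apply: csmooth_prod => i _].
  rewrite cdfun_cst mul0r addr0 cdfun_prod //; last exact: index_enum_uniq.
  rewrite mulr_sumr; apply: eq_bigr => i _; congr (_ * _).
  rewrite [RHS](bigD1 i) //= mxE eqxx; congr (_ * _).
  by apply: eq_bigr => j /negbTE ji; rewrite mxE ji.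
apply: eq_bigr => i _; rewrite (expand_det_row _ i) !mxE; apply: eq_bigr => j _.
rewrite !mxE eqxx; congr (_ * (_ * \det _)).
by apply/matrixP => k l; rewrite !mxE eq_sym (negbTE (neq_lift i k)).
Qed.

Lemma cdfun_det_invmx n (C : N -> 'M[R[i]]_n) x (v : tangent x) :
  (forall i j, csmooth (fun y => C y i j) x) -> C x \in unitmx ->
  cdfun (fun y => \det (C y)) v / \det (C x) =
  \tr ((\matrix_(i, j) cdfun (fun y => C y i j) v) *m invmx (C x)).
Proof.
move=> sC uC; rewrite cdfun_det // /invmx uC -scalemxAr mxtraceZ mulrC.
by [].
Qed.

End ComplexFunctions.

(** * Complex bases of a real space with complex structure *)

Section ComplexStructure.
Local Open Scope complex_scope.
Context {R : realType} {T : lmodType R}.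
Variable J : T -> T.
Hypotheses (lJ : linear J) (JK : forall u, J (J u) = - u).

(** The complex scalar action is a function of [J] rather than a module structure, because several
    complex structures act on the same tangent space. *)
Definition cact (z : R[i]) (u : T) : T := Re z *: u + Im z *: J u.

Lemma cactDl y z u : cact (y + z) u = cact y u + cact z u.
Proof. by rewrite /cact cReD cImD !scalerDl addrACA. Qed.

Lemma cactDr z u v : cact z (u + v) = cact z u + cact z v.
Proof. by rewrite /cact (plinD lJ) !scalerDr addrACA. Qed.

Lemma cact0l u : cact 0 u = 0.
Proof. by rewrite /cact !scale0r addr0. Qed.

Lemma cact0r z : cact z 0 = 0.
Proof. by rewrite /cact (plin0 lJ) !scaler0 addr0. Qed.

Lemma cact1 u : cact 1 u = u.
Proof. by rewrite /cact /= scale1r scale0r addr0. Qed.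

Lemma cactM y z u : cact (y * z) u = cact y (cact z u).
Proof.
rewrite /cact cReM cImM (plinD lJ) !(plinZ lJ) JK !scalerDr !scalerA.
by rewrite scalerN -scaleNr [X in _ = _ + X]addrC [RHS]addrACA -!scalerDl.
Qed.

Lemma cact_suml (I : Type) (r : seq I) (P : pred I) (z : I -> R[i]) u :
  cact (\sum_(i <- r | P i) z i) u = \sum_(i <- r | P i) cact (z i) u.
Proof. exact: (big_morph (cact^~ u) (fun y z => cactDl y z u) (cact0l u)). Qed.

Lemma cact_sumr (I : Type) (r : seq I) (P : pred I) z (F : I -> T) :
  cact z (\sum_(i <- r | P i) F i) = \sum_(i <- r | P i) cact z (F i).
Proof. exact: (big_morph (cact z) (cactDr z) (cact0r z)). Qed.

Lemma cact_real a u : cact a%:C u = a *: u.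
Proof. by rewrite /cact /= scale0r addr0. Qed.

Lemma cact_morph (f : T -> T) z u : linear f -> (forall v, f (J v) = J (f v)) ->
  f (cact z u) = cact z (f u).
Proof. by move=> lf fJ; rewrite /cact (plinD lf) !(plinZ lf) fJ. Qed.

Context {k : nat}.
Implicit Types (e f g : 'I_k -> T) (A B C : 'M[R[i]]_k).

Definition rframe e (i : 'I_k + 'I_k) : T :=
  match i with inl i => e i | inr i => J (e i) end.

Lemma rframe_sum e (z : 'I_k -> R[i]) :
  \sum_i (match i with inl i => Re (z i) | inr i => Im (z i) end) *: rframe e i =
  \sum_i cact (z i) (e i).
Proof. by rewrite big_sumType /= -big_split. Qed.

Definition cbasis e := indep (rframe e) /\
  forall u, exists z : 'I_k -> R[i], u = \sum_i cact (z i) (e i).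

(** Row [i] holds the coordinates of [f i], which is why matrices of successive changes of frame
    multiply in the order [B *m A]. *)
Definition cframe_mx e A f := forall i, f i = \sum_j cact (A i j) (e j).

Lemma cindepP e (z : 'I_k -> R[i]) : indep (rframe e) ->
  \sum_i cact (z i) (e i) = 0 -> forall i, z i = 0.
Proof.
rewrite -rframe_sum => ie /ie H i; apply/eqP; rewrite eq_complex.
by rewrite (H (inl i)) (H (inr i)) !eqxx.
Qed.

Lemma cframe_mx_inj e A B f : indep (rframe e) ->
  cframe_mx e A f -> cframe_mx e B f -> A = B.
Proof.
move=> ie fA fB; apply/matrixP => i j; apply/eqP; rewrite -subr_eq0; apply/eqP.
apply: (cindepP (z := fun j => A i j - B i j) ie).
under eq_bigr do rewrite cactDl; rewrite big_split /= -fA [X in X + _]fB -big_split /=.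
rewrite big1 // => l _; rewrite -cactDl subrr cact0l //.
Qed.

Lemma cframe_mxM e A f B g : cframe_mx e A f -> cframe_mx f B g ->
  cframe_mx e (B *m A) g.
Proof.
move=> fA gB i; rewrite gB; under eq_bigr do rewrite fA cact_sumr.
rewrite exchange_big /=; apply: eq_bigr => j _; rewrite mxE cact_suml.
by apply: eq_bigr => l _; rewrite cactM.
Qed.

Lemma cframe_mx1 e : cframe_mx e 1%:M e.
Proof.
move=> i; rewrite (bigD1 i) //= mxE eqxx cact1 big1 ?addr0 // => j ji.
by rewrite mxE eq_sym (negbTE ji) cact0l.
Qed.

Lemma cframe_mx_ex e f : cbasis e -> exists A, cframe_mx e A f.
Proof.
move=> [_ se]; have [z zE] := choice (fun i => se (f i)).
exists (\matrix_(i, j) z i j) => i; rewrite zE.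
by apply: eq_bigr => j _; rewrite mxE.
Qed.

Lemma cframe_mx_unit e C f : cbasis e -> cbasis f -> cframe_mx e C f -> C \in unitmx.
Proof.
move=> be bf fC; have [C' eC'] := cframe_mx_ex e bf.
have := cframe_mx_inj be.1 (cframe_mxM fC eC') (cframe_mx1 e).
by move=> /mulmx1_unit[].
Qed.

Lemma cframe_mx_morph e A f (al : T -> T) : linear al ->
  (forall v, al (J v) = J (al v)) -> cframe_mx e A f ->
  cframe_mx (fun i => al (e i)) A (fun i => al (f i)).
Proof.
move=> la aJ fA i; rewrite fA (plin_sum la).
by apply: eq_bigr => j _; rewrite cact_morph.
Qed.

(** The change of basis [C] satisfies [C A = B C], so the matrices are similar. This connects
    unitary frames, which define Maslov forms, with frames of the subbundles, on which determinants
    are computed. *)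
Lemma ctrace_basis e f A B (al : T -> T) : linear al ->
  (forall v, al (J v) = J (al v)) -> cbasis e -> cbasis f ->
  cframe_mx e A (fun i => al (e i)) -> cframe_mx f B (fun i => al (f i)) ->
  \tr A = \tr B.
Proof.
move=> la aJ be bf aA aB; have [C fC] := cframe_mx_ex f be.
have uC := cframe_mx_unit be bf fC.
have CA := cframe_mxM aA (cframe_mx_morph la aJ fC).
have BC := cframe_mxM fC aB.
have E := cframe_mx_inj be.1 CA BC.
by rewrite -[B](mulmxK uC) -E mxtrace_mulC mulmxA mulVmx // mul1mx.
Qed.

End ComplexStructure.

(** * Isotropic subbundles and calibrated structures *)

Section CalibratedPair.
Local Open Scope complex_scope.
Context {R : realType} {d k : nat} {N : manifold R d} {M : manifold R k.*2}.
Variable h : N -> M.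
Hypothesis sh : smooth_map h.

Notation section := (forall x : N, tangent (h x)).
Notation lsec := (local_section (whole h)).

Variable sigma : forall x : N, tangent (h x) -> tangent (h x) -> R.
Arguments sigma : clear implicits.
Hypothesis sr : forall (x : N) u, scalar (sigma x u).
Hypothesis sC : forall (x : N) u v, sigma x u v = - sigma x v u.
Hypothesis ssm : forall (x : N) s t, lsec x s -> lsec x t ->
  smooth_near (fun y => sigma y (s y) (t y)) x.

Definition isotropic (W : forall x : N, set (tangent (h x))) : Prop :=
  forall x u v, W x u -> W x v -> sigma x u v = 0.

Definition framed (W : forall x : N, set (tangent (h x))) (x : N)
    (e : 'I_k -> section) : Prop :=
  (forall i, lsec x (e i)) /\
  \forall y \near x, [/\ forall i, W y (e i y), indep (e^~ y) &
    forall u, W y u -> exists a : 'I_k -> R, u = \sum_i a i *: e i y].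

Section OneStructure.
Variable J : forall x : N, tangent (h x) -> tangent (h x).
Arguments J : clear implicits.
Hypothesis cal : calibrated sigma J.

Let lJ x : linear (J x). Proof. exact: (calibrated_smooth cal).1. Qed.
Arguments lJ : clear implicits.
Let JK x u : J x (J x u) = - u. Proof. exact: (calibratedK cal). Qed.
Let lsJ x s : lsec x s -> lsec x (fun y => J y (s y)).
Proof. exact: (calibrated_smooth cal).2. Qed.

Let g (x : N) u v : R := metric_of sigma J x u v.
Arguments g : clear implicits.

Lemma g_scalar (x : N) u : scalar (g x u).
Proof. by move=> a v v'; rewrite /g /metric_of (lJ x) sr. Qed.

Lemma g_sym (x : N) u v : g x u v = g x v u.
Proof.
rewrite /g /metric_of -(calibrated_compat cal) JK.
by rewrite (pscaN (sr _)) sC opprK.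
Qed.

Lemma g_scalarl (x : N) u : scalar (fun v => g x v u).
Proof. by move=> a v v'; rewrite !(g_sym _ u) g_scalar. Qed.

Lemma g_smooth (x : N) s t : lsec x s -> lsec x t ->
  smooth_near (fun y => g y (s y) (t y)) x.
Proof. by move=> ls lt; apply: ssm => //; exact: lsJ. Qed.

Lemma g_Jl (x : N) u v : g x (J x u) v = sigma x u v.
Proof. by rewrite /g /metric_of (calibrated_compat cal). Qed.

Lemma g_JJ (x : N) u v : g x (J x u) (J x v) = g x u v.
Proof. by rewrite g_Jl. Qed.

(** If [u + J v = 0] with [u] and [v] in the isotropic span, then [sigma v (J v) = - sigma v u = 0],
    and positivity forces [v = 0], then [u = 0]. *)
Lemma isotropic_cindep (x : N) (e : 'I_k -> tangent (h x)) :
  (forall i j, sigma x (e i) (e j) = 0) -> indep e -> indep (rframe (J x) e).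
Proof.
move=> e0 ie a; rewrite big_sumType /=.
set u := \sum_i a (inl i) *: e i => E.
have {}E : u + J x (\sum_i a (inr i) *: e i) = 0.
  apply: etrans E; rewrite (plin_sum (lJ x)); congr (_ + _).
  by apply: eq_bigr => i _; rewrite (plinZ (lJ x)).
set v := \sum_i _ *: e i in E.
have uv : sigma x v u = 0.
  rewrite /u (psca_sum (sr _)) big1 // => i _.
  rewrite (pscaZ (sr _)) sC (psca_sum (sr _)) big1 ?oppr0 ?mulr0 // => j _.
  by rewrite (pscaZ (sr _)) e0 mulr0.
have v0 : v = 0.
  apply/eqP; apply: contraT => /(calibrated_pos cal).
  have -> : metric_of sigma J x v v = 0.
    rewrite /metric_of (_ : J x v = - u) ?(pscaN (sr _)) ?uv ?oppr0 //.
    by apply/eqP; rewrite -addr_eq0 addrC E.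
  by rewrite ltxx.
have u0 : u = 0 by move: E; rewrite v0 (plin0 (lJ x)) addr0.
by move=> [i|i]; [exact: (ie _ u0)|exact: (ie _ v0)].
Qed.

Lemma cindep_cbasis (x : N) (e : 'I_k -> tangent (h x)) :
  indep (rframe (J x) e) -> cbasis (J x) e.
Proof.
move=> ie; split=> // u.
have mI : k.*2 = #|{: 'I_k + 'I_k}| by rewrite card_sum card_ord addnn.
have [a ->] := indep_span mI ie u.
exists (fun i => a (inl i) +i* a (inr i)); rewrite -rframe_sum.
by apply: eq_bigr => -[i|i].
Qed.

Lemma framed_cbasis W x e : isotropic W -> framed W x e ->
  \forall y \near x, cbasis (J y) (e^~ y).
Proof.
move=> iW [le We]; apply: filterS We => y [We ie _].
by apply/cindep_cbasis/isotropic_cindep => // i j; exact: iW.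
Qed.

Lemma lsec_rframe x (e : 'I_k -> section) i : (forall i, lsec x (e i)) ->
  lsec x (fun y => rframe (J y) (e^~ y) i).
Proof. by move=> le; case: i => i; [exact: le|exact: lsJ]. Qed.

Lemma ccoef x (e : 'I_k -> section) : (forall i, lsec x (e i)) ->
  cbasis (J x) (e^~ x) -> forall s, lsec x s ->
  exists z : 'I_k -> N -> R[i], (forall i, csmooth (z i) x) /\
    \forall y \near x, s y = \sum_i cact (J y) (z i y) (e i y).
Proof.
move=> le [ie _] s ls.
have mI : k.*2 = #|{: 'I_k + 'I_k}| by rewrite card_sum card_ord addnn.
have [_ /(_ s ls)[a [sa sE]]] := frame_near
  (e := fun i y => rframe (J y) (e^~ y) i) sh mI
  (fun i => lsec_rframe i le) ie.
exists (fun i y => a (inl i) y +i* a (inr i) y); split=> [i|].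
  by split; exact: sa.
apply: filterS sE => y ->; rewrite -rframe_sum.
by apply: eq_bigr => -[i|i].
Qed.

Lemma ccoef_mx x (e f : 'I_k -> section) : (forall i, lsec x (e i)) ->
  cbasis (J x) (e^~ x) -> (forall i, lsec x (f i)) ->
  exists C : N -> 'M[R[i]]_k, (forall i j, csmooth (fun y => C y i j) x) /\
    \forall y \near x, cframe_mx (J y) (e^~ y) (C y) (f^~ y).
Proof.
move=> le be lf; have [z Hz] := choice (fun i => ccoef le be (lf i)).
exists (fun y => \matrix_(i, j) z i j y); split=> [i j|].
  have [sz _] := Hz i; have [s1 s2] := sz j.
  by split; under eq_fun do rewrite mxE.
have : \forall y \near x, forall i, f i y = \sum_j cact (J y) (z i j y) (e j y).
  by apply: filter_forall => i; exact: (Hz i).2.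
apply: filterS => y fE i; rewrite fE.
by apply: eq_bigr => j _; rewrite mxE.
Qed.

(** The vectors [f i] and [J (f i)] are orthonormal together, because [g (J u) v = sigma u v]
    vanishes on the frame; pairing a relation with each of them isolates its coefficients. *)
Lemma unitary_cbasis U (f : 'I_k -> section) x :
  unitary_frame sigma J U f -> U x -> cbasis (J x) (f^~ x).
Proof.
move=> [oU lf Uf] Ux; apply: cindep_cbasis => a; rewrite big_sumType /=.
have gf i j : g x (f i x) (f j x) = (i == j)%:R by exact: (Uf x Ux i j).1.
have sf i j : sigma x (f i x) (f j x) = 0 by exact: (Uf x Ux i j).2.
move=> E; have Ev v : g x (\sum_i a (inl i) *: f i x +
    \sum_i a (inr i) *: J x (f i x)) v = 0.
  by rewrite E (psca0 (g_scalarl v)).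
have gsum (b : 'I_k -> R) (F : 'I_k -> tangent (h x)) v j :
    (forall i, g x (F i) v = (i == j)%:R) -> g x (\sum_i b i *: F i) v = b j.
  move=> H; rewrite (psca_sum (g_scalarl v)) (bigD1 j) //=.
  rewrite (pscaZ (g_scalarl v)) H eqxx mulr1 big1 ?addr0 // => i /negbTE ij.
  by rewrite (pscaZ (g_scalarl v)) H ij mulr0.
have gsum0 (b : 'I_k -> R) (F : 'I_k -> tangent (h x)) v :
    (forall i, g x (F i) v = 0) -> g x (\sum_i b i *: F i) v = 0.
  move=> H; rewrite (psca_sum (g_scalarl v)) big1 // => i _.
  by rewrite (pscaZ (g_scalarl v)) H mulr0.
case=> j.
  have := Ev (f j x); rewrite (pscaD (g_scalarl _)) (gsum _ _ _ j) //.
  by rewrite gsum0 ?addr0 // => i; rewrite g_Jl.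
have := Ev (J x (f j x)); rewrite (pscaD (g_scalarl _)) addrC (gsum _ _ _ j).
  by rewrite gsum0 ?addr0 // => i; rewrite g_sym g_Jl.
by move=> i; rewrite g_JJ.
Qed.

(** Gram-Schmidt stays inside the span of the isotropic frame, so [sigma] still vanishes there and
    real orthonormality becomes unitarity. *)
Lemma unitary_frame_exists W x e : isotropic W -> framed W x e ->
  exists U f, U x /\ unitary_frame sigma J U f.
Proof.
move=> iW [le We].
have ie : \forall y \near x, indep (e^~ y) by apply: filterS We => y [].
have [f [lf Hf]] := gram_schmidt sh g_scalar g_sym (calibrated_pos cal) g_smooth le ie.
have : \forall y \near x, (forall i, lsec y (f i)) /\
    forall i j, g y (f i y) (f j y) = (i == j)%:R /\ sigma y (f i y) (f j y) = 0.
  have nlf : \forall y \near x, forall i, lsec y (f i).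
    by apply: filter_forall => i; exact: local_sectionS.
  apply: filterS3 Hf We nlf => y [gf fe] [Wy _ _] lfy; split=> // i j; split; first exact: gf.
  have [c ->] := fe i; have [c' ->] := fe j.
  rewrite (psca_sum (sr _)) big1 // => l _; rewrite (pscaZ (sr _)) sC.
  rewrite (psca_sum (sr _)) big1 ?oppr0 ?mulr0 // => l' _.
  by rewrite (pscaZ (sr _)) (iW y) ?mulr0.
move=> /near_openP[U [oU Ux] sU]; exists U, f; split=> //; split=> //.
  by move=> i; apply/(smooth_sectionP sh _ oU) => y /sU[+ _]; apply.
by move=> y /sU[_ +] i j; apply.
Qed.

End OneStructure.
End CalibratedPair.

Lemma cact_regroup (R : realType) (T : lmodType R) (J : T -> T) (a b : R)
    (z : complex R) (u v : T) :
  a *: u + Re z *: v + (b *: J u + Im z *: J v) =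
  cact J (Complex a b) u + cact J z v.
Proof. by rewrite addrACA. Qed.

Lemma cframe_mxB (R : realType) (T : lmodType R) (J : T -> T) k
    (e f g : 'I_k -> T) A B :
  cframe_mx J e A f -> cframe_mx J e B g ->
  cframe_mx J e (A - B) (fun i => f i - g i).
Proof.
move=> fA gB i; rewrite fA gB -sumrB; apply: eq_bigr => j _.
rewrite !mxE /cact; case: (A i j) => a a'; case: (B i j) => b b' /=.
by rewrite !scalerBl addrACA -opprD.
Qed.

(** * The difference of two connections and its trace *)

Section ConnectionTrace.
Local Open Scope complex_scope.
Context {R : realType} {d k : nat} {N : manifold R d} {M : manifold R k.*2}.
Variable h : N -> M.
Hypothesis sh : smooth_map h.

Notation section := (forall x : N, tangent (h x)).
Notation lsec := (local_section (whole h)).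
Notation conn := (forall x : N, tangent x -> section -> tangent (h x)).

Variable sigma : forall x : N, tangent (h x) -> tangent (h x) -> R.
Arguments sigma : clear implicits.
Hypothesis sr : forall (x : N) u, scalar (sigma x u).
Hypothesis sC : forall (x : N) u v, sigma x u v = - sigma x v u.

Variable J : forall x : N, tangent (h x) -> tangent (h x).
Arguments J : clear implicits.
Hypothesis cal : calibrated sigma J.

Let lJ x : linear (J x). Proof. exact: (calibrated_smooth cal).1. Qed.
Arguments lJ : clear implicits.
Let JK x u : J x (J x u) = - u. Proof. exact: (calibratedK cal). Qed.
Arguments JK : clear implicits.
Let lsJ x s : lsec x s -> lsec x (fun y => J y (s y)).
Proof. exact: (calibrated_smooth cal).2. Qed.

Lemma section_extension x (u : tangent (h x)) : exists2 s, lsec x s & s x = u.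
Proof.
have [X lX Xu] := vfield_extension u.
by exists (fun y => X (h y)) => //; exact: pull_section.
Qed.

Variables D0 D1 : conn.
Arguments D0 : clear implicits.
Arguments D1 : clear implicits.

Definition conn_diff x (v : tangent x) (al : tangent (h x) -> tangent (h x)) :=
  [/\ linear al, forall u, al (J x u) = J x (al u) &
      forall s, lsec x s -> D1 x v s - D0 x v s = al (s x)].

(** The value at [v] of the form [sqrt(-1) / (2 pi) tr alpha], read in an arbitrary complex basis at
    the single point [x]. Since [sqrt(-1) z] has real part [- Im z], only the imaginary part of the
    trace enters. *)
Definition maslov_at x (v : tangent x) (r : R) : Prop :=
  exists al (e : 'I_k -> tangent (h x)) A, [/\ conn_diff v al, cbasis (J x) e,
    cframe_mx (J x) e A (fun i => al (e i)) & r = - (2 * pi)^-1 * Im (\tr A)].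

Lemma conn_diff_uniq x (v : tangent x) al al' :
  conn_diff v al -> conn_diff v al' -> al =1 al'.
Proof.
move=> [_ _ H] [_ _ H'] u; have [s ls <-] := section_extension u.
by rewrite -H // -H'.
Qed.

Lemma maslov_at_uniq x (v : tangent x) r r' :
  maslov_at v r -> maslov_at v r' -> r = r'.
Proof.
move=> [al [e [A [cd be eA ->]]]] [al' [e' [A' [cd' be' eA' ->]]]].
have [la aJ _] := cd; congr (_ * Im _).
apply: (ctrace_basis (lJ x) (JK x) la aJ be be' eA) => i.
by rewrite (conn_diff_uniq cd cd') -eA'.
Qed.

Section Differences.
Variables L0 L1 : forall x : N, set (tangent (h x)).
Hypotheses (ou0 : orthogonal_unitary sigma J L0 D0)
  (ou1 : orthogonal_unitary sigma J L1 D1).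

(** Expanding in a frame, the derivatives of the coefficients occur identically for both connections
    and cancel, leaving a map of the value [s x]; it is complex linear because both commute with
    [J]. *)
Lemma conn_diff_ex x (v : tangent x) : exists al, conn_diff v al.
Proof.
have [e [le lhe ie]] := pull_coord_frame sh x.
have mI : k.*2 = #|'I_(k.*2)| by rewrite card_ord.
have [a aE] := choice (fun u => indep_span mI ie u).
pose al u := \sum_i a u i *: (D1 x v (fun y => e i (h y)) - D0 x v (fun y => e i (h y))).
have auniq u b : u = \sum_i b i *: e i (h x) -> a u = b.
  move=> uE; apply/funext => i; apply/eqP; rewrite -subr_eq0; apply/eqP.
  apply: (ie (fun i => a u i - b i)).
  by under eq_bigr do rewrite scalerBl; rewrite sumrB -aE -uE subrr.
have alE s : lsec x s -> D1 x v s - D0 x v s = al (s x).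
  move=> ls; have [_ /(_ s ls)[b [sb sE]]] :=
    frame_near (e := fun i y => e i (h y)) sh mI lhe ie.
  rewrite (conn_frame sh (ou_connection ou1) v (fun i _ => sb i) (fun i _ => lhe i) sE).
  rewrite (conn_frame sh (ou_connection ou0) v (fun i _ => sb i) (fun i _ => lhe i) sE).
  rewrite -sumrB /al (auniq _ _ (nbhs_singleton sE)).
  apply: eq_bigr => i _; rewrite opprD addrACA subrr add0r scalerBr.
  by [].
exists al; split=> //.
  move=> c u u'; rewrite /al (auniq (c *: u + u') (fun i => c * a u i + a u' i)).
    by rewrite scaler_sumr -big_split /=; apply: eq_bigr => i _; rewrite scalerDl scalerA.
  rewrite {1}(aE u) {1}(aE u') scaler_sumr -big_split /=.
  by apply: eq_bigr => i _; rewrite scalerDl scalerA.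
move=> u; have [s ls su] := section_extension u.
have := alE _ (lsJ ls); rewrite (ou_J ou0) // (ou_J ou1) // su => <-.
by rewrite -(plinB (lJ x)) alE // su.
Qed.

Lemma maslov_at_ex x (v : tangent x) (e : 'I_k -> tangent (h x)) :
  cbasis (J x) e -> exists r, maslov_at v r.
Proof.
move=> be; have [al cd] := conn_diff_ex v.
have [A eA] := cframe_mx_ex (fun i => al (e i)) be.
by exists (- (2 * pi)^-1 * Im (\tr A)), al, e, A.
Qed.

(* Differentiating [tau = C eps] gives
   [D1 tau - D0 tau = W1 tau - (dC + C W0) eps], where the matrices [W0] and
   [W1] are real because [D0] and [D1] preserve [L0] and [L1]; only
   [tr (dC C^-1) = d (det C) / det C] has an imaginary part. *)
Lemma maslov_at_logdet x (v : tangent x) (eps tau : 'I_k -> section)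
    (C : N -> 'M[R[i]]_k) :
  isotropic sigma L0 -> isotropic sigma L1 ->
  framed L0 x eps -> framed L1 x tau ->
  (forall i j, csmooth (fun y => C y i j) x) ->
  (\forall y \near x, cframe_mx (J y) (eps^~ y) (C y) (tau^~ y)) ->
  maslov_at v ((2 * pi)^-1 * Im (cdfun (fun y => \det (C y)) v / \det (C x))).
Proof.
move=> i0 i1 fe ft sCx tauE.
have be := nbhs_singleton (framed_cbasis sr sC cal i0 fe).
have bt := nbhs_singleton (framed_cbasis sr sC cal i1 ft).
have [le eW] := fe; have [lt tW] := ft.
have uC := cframe_mx_unit (lJ x) (JK x) be bt (nbhs_singleton tauE).
have [al cd] := conn_diff_ex v.
have realmx W (D : conn) (f : 'I_k -> section) : framed W x f ->
    orthogonal_unitary sigma J W D ->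
    exists om : 'M[R]_k, cframe_mx (J x) (f^~ x) (map_mx (real_complex R) om)
      (fun i => D x v (f i)).
  move=> [lf fW] ou; have [Wx _ sW] := nbhs_singleton fW.
  have WD i : W x (D x v (f i)).
    apply: (ou_subbundle ou); apply/local_sectionW; split; first exact: lf.
    by apply: filterS fW => y [].
  have [om omE] := choice (fun i => sW _ (WD i)).
  exists (\matrix_(i, j) om i j) => i; rewrite omE.
  by apply: eq_bigr => j _; rewrite !mxE cact_real.
have [om0 om0E] := realmx _ _ _ fe ou0; have [om1 om1E] := realmx _ _ _ ft ou1.
pose dC := \matrix_(i, j) cdfun (fun y => C y i j) v.
pose W0 := map_mx (real_complex R) om0; pose W1 := map_mx (real_complex R) om1.
have D0tau : cframe_mx (J x) (eps^~ x) (dC + C x *m W0) (fun i => D0 x v (tau i)).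
  move=> i.
  pose a (j : 'I_k + 'I_k) y := match j with
    inl j => Re (C y i j) | inr j => Im (C y i j) end.
  have sa j : smooth_near (a j) x by case: j => j; [exact: (sCx i j).1|exact: (sCx i j).2].
  have tE : \forall y \near x, tau i y = \sum_j a j y *: rframe (J y) (eps^~ y) j.
    by apply: filterS tauE => y ->; rewrite -rframe_sum; apply: eq_bigr => -[].
  rewrite (conn_frame (e := fun j y => rframe (J y) (eps^~ y) j) sh
    (ou_connection ou0) v (fun j _ => sa j)
    (fun j _ => lsec_rframe cal j le) tE).
  rewrite big_sumType /= -big_split /=.
  under [RHS]eq_bigr do rewrite mxE cactDl.
  rewrite [RHS]big_split /=.
  under [X in _ = _ + X]eq_bigr do rewrite mxE cact_suml.
  rewrite [X in _ = _ + X]exchange_big /= -big_split /=.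
  apply: eq_bigr => j _.
  have DJ : D0 x v (fun y => J y (eps j y)) = J x (D0 x v (eps j)).
    exact: (ou_J ou0).
  transitivity (cact (J x) (dC i j) (eps j x) + cact (J x) (C x i j) (D0 x v (eps j))).
    by rewrite DJ mxE; exact: cact_regroup.
  congr (_ + _); rewrite om0E (cact_sumr (lJ x)).
  by apply: eq_bigr => l _; rewrite (cactM (lJ x) (JK x)).
have [Ci CiE] : exists Ci, cframe_mx (J x) (tau^~ x) Ci (eps^~ x).
  exact: cframe_mx_ex.
have CiC : Ci = invmx (C x).
  have := cframe_mx_inj be.1 (cframe_mxM (lJ x) (JK x) (nbhs_singleton tauE) CiE)
    (cframe_mx1 (J x) (eps^~ x)).
  by move=> E; rewrite -[Ci](mulmxK uC) E mul1mx.
exists al, (tau^~ x), (W1 - (dC + C x *m W0) *m Ci); split=> //.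
  have H := cframe_mxM (lJ x) (JK x) CiE D0tau.
  move=> i; have [_ _ alE] := cd; rewrite -alE //.
  exact: (cframe_mxB om1E H).
rewrite CiC mulmxDl opprD addrA.
set T1 := dC *m invmx (C x).
have trW0 : \tr (C x *m W0 *m invmx (C x)) = \tr W0.
  by rewrite mxtrace_mulC mulmxA mulVmx // mul1mx.
have Imreal (om : 'M[R]_k) : Im (\tr (map_mx (real_complex R) om)) = 0.
  by rewrite trace_map_mx.
rewrite !raddfB /= trW0 !Imreal subr0 sub0r mulNr mulrN opprK.
by rewrite (cdfun_det_invmx v sCx uC).
Qed.

End Differences.
End ConnectionTrace.

(** * The argument function and its differential *)

Section ComplexArgument.
Local Open Scope complex_scope.
Context {R : realType}.

Lemma dfunV d (N : manifold R d) (f : N -> R) x (v : tangent x) :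
  smooth_near f x -> f x != 0 ->
  dfun (fun y => (f y)^-1) v = - dfun f v / f x ^+ 2.
Proof.
move=> sf f0; have sV := smooth_nearV f0 sf.
have : dfun (fun y => f y * (f y)^-1) v = 0.
  apply: (dfun_near_cst (a := 1)).
  by apply: filterS (near_neq0 sf f0) => y fy; rewrite mulfV.
rewrite dfunM // => /(canRL (addrK _)); rewrite sub0r => E.
by apply: (mulfI f0); rewrite E; field.
Qed.

Lemma dfun_atan d (N : manifold R d) (f : N -> R) x (v : tangent x) :
  smooth_near f x -> dfun (fun y => atan (f y)) v = dfun f v / (1 + f x ^+ 2).
Proof.
move=> sf; have da : differentiable (@atan R) (f x) by exact/derivable1_diffP.
rewrite (dfun_comp_real v sf da); congr (_ * _).
by rewrite -deriveE //; exact: derive_val.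
Qed.

(** The argument only where [Re z > 0]; elsewhere off the imaginary axis it differs from an argument
    by a multiple of [pi], with the same differential. *)
Definition carg (z : R[i]) : R := atan (Im z / Re z).

Context {d : nat} {N : manifold R d}.

Lemma carg_smooth (q : N -> R[i]) x : csmooth q x -> Re (q x) != 0 ->
  smooth_near (fun y => carg (q y)) x.
Proof.
move=> [s1 s2] q0; apply: smooth_near_atan; apply: smooth_nearM => //.
exact: smooth_nearV.
Qed.

Lemma dfun_carg (q : N -> R[i]) x (v : tangent x) : csmooth q x ->
  Re (q x) != 0 -> dfun (fun y => carg (q y)) v = Im (cdfun q v / q x).
Proof.
move=> [s1 s2] q0.
have sV : smooth_near (fun y => (Re (q y))^-1) x by exact: smooth_nearV.
rewrite dfun_atan; last exact: smooth_nearM.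
rewrite (dfunM v s2 sV) (dfunV v s1 q0).
rewrite /cdfun; move: (dfun _ v) (dfun _ v) q0 => a' b'.
case: (q x) => a b /= a0.
have ab : a ^+ 2 + b ^+ 2 != 0.
  by rewrite gt_eqF // ltr_pwDl ?exprn_even_gt0 ?sqr_ge0.
have e1 : 1 + (b / a) ^+ 2 = (a ^+ 2 + b ^+ 2) / a ^+ 2.
  by rewrite expr_div_n mulrDl mulfV // expf_neq0.
by rewrite e1; field; rewrite a0 ab.
Qed.

Lemma cdfunZ (q : N -> R[i]) c x (v : tangent x) : csmooth q x ->
  cdfun (fun y => c * q y) v = c * cdfun q v.
Proof. by move=> sq; rewrite cdfunM ?cdfun_cst ?mul0r ?addr0 //; exact: csmooth_cst. Qed.

Lemma csmoothS (q : N -> R[i]) x : csmooth q x -> \forall y \near x, csmooth q y.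
Proof.
by move=> [s1 s2]; apply: filterS2 (smooth_nearS s1) (smooth_nearS s2).
Qed.

(** A constant factor [c] leaves the logarithmic derivative unchanged; it serves to rotate [q x]
    into the half-plane where [carg] is an argument. *)
Lemma dfun_carg_ratio (q : N -> R[i]) c x (v : tangent x) : csmooth q x ->
  c != 0 -> Re (c * q x) != 0 ->
  dfun (fun y => carg (c * q y)) v = Im (cdfun q v / q x).
Proof.
move=> sq c0 q0; rewrite dfun_carg //; last first.
  by apply: csmoothM => //; exact: csmooth_cst.
by rewrite cdfunZ // invfM mulrACA mulfV // mul1r.
Qed.

End ComplexArgument.

(** * Maslov forms in terms of their pointwise values *)

Section MaslovForms.
Local Open Scope complex_scope.
Context {R : realType} {d k : nat} {N : manifold R d} {M : manifold R k.*2}.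
Variable h : N -> M.
Hypothesis sh : smooth_map h.

Notation section := (forall x : N, tangent (h x)).
Notation lsec := (local_section (whole h)).
Notation conn := (forall x : N, tangent x -> section -> tangent (h x)).

Variable sigma : forall x : N, tangent (h x) -> tangent (h x) -> R.
Arguments sigma : clear implicits.
Hypothesis sr : forall (x : N) u, scalar (sigma x u).
Hypothesis sC : forall (x : N) u v, sigma x u v = - sigma x v u.
Hypothesis ssm : forall (x : N) s t, lsec x s -> lsec x t ->
  smooth_near (fun y => sigma y (s y) (t y)) x.

Variable J : forall x : N, tangent (h x) -> tangent (h x).
Arguments J : clear implicits.
Hypothesis cal : calibrated sigma J.
Variables D0 D1 : conn.
Arguments D0 : clear implicits.
Arguments D1 : clear implicits.
Variables L0 L1 : forall x : N, set (tangent (h x)).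
Hypotheses (ou0 : orthogonal_unitary sigma J L0 D0)
  (ou1 : orthogonal_unitary sigma J L1 D1).
Hypotheses (i0 : isotropic sigma L0) (f0 : forall x, exists e, framed L0 x e).

(** One complex equation with a real left-hand side carries two real conditions, the second being
    that the trace is purely imaginary. *)
Lemma maslov_factor (t : R) (z : R[i]) :
  t%:C = (0 +i* 1) / (2 * pi)%:C * z <-> t = - (2 * pi)^-1 * Im z /\ Re z = 0.
Proof.
have p0 : (2 * pi)^-1 != 0 :> R by rewrite invr_neq0 // mulf_neq0 // gt_eqF // pi_gt0.
have -> : (0 +i* 1) / (2 * pi)%:C * z =
    (- (2 * pi)^-1 * Im z) +i* ((2 * pi)^-1 * Re z).
  rewrite -fmorphV; case: z => a b.
  by apply/eqP; rewrite eq_complex /=; apply/andP; split; apply/eqP; ring.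
split=> [[-> /esym/eqP]|[-> ->]]; last by rewrite mulr0.
by rewrite mulf_eq0 (negbTE p0) => /eqP.
Qed.

Lemma maslov_form_at (theta : forall x : N, tangent x -> R) x (v : tangent x) :
  is_maslov_form sigma J D0 D1 theta -> maslov_at J D0 D1 v (theta x v).
Proof.
move=> mf; have [e fe] := f0 x.
have [U [f [Ux uf]]] := unitary_frame_exists sh sr sC ssm cal i0 fe.
have lf i y : U y -> lsec y (f i).
  by have [oU lf _] := uf; move=> Uy; have /(smooth_sectionP sh _ oU) := lf i; apply.
(* [is_maslov_form] wants coefficients given at all points at once: they are chosen pointwise on
   [U], and the matrix [0] serves as default outside. *)
have H y (u : tangent y) : exists A : 'M[R[i]]_k, U y ->
    exists al, conn_diff J D0 D1 u al /\
    cframe_mx (J y) (f^~ y) A (fun i => al (f i y)).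
  have [Uy|nUy] := pselect (U y); last by exists 0.
  have [al cd] := conn_diff_ex sh cal ou0 ou1 u.
  have [A HA] := cframe_mx_ex (fun i => al (f i y)) (unitary_cbasis sr sC cal uf Uy).
  by exists A => _; exists al.
pose A i j y (u : tangent y) := projT1 (cid (H y u)) i j.
have AE y (u : tangent y) i : U y -> D1 y u (f i) - D0 y u (f i) =
    \sum_j (Re (A i j y u) *: f j y + Im (A i j y u) *: J y (f j y)).
  move=> Uy; rewrite /A; case: (cid _) => B /= /(_ Uy)[al [[_ _ alE] BE]].
  by rewrite alE ?BE //; exact: lf.
have /maslov_factor[-> _] := mf U f A uf AE x v Ux.
have [al [cd BE]] := projT2 (cid (H x v)) Ux.
by exists al, (f^~ x), (projT1 (cid (H x v))); split=> //; exact: unitary_cbasis uf Ux.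
Qed.

(** Besides the value, the real part of the trace has to vanish: differentiating the constant
    [g (e i) (e i) = 1] shows that each derivative of [e i] is orthogonal to [e i], so the diagonal
    entries of the difference are imaginary. *)
Lemma maslov_form_of_at (theta : forall x : N, tangent x -> R) :
  (forall x v, maslov_at J D0 D1 v (theta x v)) -> is_maslov_form sigma J D0 D1 theta.
Proof.
move=> mt U e A uf AE x v Ux; have [oU le Ue] := uf.
have be := unitary_cbasis sr sC cal uf Ux.
have lex i : lsec x (e i) by have /(smooth_sectionP sh _ oU) := le i; apply.
have [al cd] := conn_diff_ex sh cal ou0 ou1 v.
pose B := \matrix_(i, j) A i j x v.
have BE : cframe_mx (J x) (e^~ x) B (fun i => al (e i x)).
  move=> i; have [_ _ <-] := cd; last exact: lex.
  by rewrite AE //; apply: eq_bigr => j _; rewrite mxE.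
have trB : \sum_i A i i x v = \tr B by apply: eq_bigr => i _; rewrite mxE.
rewrite trB; apply/maslov_factor; split.
  apply: (maslov_at_uniq sh cal (mt x v)).
  by exists al, (e^~ x), B.
pose g := metric_of sigma J.
have ge i j : g x (e i x) (e j x) = (i == j)%:R by exact: (Ue x Ux i j).1.
have se i j : sigma x (e i x) (e j x) = 0 by exact: (Ue x Ux i j).2.
have gD (D : conn) W : orthogonal_unitary sigma J W D -> forall i,
    g x (D x v (e i)) (e i x) = 0.
  move=> ou i; have := ou_metric ou v (lex i) (lex i).
  rewrite (dfun_near_cst (a := 1)); last first.
    apply: filterS (open_nbhs_nbhs (conj oU Ux)) => y Uy.
    by rewrite (Ue y Uy i i).1 eqxx.
  rewrite -/g [X in _ + X](g_sym sr sC cal) => /esym/eqP.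
  by rewrite -mulr2n mulrn_eq0 /= => /eqP.
rewrite -trB -[LHS]/(Re _) raddf_sum big1 // => i _.
have gl u : scalar (fun z => g x z u) by exact: (g_scalarl sr sC cal).
have gJ u z : g x (J x u) z = sigma x u z by exact: (g_Jl cal).
have : g x (D1 x v (e i) - D0 x v (e i)) (e i x) = 0.
  by rewrite (pscaD (gl _)) (pscaN (gl _)) (gD _ _ ou0) (gD _ _ ou1) subrr.
rewrite AE // (psca_sum (gl _)) (bigD1 i) //=.
rewrite (pscaD (gl _)) !(pscaZ (gl _)).
rewrite ge eqxx mulr1 gJ se mulr0 addr0 big1 ?addr0 // => j /negbTE ji.
rewrite (pscaD (gl _)) !(pscaZ (gl _)).
by rewrite ge ji mulr0 gJ se mulr0 addr0.
Qed.

End MaslovForms.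

(** * Lifts of the argument and independence of the complex structure *)

Section ComplexContinuity.
Local Open Scope complex_scope.
Context {R : realType} {T : topologicalType}.
Implicit Types f g : T -> R[i].

Definition ccont f (x : T) := continuous_at x (fun y => Re (f y)) /\
  continuous_at x (fun y => Im (f y)).

Lemma ccont_cst c x : ccont (fun _ => c) x.
Proof. by split; exact: cvg_cst. Qed.

Lemma ccontD f g x : ccont f x -> ccont g x -> ccont (fun y => f y + g y) x.
Proof.
move=> [f1 f2] [g1 g2]; split.
  by under eq_fun do rewrite cReD; exact: cvgD.
by under eq_fun do rewrite cImD; exact: cvgD.
Qed.

Lemma ccontM f g x : ccont f x -> ccont g x -> ccont (fun y => f y * g y) x.
Proof.
move=> [f1 f2] [g1 g2]; split.
  by under eq_fun do rewrite cReM; apply: cvgB; exact: cvgM.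
by under eq_fun do rewrite cImM; apply: cvgD; exact: cvgM.
Qed.

Lemma ccont_sum (I : Type) (r : seq I) (P : pred I) (F : I -> T -> R[i]) x :
  (forall i, P i -> ccont (F i) x) ->
  ccont (fun y => \sum_(i <- r | P i) F i y) x.
Proof.
move=> H; elim: r => [|i r IH].
  by under eq_fun do rewrite big_nil; exact: ccont_cst.
have [Pi|nPi] := boolP (P i).
  by under eq_fun do rewrite big_cons Pi; apply: ccontD => //; exact: H.
by under eq_fun do rewrite big_cons (negbTE nPi).
Qed.

Lemma ccont_prod (I : Type) (r : seq I) (P : pred I) (F : I -> T -> R[i]) x :
  (forall i, P i -> ccont (F i) x) ->
  ccont (fun y => \prod_(i <- r | P i) F i y) x.
Proof.
move=> H; elim: r => [|i r IH].
  by under eq_fun do rewrite big_nil; exact: ccont_cst.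
have [Pi|nPi] := boolP (P i).
  by under eq_fun do rewrite big_cons Pi; apply: ccontM => //; exact: H.
by under eq_fun do rewrite big_cons (negbTE nPi).
Qed.

Lemma ccont_det n (A : T -> 'M[R[i]]_n) x :
  (forall i j, ccont (fun y => A y i j) x) -> ccont (fun y => \det (A y)) x.
Proof.
move=> sA; apply: ccont_sum => s _; apply: ccontM; first exact: ccont_cst.
by apply: ccont_prod => i _.
Qed.

End ComplexContinuity.

Section Lifts.
Local Open Scope complex_scope.
Context {R : realType}.

Definition cpos (z : R[i]) : Prop := Im z = 0 /\ 0 < Re z.

Definition cconj (z : R[i]) : R[i] := Re z -i* Im z.

Definition cis (a : R) : R[i] := cos a +i* sin a.

Lemma cposM y z : cpos y -> cpos z -> cpos (y * z).
Proof.
case: y => a b; case: z => a' b' [/= -> a0] [/= -> a'0]; split=> /=.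
  by rewrite mulr0 mul0r addr0.
by rewrite mulr0 subr0 mulr_gt0.
Qed.

Lemma cposMl c z : cpos c -> cpos (c * z) -> cpos z.
Proof.
case: c => a b; case: z => a' b' [/= -> a0]; rewrite /cpos /= !mul0r addr0 subr0.
move=> [/eqP]; rewrite mulf_eq0 gt_eqF //= => /eqP -> H; split=> //.
by rewrite -(pmulr_rgt0 _ a0).
Qed.

Lemma cpos_conj z : z != 0 -> cpos (cconj z * z).
Proof.
case: z => a b; rewrite eq_complex /= negb_and => ab; split=> /=; first by ring.
rewrite mulNr opprK -!expr2.
have [a0|a0] := boolP (a == 0); last first.
  by rewrite ltr_pwDl ?sqr_ge0 // exprn_even_gt0.
by rewrite ltr_wpDl ?sqr_ge0 // exprn_even_gt0 //=; move: ab; rewrite a0.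
Qed.

Lemma cisD a b : cis (a + b) = cis a * cis b.
Proof. by rewrite /cis cosD sinD; apply/eqP; rewrite eq_complex /= eqxx addrC mulrC
  [X in _ + X]mulrC eqxx. Qed.

Lemma cpos_carg z : 0 < Re z -> cpos (z * cis (- carg z)).
Proof.
case: z => a b /= a0; rewrite /carg /= /cis cosN sinN /cpos /=.
set t := b / a.
have c0 : 0 < cos (atan t) by rewrite cos_atan invr_gt0 sqrtr_gt0 ltr_pwDl ?sqr_ge0.
have -> : sin (atan t) = t * cos (atan t).
  by rewrite -[X in X * _](atanK t) /tan divfK // gt_eqF.
split; first by rewrite /t; field; rewrite gt_eqF.
have -> : a * cos (atan t) - b * - (t * cos (atan t)) =
    (a + b ^+ 2 / a) * cos (atan t) by rewrite /t; field; rewrite gt_eqF.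
by rewrite mulr_gt0 // ltr_pwDl // divr_ge0 ?sqr_ge0 // ltW.
Qed.

(** The normalisation [phi 0 = 0] forces [q 0] to be a positive real and removes the ambiguity by
    multiples of [2 pi]. *)
Definition arg_lift (q : R -> R[i]) (phi : R -> R) : Prop :=
  [/\ {within `[0, 1], continuous phi}, phi 0 = 0 &
      forall t : R, 0 <= t <= 1 -> cpos (q t * cis (- phi t))].

(** Both hypotheses are polar forms of the same number: the moduli [r] and [s] are positive with
    equal squares, so the cosines and sines agree. *)
Lemma cpos_cis z a b : cpos (z * cis (- a)) -> cpos (z * cis (- b)) -> cos (a - b) = 1.
Proof.
case: z => x y; rewrite /cpos /cis !cosN !sinN /= cosB.
move=> [i1 r1] [i2 r2].
set r := x * cos a - y * - sin a in r1; set s := x * cos b - y * - sin b in r2.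
have ca := cos2Dsin2 a; have cb := cos2Dsin2 b.
have key (t u : R) : cos t ^+ 2 + sin t ^+ 2 = 1 -> x * - sin t + y * cos t = 0 ->
    u = x * cos t - y * - sin t -> x = u * cos t /\ y = u * sin t.
  move=> c1 E0 ->; split.
    rewrite (_ : _ * cos t = x * (cos t ^+ 2 + sin t ^+ 2) +
      sin t * (x * - sin t + y * cos t)); last by ring.
    by rewrite c1 E0 mulr1 mulr0 addr0.
  rewrite (_ : _ * sin t = y * (cos t ^+ 2 + sin t ^+ 2) -
      cos t * (x * - sin t + y * cos t)); last by ring.
  by rewrite c1 E0 mulr1 mulr0 subr0.
have [xr yr] := key a r ca i1 erefl.
have [xs ys] := key b s cb i2 erefl.
have rs : r = s.
  have : r ^+ 2 = s ^+ 2.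
    have e1 : r ^+ 2 = x ^+ 2 + y ^+ 2 by rewrite xr yr !exprMn -mulrDr ca mulr1.
    have e2 : s ^+ 2 = x ^+ 2 + y ^+ 2 by rewrite xs ys !exprMn -mulrDr cb mulr1.
    by rewrite e1 e2.
  by move/eqP; rewrite eqrXn2 ?ltW // => /eqP.
have r0 : r != 0 by rewrite gt_eqF.
have c : cos a = cos b by apply: (mulfI r0); rewrite -xr [in RHS]rs.
have s' : sin a = sin b by apply: (mulfI r0); rewrite -yr [in RHS]rs.
by rewrite c s' -!expr2.
Qed.

Let cos_lt1 (v : R) : 0 < v <= pi -> cos v != 1.
Proof.
move=> /andP[v0 vpi]; apply/eqP => cv.
suff : v = 0 by move=> E; rewrite E ltxx in v0.
apply: cos_inj; rewrite ?in_itv /= ?lexx ?(ltW v0) ?vpi ?pi_ge0 //.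
by rewrite cv cos0.
Qed.

(** Two lifts differ by angles of cosine 1. If the end values were in the wrong order, the
    intermediate value theorem would give a difference [v] with [0 < v <= pi], where the cosine is
    never 1; the minimum with [pi] keeps [v] in that range. *)
Let lift_le q phi psi : arg_lift q phi -> arg_lift q psi -> phi 1 <= psi 1.
Proof.
move=> [cphi phi0 Hphi] [cpsi psi0 Hpsi]; rewrite leNgt; apply/negP => lt.
have cd : {within `[0, 1], continuous (fun t : R => phi t - psi t)}.
  by move=> t; apply: cvgB; [exact: cphi|exact: cpsi].
pose v : R := Num.min (phi 1 - psi 1) pi.
have v0 : 0 < v by rewrite lt_min subr_gt0 lt pi_gt0.
have [c /[!in_itv]/= c01 cE] : exists2 c, c \in `[0, 1]%R & phi c - psi c = v.
  apply: IVT => //; rewrite phi0 psi0 subrr.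
  have vle : v <= phi 1 - psi 1 by rewrite /v ge_min lexx.
  by apply/andP; split; [rewrite ge_min (ltW v0)|rewrite le_max vle orbT].
have := cpos_cis (Hphi c c01) (Hpsi c c01); rewrite cE; apply/eqP/cos_lt1.
by rewrite v0 /v ge_min lexx orbT.
Qed.

Lemma arg_lift_uniq q phi psi : arg_lift q phi -> arg_lift q psi -> phi 1 = psi 1.
Proof. by move=> H1 H2; apply/eqP; rewrite eq_le !(lift_le H1, lift_le H2). Qed.

Lemma arg_liftZ c q q' phi : cpos c ->
  (forall t : R, 0 <= t <= 1 -> q' t = c * q t) -> arg_lift q phi -> arg_lift q' phi.
Proof.
move=> c0 qq' [c1 p0 H]; split=> // t t01; rewrite qq' // -mulrA.
by apply: cposM => //; exact: H.
Qed.

Lemma arg_liftM q q' phi psi : arg_lift q phi -> arg_lift q' psi ->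
  arg_lift (fun t => q t * q' t) (fun t => phi t + psi t).
Proof.
move=> [c1 p1 H1] [c2 p2 H2]; split.
- by move=> t; apply: cvgD; [exact: c1|exact: c2].
- by rewrite p1 p2 addr0.
- by move=> t t01; rewrite opprD cisD mulrACA; apply: cposM; [exact: H1|exact: H2].
Qed.

Lemma arg_lift1 : arg_lift (fun=> 1) (fun=> 0).
Proof.
split=> //; first by move=> t; exact: cvg_cst.
by move=> t _; rewrite mul1r oppr0 /cis cos0 sin0; split.
Qed.

End Lifts.

(** * Existence of lifts along polynomial paths *)

Section LiftExistence.
Local Open Scope complex_scope.
Context {R : realType}.

Lemma carg_continuous (T : topologicalType) (f : T -> R[i]) x :
  ccont f x -> Re (f x) != 0 -> continuous_at x (fun y => carg (f y)).
Proof.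
move=> [f1 f2] f0.
apply: (@continuous_comp _ _ _ (fun y => Im (f y) / Re (f y)) (@atan R)).
  by apply: cvgM => //; exact: cvgV.
exact: continuous_atan.
Qed.

Lemma ccont_of_real (x : R) : ccont (fun t : R => t%:C) x.
Proof. by split; [exact: cvg_id|exact: cvg_cst]. Qed.

(* Off the negative real axis, [arg z = 2 arg (z + |z|)]. *)
Lemma arg_lift_linear (c : R[i]) :
  (forall t : R, 0 <= t <= 1 -> Im (1 + t%:C * c) = 0 -> 0 < Re (1 + t%:C * c)) ->
  exists phi, arg_lift (fun t : R => 1 + t%:C * c) phi.
Proof.
move=> H; pose z (t : R) := 1 + t%:C * c.
pose nz t := Num.sqrt (Re (z t) ^+ 2 + Im (z t) ^+ 2).
pose w t := z t + (nz t)%:C.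
have n2 t : nz t ^+ 2 = Re (z t) ^+ 2 + Im (z t) ^+ 2.
  by rewrite sqr_sqrtr // addr_ge0 ?sqr_ge0.
have Rew t : 0 <= t <= 1 -> 0 < Re (w t).
  move=> t01; rewrite cReD [X in _ + X]/=.
  have [i0|i0] := eqVneq (Im (z t)) 0.
    by rewrite ltr_pwDl ?sqrtr_ge0 //; exact: H.
  have lt : `|Re (z t)| < nz t.
    rewrite -sqrtr_sqr ltr_sqrt; last by rewrite ltr_wpDl ?sqr_ge0 // exprn_even_gt0.
    by rewrite ltrDl exprn_even_gt0.
  rewrite addrC -ltrBlDr sub0r; apply: le_lt_trans lt.
  by rewrite -normrN ler_norm.
have cz t : ccont z t.
  apply: ccontD; first exact: ccont_cst.
  by apply: ccontM; [exact: ccont_of_real|exact: ccont_cst].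
have cn t : ccont (fun t => (nz t)%:C) t.
  split; last exact: cvg_cst.
  apply: (@continuous_comp _ _ _ (fun t => Re (z t) ^+ 2 + Im (z t) ^+ 2) Num.sqrt).
    have [c1 c2] := cz t.
    have : continuous_at t (fun t => Re (z t) * Re (z t) + Im (z t) * Im (z t)).
      by apply: cvgD; exact: cvgM.
    exact.
  exact: sqrt_continuous.
exists (fun t => carg (w t) + carg (w t)); split.
- apply: continuous_in_subspaceT => t; rewrite inE /= in_itv /= => t01.
  have ca : continuous_at t (fun t => carg (w t)).
    apply: carg_continuous; first exact: ccontD.
    by rewrite gt_eqF // Rew.
  exact: cvgD.
- have z0 : z 0 = 1 by rewrite /z mul0r addr0.
  by rewrite /carg /w z0 /= addr0 mul0r atan0 addr0.
- move=> t t01; have r0 := Rew t t01; have H1 := cpos_carg r0.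
  have := cposM H1 H1; rewrite mulrACA -cisD -opprD.
  have -> : w t * w t = (2 * Re (w t))%:C * z t.
    apply/eqP; rewrite eq_complex /w; move: (n2 t); rewrite /nz.
    move: (Num.sqrt _) => s; case: (z t) => a b /= E.
    by apply/andP; split; apply/eqP; [nra|ring].
  by rewrite -mulrA; apply: cposMl; split=> //=; rewrite mulr_gt0.
Qed.

(** Over the complex numbers [P(t) / P(0)] is the product of the factors [1 - t / a] over the roots
    [a]. Each factor is lifted separately and the lifts are added; the positive number [cconj P.[0]
    * P.[0]] restores the scale. *)
Lemma arg_lift_poly (P : {poly R[i]}) :
  (forall t : R, 0 <= t <= 1 -> P.[t%:C] != 0) ->
  exists phi, arg_lift (fun t : R => P.[t%:C] * cconj P.[0]) phi.
Proof.
move=> P0; have [r PE] := closed_field_poly_normal P.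
have z01 : (0 : R) <= (0 : R) <= (1 : R) by rewrite lexx ler01.
have P00 : P.[0] != 0 by exact: P0 0 z01.
have rP a : a \in r -> P.[a] = 0.
  move=> ar; rewrite PE hornerZ; apply/eqP; rewrite mulf_eq0 orbC.
  by rewrite -/(root _ a) root_prod_XsubC ar.
have r0 a : a \in r -> a != 0.
  by move=> /rP ra; apply/eqP => a0; move: P00; rewrite -a0 ra a0 eqxx.
suff [phi Hphi] : exists phi, arg_lift (fun t : R => \prod_(a <- r) (1 + t%:C * - a^-1)) phi.
  exists phi; apply: (arg_liftZ (c := cconj P.[0] * P.[0])) Hphi.
    exact: cpos_conj.
  move=> t _; rewrite mulrC -mulrA; congr (_ * _).
  rewrite {1 2}PE !hornerZ -mulrA; congr (_ * _).
  rewrite !horner_prod -big_split /=; apply: eq_big_seq => a ar.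
  rewrite !hornerXsubC sub0r mulrDr mulr1 mulrCA mulrNN mulfV ?r0 // mulr1 addrC.
  by [].
elim: r {PE} rP r0 => [|a r IH] rP r0.
  by exists (fun=> 0); under eq_fun do rewrite big_nil; exact: arg_lift1.
have [||phi Hphi] := IH.
- by move=> b br; apply: rP; rewrite inE br orbT.
- by move=> b br; apply: r0; rewrite inE br orbT.
have a0 : a != 0 by apply: r0; rewrite mem_head.
have [|psi Hpsi] := @arg_lift_linear (- a^-1).
  move=> t t01 i0; rewrite ltNge; apply/negP => re0.
  (* If the factor were a real number [- s <= 0], then [a = t / (1 + s)] would be a root of [P] in
     the unit interval. *)
  pose s := - Re (1 + t%:C * - a^-1).
  have zE : 1 + t%:C * - a^-1 = (- s)%:C.
    by apply/eqP; rewrite eq_complex /= opprK i0 !eqxx.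
  have s0 : 0 <= s by rewrite oppr_ge0.
  have tE : t%:C = (1 + s)%:C * a.
    apply: (mulIf (invr_neq0 a0)); rewrite mulfK //.
    by move: zE; rewrite mulrN rmorphN rmorphD /= => /eqP;
      rewrite subr_eq addrC -subr_eq opprK => /eqP <-; rewrite addrC.
  have s1 : 0 < 1 + s by rewrite ltr_pwDl.
  have aE : a = (t / (1 + s))%:C.
    rewrite rmorphM /= tE fmorphV mulrC mulrA mulVf ?mul1r //.
    by rewrite eq_complex /= eqxx andbT gt_eqF.
  have := P0 (t / (1 + s)); rewrite -aE rP ?mem_head // eqxx => /(_ _)/negP; apply => //.
  have /andP[t0 t1] := t01; rewrite divr_ge0 ?(ltW s1) //=.
  by rewrite ler_pdivrMr // mul1r (le_trans t1) // lerDl.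
exists (fun t => psi t + phi t); under eq_fun do rewrite big_cons.
exact: arg_liftM.
Qed.

(* The factor [cconj (\det A)] makes the path start on the positive reals. *)
Definition det_path k (A B : 'M[R[i]]_k) (t : R) : R[i] :=
  \det (A + t%:C *: (B - A)) * cconj (\det A).

(** The determinant of a matrix that is affine in [t] is the value at [t] of a polynomial, namely of
    the same determinant taken over polynomials. *)
Lemma arg_lift_det_path k (A B : 'M[R[i]]_k) :
  (forall t : R, 0 <= t <= 1 -> \det (A + t%:C *: (B - A)) != 0) ->
  exists phi, arg_lift (det_path A B) phi.
Proof.
pose P := \det (map_mx polyC A + 'X *: map_mx polyC (B - A)).
have PE (x : R[i]) : P.[x] = \det (A + x *: (B - A)).
  rewrite /P -horner_evalE -det_map_mx; congr (\det _).
  by apply/matrixP => i j; rewrite !mxE /= /horner_eval hornerD hornerM hornerX !hornerC.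
move=> H; have [|phi Hphi] := @arg_lift_poly P.
  by move=> t t01; rewrite PE; exact: H.
exists phi; apply: (arg_liftZ (c := 1)) Hphi; first by split=> //=; exact: ltr01.
by move=> t _; rewrite mul1r /det_path !PE scale0r addr0.
Qed.

End LiftExistence.

(** * Nonvanishing of the interpolated determinant *)

Section NonsingularPath.
Context {R : realType} {T : lmodType R}.
Variables (s : T -> T -> R) (Ja Jb : T -> T).
Hypotheses (sr : forall u, scalar (s u)) (sC : forall u v, s u v = - s v u).
Hypotheses (compa : forall u v, s (Ja u) (Ja v) = s u v)
  (compb : forall u v, s (Jb u) (Jb v) = s u v).
Hypotheses (la0 : Ja 0 = 0) (lb0 : Jb 0 = 0).
Hypotheses (posa : forall u, u != 0 -> 0 < s u (Ja u))
  (posb : forall u, u != 0 -> 0 < s u (Jb u)).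

Let sl u : scalar (s^~ u).
Proof. by move=> a v v'; rewrite !(sC _ u) sr opprD -mulrN. Qed.

(* With [a = u + J v] and [b = u' + J v'], where [u], [v], [u'], [v'] lie in an
   isotropic space, [s a b = s u b + s a u'], an identity which is affine in
   [(u, u')]; along the path it becomes [s v a + s v' b = 0], a sum of values
   of positive definite forms. *)
Lemma isotropic_path_inj (F : set T) (a b ua va ua' va' ub vb ub' vb' : T) (t : R) :
  (forall x y, F x -> F y -> s x y = 0) ->
  [/\ F ua, F va, F ua' & F va'] -> [/\ F ub, F vb, F ub' & F vb'] ->
  a = ua + Ja va -> a = ub + Jb vb -> b = ua' + Ja va' -> b = ub' + Jb vb' ->
  s a b = 0 -> 0 <= t <= 1 ->
  (1 - t) *: ua + t *: ub = (1 - t) *: va' + t *: vb' ->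
  (1 - t) *: va + t *: vb = - ((1 - t) *: ua' + t *: ub') ->
  a = 0 /\ b = 0.
Proof.
move=> iso [Fua Fva Fua' Fva'] [Fub Fvb Fub' Fvb'] aa ab ba bb sab /andP[t0 t1] E1 E2.
have ge0a u : 0 <= s u (Ja u).
  by have [->|/posa/ltW//] := eqVneq u 0; rewrite (psca0 (sl _)).
have ge0b u : 0 <= s u (Jb u).
  by have [->|/posb/ltW//] := eqVneq u 0; rewrite (psca0 (sl _)).
have eq0a u : s u (Ja u) = 0 -> u = 0.
  by move=> H; apply/eqP; apply: contraT => /posa; rewrite H ltxx.
have eq0b u : s u (Jb u) = 0 -> u = 0.
  by move=> H; apply/eqP; apply: contraT => /posb; rewrite H ltxx.
have isoD c u x y : F x -> F u -> c = u + y -> s x c = s x y.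
  by move=> Fx Fu ->; rewrite (pscaD (sr _)) iso // add0r.
have split J u v u' v' : (forall x y, s (J x) (J y) = s x y) ->
    F u -> F v -> F u' -> F v' -> a = u + J v -> b = u' + J v' -> s a u' = - s u b.
  move=> cJ Fu Fv Fu' Fv' aE bE; apply/eqP; rewrite -addr_eq0; move: sab.
  rewrite aE bE !(pscaD (sl _)) !(pscaD (sr _)) cJ (iso u u') // (iso v v') //.
  by rewrite !add0r addr0 addrC => ->.
have splita := split _ _ _ _ _ compa Fua Fva Fua' Fva' aa ba.
have splitb := split _ _ _ _ _ compb Fub Fvb Fub' Fvb' ab bb.
have va_a := isoD _ _ _ _ Fva Fua aa; have vb_a := isoD _ _ _ _ Fvb Fub ab.
have va_b := isoD _ _ _ _ Fva' Fua' ba; have vb_b := isoD _ _ _ _ Fvb' Fub' bb.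
have comb (z : R) (x y w : T) : s (z *: x + t *: y) w = z * s x w + t * s y w.
  by rewrite (pscaD (sl _)) !(pscaZ (sl _)).
have key : (1 - t) * s va (Ja va) + t * s vb (Jb vb) +
    ((1 - t) * s va' (Ja va') + t * s vb' (Jb vb')) = 0.
  rewrite -va_a -vb_a -va_b -vb_b -!comb E2 -E1 !comb (pscaN (sl _)) comb.
  by rewrite (sC ua') (sC ub') splita splitb; ring.
have t1' : 0 <= 1 - t by rewrite subr_ge0.
have [t_lt1|t_ge1] := ltP t 1; last first.
  have tE : t = 1 by apply/eqP; rewrite eq_le t1 t_ge1.
  move: key E1 E2; rewrite tE subrr !mul0r !add0r !mul1r !scale0r !add0r !scale1r.
  move=> /eqP; rewrite paddr_eq0 // => /andP[/eqP/eq0b vb0 /eqP/eq0b vb'0].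
  rewrite vb0 vb'0 => ub0 /eqP; rewrite eq_sym oppr_eq0 => /eqP ub'0.
  by rewrite ab bb vb0 vb'0 ub0 ub'0 lb0 addr0.
have t1p : 0 < 1 - t by rewrite subr_gt0.
have tb u : 0 <= t * s u (Jb u) by rewrite mulr_ge0.
have ta u : 0 <= (1 - t) * s u (Ja u) by rewrite mulr_ge0.
move: key => /eqP; rewrite paddr_eq0 ?addr_ge0 // => /andP[].
rewrite !paddr_eq0 // !mulf_eq0 (gt_eqF t1p) /=.
move=> /andP[/eqP/eq0a va0 _] /andP[/eqP/eq0a va'0 _].
have aE : a = ua by rewrite aa va0 la0 addr0.
have bE : b = ua' by rewrite ba va'0 la0 addr0.
have vb0 : vb = 0.
  by apply: eq0b; rewrite -vb_a aE iso.
have vb'0 : vb' = 0.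
  by apply: eq0b; rewrite -vb_b bE iso.
have ubE : ub = a by rewrite ab vb0 lb0 addr0.
have ubE' : ub' = b by rewrite bb vb'0 lb0 addr0.
move: E1 E2; rewrite va0 vb0 va'0 vb'0 ubE ubE' -aE -bE !scaler0 addr0.
rewrite -!scalerDl subrK !scale1r => -> /eqP.
by rewrite eq_sym oppr_eq0 => /eqP ->.
Qed.

End NonsingularPath.

Section DetPath.
Local Open Scope complex_scope.
Context {R : realType} {T : lmodType R} {k : nat}.

Lemma cframe_mx_lincomb (J : T -> T) (e f : 'I_k -> T) A (r : 'I_k -> R) :
  linear J -> (forall u, J (J u) = - u) -> cframe_mx J e A f ->
  let z := (\row_i (r i)%:C) *m A in
  \sum_i r i *: f i = \sum_j Re (z 0 j) *: e j + J (\sum_j Im (z 0 j) *: e j).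
Proof.
move=> lJ JK fA z; rewrite (plin_sum lJ) -big_split /=.
transitivity (\sum_j cact J (z 0 j) (e j)); last first.
  by apply: eq_bigr => j _; rewrite (plinZ lJ).
under [RHS]eq_bigr do rewrite mxE cact_suml.
rewrite exchange_big /=; apply: eq_bigr => i _.
rewrite -(cact_real J) fA (cact_sumr lJ); apply: eq_bigr => j _.
by rewrite mxE (cactM lJ JK).
Qed.

Variables (s : T -> T -> R) (Ja Jb : T -> T).
Hypotheses (sr : forall u, scalar (s u)) (sC : forall u v, s u v = - s v u).
Hypotheses (la : linear Ja) (lb : linear Jb).
Hypotheses (JaK : forall u, Ja (Ja u) = - u) (JbK : forall u, Jb (Jb u) = - u).
Hypotheses (compa : forall u v, s (Ja u) (Ja v) = s u v)
  (compb : forall u v, s (Jb u) (Jb v) = s u v).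
Hypotheses (posa : forall u, u != 0 -> 0 < s u (Ja u))
  (posb : forall u, u != 0 -> 0 < s u (Jb u)).

(** A kernel row [c = p + i q] gives the vectors [a] and [b] with real coordinates [p] and [q] in
    the frame [f]. The real and imaginary parts of [c X = 0] are exactly the two relations of
    [isotropic_path_inj], with [F] the real span of [e]. *)
Lemma det_path_neq0 (e f : 'I_k -> T) A B (t : R) :
  (forall i j, s (e i) (e j) = 0) -> (forall i j, s (f i) (f j) = 0) ->
  indep f -> cframe_mx Ja e A f -> cframe_mx Jb e B f -> 0 <= t <= 1 ->
  \det (A + t%:C *: (B - A)) != 0.
Proof.
move=> se sf If fA fB t01; apply/negP => /det0P[c c0 cX].
have sum0 (x y : 'I_k -> T) (r r' : 'I_k -> R) : (forall i j, s (x i) (y j) = 0) ->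
    s (\sum_i r i *: x i) (\sum_j r' j *: y j) = 0.
  move=> xy; rewrite (psca_sum (sr _)) big1 // => j _.
  rewrite (pscaZ (sr _)) sC (psca_sum (sr _)) big1 ?oppr0 ?mulr0 // => i _.
  by rewrite (pscaZ (sr _)) sC xy oppr0 mulr0.
pose p i := Re (c 0 i); pose q i := Im (c 0 i).
pose zp (C : 'M[R[i]]_k) := (\row_i (p i)%:C) *m C.
pose zq (C : 'M[R[i]]_k) := (\row_i (q i)%:C) *m C.
pose S (r : 'I_k -> R) := \sum_j r j *: e j.
pose rz (z : 'rV[R[i]]_k) j := Re (z 0 j); pose iz (z : 'rV[R[i]]_k) j := Im (z 0 j).
have cE : c = \row_i (p i)%:C + 'i *: \row_i (q i)%:C.
  apply/rowP => i; rewrite !mxE /p /q; case: (c 0 i) => x y.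
  by apply/eqP; rewrite eq_complex /=; apply/andP; split; apply/eqP; ring.
have SE r r' : (forall j, r j = r' j) -> S r = S r'.
  by move=> E; apply: eq_bigr => j _; rewrite E.
have SD (x y : R) r r' : x *: S r + y *: S r' = S (fun j => x * r j + y * r' j).
  rewrite !scaler_sumr -big_split /=; apply: eq_bigr => j _.
  by rewrite !scalerA -scalerDl.
have SN r : - S r = S (fun j => - r j).
  by rewrite -sumrN; apply: eq_bigr => j _; rewrite scaleNr.
have zX j : (1 - t)%:C * zp A 0 j + t%:C * zp B 0 j +
    'i * ((1 - t)%:C * zq A 0 j + t%:C * zq B 0 j) = 0.
  apply: etrans (etrans (congr1 (fun z : 'rV_k => z 0 j) cX) (mxE _ _ _ _)).
  have -> : A + t%:C *: (B - A) = (1 - t)%:C *: A + t%:C *: B.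
    by rewrite scalerBr rmorphB rmorph1 scalerBl scale1r addrCA addrC.
  rewrite [in RHS]cE mulmxDl mulmxDr -scalemxAl mulmxDr -!scalemxAr !mxE.
  by [].
have [a0 b0] : \sum_i p i *: f i = 0 /\ \sum_i q i *: f i = 0.
  apply: (isotropic_path_inj sr sC compa compb (plin0 la) (plin0 lb) posa posb
    (F := [set x | exists r, x = S r]) (ua := S (rz (zp A))) (va := S (iz (zp A)))
    (ub := S (rz (zp B))) (vb := S (iz (zp B)))
    (ua' := S (rz (zq A))) (va' := S (iz (zq A))) (ub' := S (rz (zq B)))
    (vb' := S (iz (zq B))) (t := t)) => //.
  - by move=> x y [r ->] [r' ->]; exact: sum0.
  - by split; eexists.
  - by split; eexists.
  - exact: (cframe_mx_lincomb p la JaK fA).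
  - exact: (cframe_mx_lincomb p lb JbK fB).
  - exact: (cframe_mx_lincomb q la JaK fA).
  - exact: (cframe_mx_lincomb q lb JbK fB).
  - exact: sum0.
  - rewrite !SD; apply: SE => j; have := zX j; rewrite /rz /iz.
    case: (zp A 0 j) => x x'; case: (zp B 0 j) => y y'.
    case: (zq A 0 j) => u u'; case: (zq B 0 j) => v v' /eqP.
    by rewrite eq_complex /= => /andP[/eqP H _]; lra.
  - rewrite !SD SN; apply: SE => j; have := zX j; rewrite /rz /iz.
    case: (zp A 0 j) => x x'; case: (zp B 0 j) => y y'.
    case: (zq A 0 j) => u u'; case: (zq B 0 j) => v v' /eqP.
    by rewrite eq_complex /= => /andP[_ /eqP H]; lra.
move/negP: c0; apply; apply/eqP/rowP => i; apply/eqP.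
have := If p a0 i; have := If q b0 i; rewrite /p /q mxE eq_complex => -> ->.
by rewrite !eqxx.
Qed.

End DetPath.

(** * Dependence of lifts on the point and on the frames *)

Section LiftNear.
Local Open Scope complex_scope.
Context {R : realType} {T : topologicalType} {k : nat}.

Lemma ccont_conj (X : topologicalType) (f : X -> R[i]) x :
  ccont f x -> ccont (fun y => cconj (f y)) x.
Proof. by move=> [f1 f2]; split=> //; exact: cvgN. Qed.

Lemma ccont_comp (X Y : topologicalType) (f : Y -> R[i]) (g : X -> Y) x :
  {for x, continuous g} -> ccont f (g x) -> ccont (fun y => f (g y)) x.
Proof.
move=> cg [f1 f2]; split.
  exact: (@continuous_comp _ _ _ g (fun y => Re (f y))).
exact: (@continuous_comp _ _ _ g (fun y => Im (f y))).
Qed.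

Lemma det_path_ccont (X : topologicalType) (A B : X -> 'M[R[i]]_k) (t : X -> R) x :
  (forall i j, ccont (fun y => A y i j) x) -> (forall i j, ccont (fun y => B y i j) x) ->
  {for x, continuous t} -> ccont (fun y => det_path (A y) (B y) (t y)) x.
Proof.
move=> cA cB ct; apply: ccontM; last by apply: ccont_conj; exact: ccont_det.
apply: ccont_det => i j; under eq_fun do rewrite !mxE.
apply: ccontD => //; apply: ccontM.
  by apply: (ccont_comp (f := fun t : R => t%:C)) => //; exact: ccont_of_real.
apply: ccontD => //.
by under eq_fun do rewrite -mulN1r; apply: ccontM => //; exact: ccont_cst.
Qed.

Lemma det_path0_real (A B : 'M[R[i]]_k) : Im (det_path A B 0) = 0.
Proof.
rewrite /det_path scale0r addr0; case: (\det A) => a b /=; ring.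
Qed.

(** [G y t] compares the path at [y] with the one at [x] and is positive for [y = x]. While its real
    part stays positive, adding [carg (G y t)] to the lift at [x] gives the lift at [y]; its end
    value thus varies as [carg] of an explicit function. *)
Lemma lift_near (A B : T -> 'M[R[i]]_k) x phi :
  (forall i j, ccont (fun y => A y i j) x) -> (forall i j, ccont (fun y => B y i j) x) ->
  (forall t : R, 0 <= t <= 1 -> det_path (A x) (B x) t != 0) ->
  arg_lift (det_path (A x) (B x)) phi ->
  let G y t := cconj (det_path (A x) (B x) t) * det_path (A y) (B y) t in
  \forall y \near x, 0 < Re (G y 1) /\
    forall psi, arg_lift (det_path (A y) (B y)) psi -> psi 1 = phi 1 + carg (G y 1).
Proof.
move=> cA cB q0 Hphi G.
have cGx (t : R) : ccont (det_path (A x) (B x)) t.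
  apply: (det_path_ccont (A := fun=> A x) (B := fun=> B x) (t := id)) => // i j;
  exact: ccont_cst.
(* Positivity at each [t] holds jointly near [(t, x)]; compactness of the unit interval gives one
   neighbourhood of [x] for all [t]. *)
have nG : \forall y \near x, `[0, 1]%classic `<=` (fun t : R => 0 < Re (G y t)).
  have := (compact_near_coveringP _).1 (@segment_compact R 0 1); apply.
  move=> t /=; rewrite in_itv /= => t01.
  have cG : ccont (fun z : R * T => G z.2 z.1) (t, x).
    apply: ccontM.
      apply: ccont_conj; apply: (ccont_comp (f := det_path (A x) (B x))) => //.
      exact: cvg_fst.
    apply: (det_path_ccont (A := fun z : R * T => A z.2) (B := fun z => B z.2)
      (t := fst)) => [i j|i j|]; last exact: cvg_fst.
      apply: (ccont_comp (f := fun y => A y i j) (g := snd)) => //; exact: cvg_snd.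
    apply: (ccont_comp (f := fun y => B y i j) (g := snd)) => //; exact: cvg_snd.
  have [_ G0] := cpos_conj (q0 t t01).
  have oG : open_nbhs (Re (G x t)) [set z : R | 0 < z] by split; [exact: open_gt|].
  exact: (cG.1 _ (open_nbhs_nbhs oG)).
apply: filterS nG => y HG.
have {}HG (t : R) : 0 <= t <= 1 -> 0 < Re (G y t).
  by move=> t01; apply: HG; rewrite /= in_itv.
have one01 : (0 : R) <= (1 : R) <= (1 : R) by rewrite lexx ler01.
split=> [|psi Hpsi]; first exact: HG.
have [c1 p0 pp] := Hphi.
suff H : arg_lift (det_path (A y) (B y)) (fun t => phi t + carg (G y t)).
  exact: (arg_lift_uniq Hpsi H).
split.
- have c2 : {within `[0, 1], continuous (fun t : R => carg (G y t))}.
    apply: continuous_in_subspaceT => t; rewrite inE /= in_itv /= => t01.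
    apply: carg_continuous; last by rewrite gt_eqF // HG.
    apply: ccontM; first exact: ccont_conj.
    apply: (det_path_ccont (A := fun=> A y) (B := fun=> B y) (t := id)) => // i j;
    exact: ccont_cst.
  by move=> t; apply: cvgD; [exact: c1|exact: c2].
- rewrite p0 add0r /carg (_ : Im (G y 0) = 0) ?mul0r ?atan0 // /G cImM.
  rewrite det_path0_real mulr0 add0r.
  by rewrite -[Im (cconj _)]/(- Im _) det_path0_real oppr0 mul0r.
- move=> t t01; have H1 := pp t t01; have H2 := cpos_carg (HG t t01).
  have := cposM H1 H2; rewrite mulrACA -cisD -opprD /G mulrA [_ * cconj _]mulrC.
  rewrite -[X in cpos X]mulrA; apply: cposMl; apply: cpos_conj; exact: q0.
Qed.

(** Both determinants in [det_path], one of them conjugated, are multiplied by the real number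
    [\det Q / \det P]; the path gains its square, which is positive whatever the orientations. *)
Lemma det_path_real_change (A B A' B' : 'M[R[i]]_k) (P Q : 'M[R]_k) :
  map_mx (real_complex R) Q *m A = A' *m map_mx (real_complex R) P ->
  map_mx (real_complex R) Q *m B = B' *m map_mx (real_complex R) P ->
  \det P != 0 -> \det Q != 0 ->
  exists c, cpos c /\ forall t, det_path A' B' t = c * det_path A B t.
Proof.
move=> QA QB P0 Q0; pose c := ((\det Q / \det P) ^+ 2).
exists c%:C; split; first by split=> //=; rewrite exprn_even_gt0 //= mulf_neq0 ?invr_neq0.
have dE C C' : map_mx (real_complex R) Q *m C = C' *m map_mx (real_complex R) P ->
    \det C' = (\det Q / \det P)%:C * \det C.
  move=> /(congr1 determinant); rewrite !det_mulmx !det_map_mx => E.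
  rewrite rmorphM /= fmorphV mulrAC E mulfK //.
  by rewrite fmorph_eq0.
move=> t; rewrite /det_path (dE _ _ QA) (dE (A + t%:C *: (B - A))); last first.
  by rewrite mulmxDr mulmxDl -scalemxAr -scalemxAl mulmxBr mulmxBl QA QB.
rewrite /c; move: (_ / _) => r.
case: (\det A) => a a'; case: (\det _) => b b'.
by apply/eqP; rewrite eq_complex /=; apply/andP; split; apply/eqP; ring.
Qed.

End LiftNear.

(** * Independence of the complex structure *)

Section Independence.
Local Open Scope complex_scope.
Context {R : realType} {d k : nat} {N : manifold R d} {M : manifold R k.*2}.
Variable h : N -> M.
Hypothesis sh : smooth_map h.

Notation section := (forall x : N, tangent (h x)).

Variable sigma : forall x : N, tangent (h x) -> tangent (h x) -> R.
Arguments sigma : clear implicits.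
Hypothesis sr : forall (x : N) u, scalar (sigma x u).
Hypothesis sC : forall (x : N) u v, sigma x u v = - sigma x v u.
Variables L0 L1 : forall x : N, set (tangent (h x)).
Arguments L0 : clear implicits.
Arguments L1 : clear implicits.
Hypotheses (i0 : isotropic sigma L0) (i1 : isotropic sigma L1).
Hypotheses (f0 : forall x, exists e, framed L0 x e)
  (f1 : forall x, exists e, framed L1 x e).
Variables Ja Jb : forall x : N, tangent (h x) -> tangent (h x).
Arguments Ja : clear implicits.
Arguments Jb : clear implicits.
Hypotheses (cala : calibrated sigma Ja) (calb : calibrated sigma Jb).

Let lJa x : linear (Ja x). Proof. exact: (calibrated_smooth cala).1. Qed.
Let lJb x : linear (Jb x). Proof. exact: (calibrated_smooth calb).1. Qed.
Arguments lJa : clear implicits.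
Arguments lJb : clear implicits.
Let JaK x u : Ja x (Ja x u) = - u. Proof. exact: (calibratedK cala). Qed.
Let JbK x u : Jb x (Jb x u) = - u. Proof. exact: (calibratedK calb). Qed.
Arguments JaK : clear implicits.
Arguments JbK : clear implicits.

Definition basis_of_set (T : lmodType R) (W : set T) (e : 'I_k -> T) : Prop :=
  [/\ forall i, W (e i), indep e &
      forall u, W u -> exists a : 'I_k -> R, u = \sum_i a i *: e i].

Lemma basis_cbasis (J : forall x : N, tangent (h x) -> tangent (h x)) W x e :
  calibrated sigma J -> isotropic sigma W ->
  basis_of_set (W x) e -> cbasis (J x) e.
Proof.
move=> cal iW [We ie _]; apply: cindep_cbasis.
by apply: (isotropic_cindep sr sC cal) => // i j; exact: iW.
Qed.

Lemma basis_change (T : lmodType R) (J : T -> T) W (e e' : 'I_k -> T) :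
  basis_of_set W e -> basis_of_set W e' ->
  exists P : 'M[R]_k, cframe_mx J e (map_mx (real_complex R) P) e'.
Proof.
move=> [_ _ se] [We' _ _]; have [a aE] := choice (fun i => se _ (We' i)).
exists (\matrix_(i, j) a i j) => i; rewrite aE.
by apply: eq_bigr => j _; rewrite !mxE cact_real.
Qed.

(** The variation of the argument from the matrix of [Ja] to that of [Jb]. Quantifying over all
    pairs of real bases at [x] makes it a function of the point alone, with no frame to
    globalise. *)
Definition phase_at (x : N) (r : R) : Prop :=
  exists (e f : 'I_k -> tangent (h x)) A B phi,
  [/\ basis_of_set (L0 x) e /\ basis_of_set (L1 x) f, cframe_mx (Ja x) e A f,
      cframe_mx (Jb x) e B f, arg_lift (det_path A B) phi & r = phi 1].

Lemma phase_at_uniq x r r' : phase_at x r -> phase_at x r' -> r = r'.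
Proof.
move=> [e [f [A [B [phi [[be bf] fA fB Hphi ->]]]]]].
move=> [e' [f' [A' [B' [phi' [[be' bf'] fA' fB' Hphi' ->]]]]]].
have cb := basis_cbasis.
have [P] := basis_change (Ja x) be be'; have [Q] := basis_change (Ja x) bf bf'.
move=> QE PE.
(* The change of frame is real, and real scalars act independently of the complex structure, so the
   same matrix serves for [Jb]. *)
have PE' : cframe_mx (Jb x) e (map_mx (real_complex R) P) e'.
  by move=> i; rewrite PE; apply: eq_bigr => j _; rewrite !mxE !cact_real.
have QE' : cframe_mx (Jb x) f (map_mx (real_complex R) Q) f'.
  by move=> i; rewrite QE; apply: eq_bigr => j _; rewrite !mxE !cact_real.
have ce := basis_cbasis cala i0 be; have ce' := basis_cbasis cala i0 be'.
have cf := basis_cbasis cala i1 bf; have cf' := basis_cbasis cala i1 bf'.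
have det0 (C : 'M[R]_k) : map_mx (real_complex R) C \in unitmx -> \det C != 0.
  by rewrite unitmxE det_map_mx unitfE fmorph_eq0.
have QA := cframe_mx_inj ce.1 (cframe_mxM (lJa x) (JaK x) fA QE)
  (cframe_mxM (lJa x) (JaK x) PE fA').
have QB := cframe_mx_inj (basis_cbasis calb i0 be).1
  (cframe_mxM (lJb x) (JbK x) fB QE') (cframe_mxM (lJb x) (JbK x) PE' fB').
have P0 := det0 _ (cframe_mx_unit (lJa x) (JaK x) ce ce' PE).
have Q0 := det0 _ (cframe_mx_unit (lJa x) (JaK x) cf cf' QE).
have [c [c0 cE]] := det_path_real_change QA QB P0 Q0.
exact: (arg_lift_uniq (arg_liftZ c0 (fun t _ => cE t) Hphi) Hphi').
Qed.

Lemma phase_path_neq0 x (e f : 'I_k -> tangent (h x)) A B (t : R) :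
  basis_of_set (L0 x) e -> basis_of_set (L1 x) f -> cframe_mx (Ja x) e A f ->
  cframe_mx (Jb x) e B f -> 0 <= t <= 1 -> \det (A + t%:C *: (B - A)) != 0.
Proof.
move=> [We ie _] [Wf If _] fA fB.
apply: (det_path_neq0 (s := sigma x) (sr (x := x)) (sC (x := x)) (lJa x) (lJb x)
  (JaK x) (JbK x) _ _ _ _ _ _ If fA fB).
- exact: (calibrated_compat cala).
- exact: (calibrated_compat calb).
- exact: (calibrated_pos cala).
- exact: (calibrated_pos calb).
- by move=> i j; exact: i0.
- by move=> i j; exact: i1.
Qed.

Lemma framed_basis W x (e : 'I_k -> section) : framed W x e ->
  \forall y \near x, basis_of_set (W y) (e^~ y).
Proof. by move=> [_]. Qed.

Lemma phase_at_ex x : exists r, phase_at x r.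
Proof.
have [e fe] := f0 x; have [f ff] := f1 x.
have be := nbhs_singleton (framed_basis fe); have bf := nbhs_singleton (framed_basis ff).
have [A fA] := cframe_mx_ex (f^~ x) (basis_cbasis cala i0 be).
have [B fB] := cframe_mx_ex (f^~ x) (basis_cbasis calb i0 be).
have [phi Hphi] := arg_lift_det_path (fun t => phase_path_neq0 (t := t) be bf fA fB).
by exists (phi 1), (e^~ x), (f^~ x), A, B, phi.
Qed.

Lemma csmooth_ccont (q : N -> R[i]) x : csmooth q x -> ccont q x.
Proof. by move=> [s1 s2]; split; exact: smooth_near_continuous. Qed.

Lemma csmooth_conj (q : N -> R[i]) x : csmooth q x -> csmooth (fun y => cconj (q y)) x.
Proof. by move=> [s1 s2]; split=> //; exact: smooth_nearN. Qed.

Lemma cdfun_conj (q : N -> R[i]) x (v : tangent x) : csmooth q x ->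
  cdfun (fun y => cconj (q y)) v = cconj (cdfun q v).
Proof. by move=> [s1 s2]; rewrite /cdfun /cconj /= dfunN. Qed.

(** By uniqueness [f] may be computed in smooth local frames, where [lift_near] gives
    [f y = phi 1 + carg (c * q y)] with [phi 1] and [c] constant. Hence [f] is smooth and its
    differential is the imaginary part of the logarithmic derivative of [q]. *)
Lemma phase_near f x : (forall x, phase_at x (f x)) ->
  exists (e t : 'I_k -> section) (A B : N -> 'M[R[i]]_k),
  [/\ framed L0 x e, framed L1 x t,
   (forall i j, csmooth (fun y => A y i j) x) /\ (forall i j, csmooth (fun y => B y i j) x),
   (\forall y \near x, cframe_mx (Ja y) (e^~ y) (A y) (t^~ y)) /\
   (\forall y \near x, cframe_mx (Jb y) (e^~ y) (B y) (t^~ y)) &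
   smooth_near f x /\ forall v : tangent x, dfun f v =
     Im (cdfun (fun y => \det (B y)) v / \det (B x)) -
     Im (cdfun (fun y => \det (A y)) v / \det (A x))].
Proof.
move=> Hf; have [e fe] := f0 x; have [t ft] := f1 x.
have be := framed_basis fe; have bt := framed_basis ft.
have ba := basis_cbasis cala i0 (nbhs_singleton be).
have bb := basis_cbasis calb i0 (nbhs_singleton be).
have [A [sA tA]] := ccoef_mx sh cala fe.1 ba ft.1.
have [B [sB tB]] := ccoef_mx sh calb fe.1 bb ft.1.
exists e, t, A, B; split=> //.
have bx := nbhs_singleton be; have btx := nbhs_singleton bt.
have tAx := nbhs_singleton tA; have tBx := nbhs_singleton tB.
have n0 (s : R) : 0 <= s <= 1 -> \det (A x + s%:C *: (B x - A x)) != 0.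
  exact: phase_path_neq0 bx btx tAx tBx.
have A0 : \det (A x) != 0.
  by have := n0 0; rewrite scale0r addr0; apply; rewrite lexx ler01.
have one01 : (0 : R) <= (1 : R) <= (1 : R) by rewrite lexx ler01.
have B0 : \det (B x) != 0.
  by have := n0 1 one01; rewrite scale1r addrC subrK.
have cj0 (z : R[i]) : z != 0 -> cconj z != 0.
  by case: z => a b; rewrite !eq_complex /= oppr_eq0.
have q0 (s : R) : 0 <= s <= 1 -> det_path (A x) (B x) s != 0.
  by move=> s01; rewrite mulf_neq0 ?cj0 // n0.
have [phi Hphi] := arg_lift_det_path n0.
pose q y := \det (B y) * cconj (\det (A y)).
have q1 y : det_path (A y) (B y) 1 = q y.
  by rewrite /det_path scale1r addrC subrK.
have sq : csmooth q x by apply: csmoothM; [|apply: csmooth_conj]; exact: csmooth_det.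
pose c := cconj (q x).
have fE : \forall y \near x, 0 < Re (c * q y) /\ phi 1 + carg (c * q y) = f y.
  have H := lift_near (fun i j => csmooth_ccont (sA i j))
    (fun i j => csmooth_ccont (sB i j)) q0 Hphi.
  apply: filterS3 H (filterI be bt) (filterI tA tB) => y.
  rewrite /= !q1 -/c => -[Gy liftE] [by1 bty] [tAy tBy]; split=> //.
  have [psi Hpsi] := arg_lift_det_path (fun s => phase_path_neq0 (t := s) by1 bty tAy tBy).
  rewrite -(liftE psi Hpsi); apply: (phase_at_uniq (x := y)) (Hf y).
  by exists (e^~ y), (t^~ y), (A y), (B y), psi.
have c0 : c != 0 by rewrite cj0 // mulf_neq0 // cj0.
have cq0 : Re (c * q x) != 0 by rewrite gt_eqF //; exact: (nbhs_singleton fE).1.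
have scarg : smooth_near (fun y => carg (c * q y)) x.
  by apply: carg_smooth => //; apply: csmoothM => //; exact: csmooth_cst.
have sphi : smooth_near (fun y => phi 1 + carg (c * q y)) x.
  by apply: smooth_nearD => //; exact: smooth_near_cst.
have {}fE : \forall y \near x, phi 1 + carg (c * q y) = f y by apply: filterS fE => y [].
split; first exact: smooth_near_eq fE sphi.
move=> v; rewrite -(dfun_eq v sphi fE) dfunD //; last exact: smooth_near_cst.
rewrite dfun_cst add0r dfun_carg_ratio //.
have sdA : csmooth (fun y => \det (A y)) x by exact: csmooth_det.
have sdB : csmooth (fun y => \det (B y)) x by exact: csmooth_det.
rewrite /q cdfunM //; last exact: csmooth_conj.
(* The conjugated factor of [q] contributes the conjugate of the logarithmic derivative of [\det A],
   hence the opposite imaginary part. *)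
rewrite cdfun_conj // mulrDl invfM mulrACA mulfV // mul1r.
rewrite [X in _ + X]mulrACA mulfV ?cj0 // mulr1 addrC cImD; congr (_ + _).
move: (cdfun _ v) A0 => [a a']; case: (\det (A x)) => b b' /=.
rewrite eq_complex /= negb_and => bb0.
by rewrite sqrrN !mulNr opprD !mulrN opprK.
Qed.

End Independence.

(** * The projected connection *)

Section ProjectedConnection.
Context {R : realType} {d k : nat} {N : manifold R d} {M : manifold R k.*2}.
Variable h : N -> M.
Hypothesis sh : smooth_map h.

Notation section := (forall x : N, tangent (h x)).
Notation lsec := (local_section (whole h)).
Notation conn := (forall x : N, tangent x -> section -> tangent (h x)).

Variable sigma : forall x : N, tangent (h x) -> tangent (h x) -> R.
Arguments sigma : clear implicits.
Hypothesis sr : forall (x : N) u, scalar (sigma x u).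
Hypothesis sC : forall (x : N) u v, sigma x u v = - sigma x v u.
Hypothesis ssm : forall (x : N) s t, lsec x s -> lsec x t ->
  smooth_near (fun y => sigma y (s y) (t y)) x.
Variable J : forall x : N, tangent (h x) -> tangent (h x).
Arguments J : clear implicits.
Hypothesis cal : calibrated sigma J.
Variables L0 L1 : forall x : N, set (tangent (h x)).
Arguments L0 : clear implicits.
Arguments L1 : clear implicits.
Hypotheses (i0 : isotropic sigma L0) (i1 : isotropic sigma L1).
Hypotheses (f0 : forall x, exists e, framed L0 x e)
  (f1 : forall x, exists e, framed L1 x e).

Let lJ x : linear (J x). Proof. exact: (calibrated_smooth cal).1. Qed.
Arguments lJ : clear implicits.
Let JK x u : J x (J x u) = - u. Proof. exact: (calibratedK cal). Qed.
Arguments JK : clear implicits.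
Let lsJ x s : lsec x s -> lsec x (fun y => J y (s y)).
Proof. exact: (calibrated_smooth cal).2. Qed.

Lemma framedS (W : forall x : N, set (tangent (h x))) x (e : 'I_k -> section) :
  framed W x e -> \forall y \near x, framed W y e.
Proof.
move=> [le We].
have : \forall y \near x, forall i, lsec y (e i).
  by apply: filter_forall => i; exact: local_sectionS.
have /near_openP[U [oU Ux] sU] := We.
apply: filterS2 (open_nbhs_nbhs (conj oU Ux)) => y Uy ley; split=> //.
by apply: filterS (open_nbhs_nbhs (conj oU Uy)) => z /sU.
Qed.

(** The primitive is [(2 pi)^-1 * carg (c * \det C)], where the constant [c], the conjugate of
    [\det (C x)], moves the determinant into the right half-plane near [x]. *)
Lemma maslov_exact_near (D0 D1 : conn) (theta : forall x : N, tangent x -> R) x :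
  orthogonal_unitary sigma J L0 D0 -> orthogonal_unitary sigma J L1 D1 ->
  (forall x v, maslov_at J D0 D1 v (theta x v)) -> exact_near theta x.
Proof.
move=> ou0 ou1 mt; have [e fe] := f0 x; have [t ft] := f1 x.
have be := nbhs_singleton (framed_cbasis sr sC cal i0 fe).
have bt := nbhs_singleton (framed_cbasis sr sC cal i1 ft).
have [C [sCx tE]] := ccoef_mx sh cal fe.1 be ft.1.
have uC := cframe_mx_unit (lJ x) (JK x) be bt (nbhs_singleton tE).
have C0 : \det (C x) != 0 by rewrite -unitfE -unitmxE.
pose q y := \det (C y); have sq : csmooth q x by exact: csmooth_det.
have cp := cpos_conj C0; pose c := cconj (q x).
have c0 : c != 0.
  by apply/eqP => c0; have [_] := cp; rewrite -/(q x) -/c c0 mul0r ltxx.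
have sre : smooth_near (fun y => Re (c * q y)) x.
  by have [] := csmoothM (csmooth_cst c x) sq.
have cq : \forall y \near x, 0 < Re (c * q y) by apply: near_gt0 => //; exact: cp.2.
have scarg : smooth_near (fun y => carg (c * q y)) x.
  apply: carg_smooth; last by rewrite gt_eqF // (nbhs_singleton cq).
  by apply: csmoothM => //; exact: csmooth_cst.
exists (fun y => (2 * pi)^-1 * carg (c * q y)).
  by apply: smooth_nearM => //; exact: smooth_near_cst.
have nC : \forall y \near x, forall i j, csmooth (fun z => C z i j) y.
  by apply: filter_forall => i; apply: filter_forall => j; exact: csmoothS.
apply: filterS3 (filterI nC cq) (filterI (framedS fe) (framedS ft)) (near_join tE).
move=> y [sCy cqy] [fey fty] tEy v.
have sqy : csmooth q y by exact: csmooth_det.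
have scy : smooth_near (fun z => carg (c * q z)) y.
  apply: carg_smooth; last by rewrite gt_eqF.
  by apply: csmoothM => //; exact: csmooth_cst.
rewrite dfunM //; last exact: smooth_near_cst.
rewrite dfun_cst mulr0 addr0 dfun_carg_ratio // ?gt_eqF //.
apply: (maslov_at_uniq sh cal (mt y v)).
exact: (maslov_at_logdet sh sr sC cal ou0 ou1 v i0 i1 fey fty sCy tEy).
Qed.

Variable D : conn.
Arguments D : clear implicits.
Hypothesis ou0 : orthogonal_unitary sigma J L0 D.

Hypothesis lag1 : forall x : N, lagrangian_subspace sigma (L1 x).

Let L1_lin (x : N) a u v : L1 x u -> L1 x v -> L1 x (a *: u + v).
Proof.
move=> Lu Lv; apply/lag1 => z Lz; rewrite sC sr.
by rewrite (i1 Lz Lu) (i1 Lz Lv) mulr0 addr0 oppr0.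
Qed.

Let L1_0 (x : N) : L1 x 0.
Proof. by apply/lag1 => z _; rewrite sC (psca0 (sr _)) oppr0. Qed.

Let L1_N (x : N) u : L1 x u -> L1 x (- u).
Proof. by move=> Lu; rewrite -scaleN1r -[_ *: _]addr0; exact: L1_lin. Qed.

Lemma lagrangian_split (x : N) (u : tangent (h x)) :
  exists p : tangent (h x) * tangent (h x),
    [/\ L1 x p.1, L1 x p.2 & u = p.1 + J x p.2].
Proof.
have [e fe] := f1 x.
have [_ se] := nbhs_singleton (framed_cbasis sr sC cal i1 fe).
have [_ /nbhs_singleton[We _ _]] := fe.
have L1_sum (a : 'I_k -> R) : L1 x (\sum_i a i *: e i x).
  by elim/big_ind: _ => [|u' v' Lu Lv|i _]; [exact: L1_0|
    rewrite -[u']scale1r; exact: L1_lin|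
    rewrite -[_ *: _]addr0; exact: L1_lin].
have [z ->] := se u.
exists (\sum_i Re (z i) *: e i x, \sum_i Im (z i) *: e i x); split=> //=.
rewrite (plin_sum (lJ x)) -big_split /=; apply: eq_bigr => i _.
by rewrite (plinZ (lJ x)).
Qed.

(** The projection onto [L1] along [J L1], chosen pointwise; its linearity and smoothness come from
    uniqueness of the splitting and from a frame of [L1]. *)
Definition lag_proj (x : N) (u : tangent (h x)) : tangent (h x) :=
  (projT1 (cid (lagrangian_split u))).1.
Arguments lag_proj : clear implicits.

Lemma lag_projP (x : N) u v : L1 x u -> L1 x v -> lag_proj x (u + J x v) = u.
Proof.
move=> Lu Lv; rewrite /lag_proj; case: (cid _) => -[p q] /= [Lp Lq E].
have vq : v - q = 0.
  apply/eqP; apply: contraT => /(calibrated_pos cal); rewrite /metric_of.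
  have -> : J x (v - q) = p - u.
    rewrite (plinB (lJ x)); apply/eqP; rewrite subr_eq addrAC -E.
    by rewrite addrAC subrr add0r.
  have Lvq : L1 x (v - q) by rewrite -[v]scale1r; apply: L1_lin => //; exact: L1_N.
  have Lpu : L1 x (p - u) by rewrite -[p]scale1r; apply: L1_lin => //; exact: L1_N.
  by rewrite (i1 Lvq Lpu) ltxx.
move/eqP: vq; rewrite subr_eq0 => /eqP vq; move: E; rewrite vq.
by move=> /addIr ->.
Qed.

Lemma lag_proj_in (x : N) u : L1 x (lag_proj x u).
Proof. by rewrite /lag_proj; case: (cid _) => -[p q] /= []. Qed.

Lemma lag_proj_id (x : N) u : L1 x u -> lag_proj x u = u.
Proof.
move=> Lu; have := lag_projP Lu (L1_0 x); rewrite (plin0 (lJ x)) addr0.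
by [].
Qed.

Lemma lag_proj_J (x : N) u : L1 x u -> lag_proj x (J x u) = 0.
Proof. by move=> Lu; have := lag_projP (L1_0 x) Lu; rewrite add0r. Qed.

Lemma lag_proj_linear (x : N) : linear (lag_proj x).
Proof.
move=> a u v; have [[p q] /= [Lp Lq ->]] := lagrangian_split u.
have [[p' q'] /= [Lp' Lq' ->]] := lagrangian_split v.
rewrite (lag_projP Lp Lq) (lag_projP Lp' Lq').
have -> : a *: (p + J x q) + (p' + J x q') = (a *: p + p') + J x (a *: q + q').
  by rewrite (lJ x) scalerDr addrACA.
by rewrite lag_projP //; exact: L1_lin.
Qed.
Arguments lag_proj_linear : clear implicits.

(** For [u = p + J q] with [p] and [q] in [L1], the projection of [J u = - q + J p] is [- q]; thus
    [- J P J], with [P] the projection, is the complementary projection. *)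
Lemma lag_proj_compl (x : N) u : lag_proj x u - J x (lag_proj x (J x u)) = u.
Proof.
have [[p q] /= [Lp Lq ->]] := lagrangian_split u; rewrite (lag_projP Lp Lq).
have -> : J x (p + J x q) = - q + J x p by rewrite (plinD (lJ x)) JK addrC.
rewrite (lag_projP (L1_N Lq) Lp) (plinN (lJ x)) opprK.
by [].
Qed.

Lemma lag_proj_smooth : smooth_endo lag_proj.
Proof.
apply: (smooth_endo_of_frames sh) => [x|x]; first exact: lag_proj_linear.
have [e fe] := f1 x; have [le We] := fe.
have [ie _] := nbhs_singleton (framed_cbasis sr sC cal i1 fe).
exists ('I_k + 'I_k)%type, (fun i y => rframe (J y) (e^~ y) i); split.
- by rewrite card_sum card_ord addnn.
- by move=> i; exact: (lsec_rframe cal i le).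
- exact: ie.
- case=> i.
    apply: (local_section_eq sh _ (le i)).
    by apply: filterS We => y [We _ _] /=; rewrite lag_proj_id.
  apply: (local_section_eq sh _ (local_section0 sh x)).
  by apply: filterS We => y [We _ _] /=; rewrite lag_proj_J.
Qed.

(** With [P = lag_proj], a section is [P s - J (P (J s))]. The operator [P D] acts on the two
    sections [P s] and [P (J s)] of [L1], and the result is reassembled in the same way, which makes
    it commute with [J]. *)
Definition proj_conn (x : N) (v : tangent x) (s : section) : tangent (h x) :=
  lag_proj x (D x v (fun y => lag_proj y (s y))) -
  J x (lag_proj x (D x v (fun y => lag_proj y (J y (s y))))).
Arguments proj_conn : clear implicits.

Let lsP x s : lsec x s -> lsec x (fun y => lag_proj y (s y)).
Proof. exact: lag_proj_smooth.2. Qed.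

Let cD := ou_connection ou0.

Lemma proj_conn_connection : connection h (whole h) proj_conn.
Proof.
have lP := lag_proj_linear.
split.
- move=> x s ls a u v; rewrite /proj_conn !(conn_linear cD) ?lP ?(lJ x);
    do ?[exact: lsP|exact/lsP/lsJ].
  by rewrite scalerBr opprD addrACA.
- move=> x v s t ls lt; rewrite /proj_conn.
  have -> : (fun y => lag_proj y (s y + t y)) = (fun y => lag_proj y (s y) + lag_proj y (t y)).
    by apply: functional_extensionality_dep => y; rewrite (plinD (lP y)).
  have -> : (fun y => lag_proj y (J y (s y + t y))) =
      (fun y => lag_proj y (J y (s y)) + lag_proj y (J y (t y))).
    by apply: functional_extensionality_dep => y; rewrite (plinD (lJ y)) (plinD (lP y)).
  rewrite !(conn_add cD); do ?[exact: lsP|exact/lsP/lsJ].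
  by rewrite !(plinD (lP x)) (plinD (lJ x)) opprD addrACA.
- move=> x v f s sf ls; rewrite /proj_conn.
  have -> : (fun y => lag_proj y (f y *: s y)) = (fun y => f y *: lag_proj y (s y)).
    by apply: functional_extensionality_dep => y; rewrite (plinZ (lP y)).
  have -> : (fun y => lag_proj y (J y (f y *: s y))) = (fun y => f y *: lag_proj y (J y (s y))).
    by apply: functional_extensionality_dep => y; rewrite (plinZ (lJ y)) (plinZ (lP y)).
  rewrite !(conn_leibniz cD) //; do ?[exact: lsP|exact/lsP/lsJ].
  rewrite !(plinD (lP x)) !(plinZ (lP x)) (plinD (lJ x)) !(plinZ (lJ x)).
  (* The two terms containing the derivative of [f] recombine into that derivative times [s x] by
     [lag_proj_compl]. *)
  rewrite opprD addrACA -!scalerBr; congr (_ *: _ + _).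
  rewrite !(lag_proj_id (lag_proj_in _)); exact: lag_proj_compl.
- move=> x X s lX ls.
  have H s' : lsec x s' -> lsec x (fun y => lag_proj y (D y (X y) s')).
    by move=> ls'; apply: lsP; exact: (conn_smooth cD).
  have := local_sectionD sh (H _ (lsP ls)) (local_sectionZ sh
    (@smooth_near_cst _ _ _ _ (-1 : R) x) (lsJ (H _ (lsP (lsJ ls))))).
  apply: (local_section_eq sh); apply: nearW => y.
  by rewrite scaleN1r.
Qed.

Lemma proj_conn_J (x : N) (v : tangent x) s : lsec x s ->
  proj_conn x v (fun y => J y (s y)) = J x (proj_conn x v s).
Proof.
move=> ls; rewrite /proj_conn (plinB (lJ x)) JK opprK.
have -> : (fun y => lag_proj y (J y (J y (s y)))) = (fun y => - lag_proj y (s y)).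
  by apply: functional_extensionality_dep => y; rewrite JK (plinN (lag_proj_linear y)).
rewrite (connN v cD (lsP ls)) (plinN (lag_proj_linear x)) (plinN (lJ x)) opprK addrC.
by [].
Qed.

Lemma proj_conn_L1 (x : N) (v : tangent x) s : local_section L1 x s ->
  proj_conn x v s = lag_proj x (D x v s).
Proof.
move=> /local_sectionW[ls Ls]; rewrite /proj_conn.
rewrite (conn_local sh v cD (s := fun y => lag_proj y (s y)) (t := s)); first last.
- by apply: filterS Ls => y Ly; exact: lag_proj_id.
- by apply/local_sectionW; split; [exact: lsP|exact: nearW].
rewrite (conn_local sh v cD (s := fun y => lag_proj y (J y (s y))) (t := fun _ => 0)); first last.
- by apply: filterS Ls => y Ly; exact: lag_proj_J.
- by apply/local_sectionW; split; [exact/lsP/lsJ|exact: nearW].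
by rewrite (conn0 sh cD) (plin0 (lag_proj_linear x)) (plin0 (lJ x)) subr0.
Qed.

(** [L1] is isotropic, so it is orthogonal to [J L1], and projecting does not change products with
    vectors of [L1]: the metric identity of [D] passes to the frame [e]. The isometry [J] carries it
    to [J e], and mixed products vanish on both sides. *)
Lemma proj_conn_unitary : orthogonal_unitary sigma J L1 proj_conn.
Proof.
have gS := g_scalar sr cal; have gC := g_sym sr sC cal.
have gsm := g_smooth ssm cal; have gJ := g_Jl cal.
split; [exact: proj_conn_connection| |exact: proj_conn_J|]; last first.
  by move=> x v s ls; rewrite proj_conn_L1 //; exact: lag_proj_in.
move=> x v s t ls lt.
have [e fe] := f1 x; have [le We] := fe.
have [ie _] := nbhs_singleton (framed_cbasis sr sC cal i1 fe).
have [We0 _ _] := nbhs_singleton We.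
have lL i : local_section L1 x (e i).
  by apply/local_sectionW; split; [exact: le|apply: filterS We => y []].
have Di i := proj_conn_L1 v (lL i).
have DJi i : proj_conn x v (fun y => J y (e i y)) = J x (lag_proj x (D x v (e i))).
  by rewrite proj_conn_J // Di.
pose g := metric_of sigma J.
have gl u : scalar (fun z => g x z u) by exact: (g_scalarl sr sC cal).
have g0 y a b : L1 y a -> L1 y b -> g y (J y a) b = 0.
  by move=> La Lb; rewrite /g gJ i1.
have gC' y a b : g y a b = g y b a by exact: gC.
have gJJ y a b : g y (J y a) (J y b) = g y a b by exact: (g_JJ cal).
have gproj a b : L1 x b -> g x a b = g x (lag_proj x a) b.
  move=> Lb; rewrite -{1}(lag_proj_compl a) (pscaD (gl _)) (pscaN (gl _)).
  by rewrite g0 ?subr0 //; exact: lag_proj_in.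
have Hee i j : dfun (fun y => g y (e i y) (e j y)) v =
    g x (lag_proj x (D x v (e i))) (e j x) + g x (e i x) (lag_proj x (D x v (e j))).
  rewrite [LHS](ou_metric ou0 v (le i) (le j)); congr (_ + _); first exact: gproj.
  by apply: etrans (gC' _ _ _) _; rewrite gproj //; exact: gC'.
have Hje i j : dfun (fun y => g y (J y (e i y)) (e j y)) v =
    g x (J x (lag_proj x (D x v (e i)))) (e j x) +
    g x (J x (e i x)) (lag_proj x (D x v (e j))).
  rewrite !g0 ?addr0 //; do ?exact: lag_proj_in.
  apply: (dfun_near_cst (a := 0)); apply: filterS We => y [Wy _ _].
  exact: g0.
apply: (@metric_of_frame _ _ _ _ _ h sh proj_conn proj_conn_connection g gS gC gsm x v
  ('I_k + 'I_k)%type (fun i y => rframe (J y) (e^~ y) i) _ _ ie _ s t ls lt).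
- by rewrite card_sum card_ord addnn.
- by move=> i; exact: (lsec_rframe cal i le).
case=> i; case=> j /=; rewrite ?DJi ?Di.
- exact: Hee.
- under eq_fun do rewrite gC'.
  by rewrite Hje addrC gC' [X in _ + X]gC'.
- exact: Hje.
- under eq_fun do rewrite gJJ.
  by rewrite !gJJ Hee.
Qed.

End ProjectedConnection.

Section PushSections.
Context {R : realType} {d m : nat} {N : manifold R d} {M : manifold R m}.
Variable h : N -> M.
Hypothesis sh : smooth_map h.

Lemma push_section (X : forall y : N, tangent y) x :
  local_vfield x X -> local_section (whole h) x (fun y => push h (X y)).
Proof.
move=> lX; have cx := mem_chart_at (h x); set c := chart_at _ in cx.
apply: (local_section_comp sh cx) => j.
have sid := smooth_map_id M.
have sfj p : dom c p -> smooth_near (fun q => fwd c q 0 j) p.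
  move=> cp; have := smooth_near_fwd sid cp.
  by move=> /smooth_near_rowP; apply.
(* In the fixed chart [c] the components are derivatives along [X] of the coordinates of [h],
   whereas [push] is defined through the chart at the moving point [h y]. *)
apply: (@smooth_near_eq _ _ _ _ (fun y => dfun (fun z => fwd c (h z) 0 j) (X y))).
  apply: filterS (near_dom_map sh cx) => y cy.
  rewrite (dfun_push sh (f := fun q => fwd c q 0 j)); last exact: sfj.
  rewrite (dfun_chart _ cy (sfj _ cy)).
  have -> : ((fun q => fwd c q 0 j) \o bwd c) = (fun z => (fwd c \o bwd c) z 0 j) by [].
  by rewrite diff_coord ?transition_id //; exact: transition_diff.
apply: smooth_near_dfun => //.
exact: (smooth_near_pull sh (f := fun q => fwd c q 0 j) (sfj _ cx)).
Qed.

End PushSections.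

(** * Local frames of the vertical bundle and of the submanifold *)

Section LagrangianFrames.
Context {R : realType} {n : nat} {M : manifold R n.*2} {L : manifold R n}.
Variables (S : forall p : M, tangent p -> tangent p)
  (w : forall p : M, tangent p -> tangent p -> R)
  (V' : forall p : M, set (tangent p))
  (iota : L -> M).
Arguments S : clear implicits.
Arguments w : clear implicits.
Hypotheses (ll : locally_lagrangian S w) (ld : lagrangian_distribution w V')
  (cVV' : complementary V' (vertical S)).
Hypothesis li : lagrangian_submanifold iota w.

Let si : smooth_map iota := ls_smooth li.

(** [S] sends the [V'] half of the adapted frame to independent vectors and kills the other half, so
    these images already generate its whole image. *)
Lemma framed_vertical x :
  exists e, framed (h := iota) (fun y => vertical S (iota y)) x e.
Proof.
have [e [le Ve ie]] := adapted_frame ll ld cVV' (iota x).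
have sS := (ts_smooth (ll_tangent_structure ll)).2.
exists (fun i y => S (iota y) (e i (iota y))); split.
  move=> i; apply: (pull_section si (Y := fun q => S q (e i q))).
  exact: (sS (iota x) (e i) (le i)).
apply: filterS (smooth_map_near si ie) => y iy; split.
- by move=> i; exists (e i (iota y)).
- move=> a a0 i.
  apply: (iy (fun j => match j with inl _ => 0 | inr j => a j end) _ (inr i)).
  rewrite big_sumType /= [X in X + _]big1 ?add0r // => j _.
  by rewrite scale0r.
- move=> u [z ->].
  have mI : n.*2 = #|{: 'I_n + 'I_n}| by rewrite card_sum card_ord addnn.
  have [a ->] := indep_span mI iy z.
  exists (fun i => a (inl i)).
  rewrite (plin_sum (S_linear ll _)) big_sumType /=.
  rewrite [X in _ + X]big1 ?addr0; last first.
    move=> i _; rewrite (plinZ (S_linear ll _)) (S_square ll) scaler0.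
    by [].
  by apply: eq_bigr => i _; rewrite (plinZ (S_linear ll _)).
Qed.

Lemma framed_image x : exists e, framed (h := iota) (image_tangent iota) x e.
Proof.
have sid := smooth_map_id L.
have [e [le _ ie]] := pull_coord_frame sid x.
have mI : n = #|'I_n| by rewrite card_ord.
have [nie _] := frame_near (h := @idfun L) sid mI le ie.
exists (fun i y => push iota (e i y)); split.
  by move=> i; exact: push_section.
apply: filterS nie => y iy.
have pl := push_is_linear iota (x := y).
have psum (a : 'I_n -> R) : \sum_i a i *: push iota (e i y) =
    push iota (\sum_i a i *: e i y).
  by rewrite (plin_sum pl); apply: eq_bigr => i _; rewrite (plinZ pl).
split.
- by move=> i; exists (e i y).
- move=> a; rewrite psum -(plin0 pl) => /(ls_immersion li); exact: iy.
- move=> u [v ->]; have [a ->] := indep_span mI iy v.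
  by exists a; rewrite psum.
Qed.

Lemma isotropic_vertical :
  isotropic (h := iota) (fun x => w (iota x)) (fun y => vertical S (iota y)).
Proof. by move=> x u v; exact: w_V. Qed.

Lemma isotropic_image : isotropic (h := iota) (fun x => w (iota x)) (image_tangent iota).
Proof. by move=> x u v /(ls_lagrangian li); apply. Qed.

End LagrangianFrames.

Theorem proposition3p1 (R : realType) (n : nat) (M : manifold R n.*2)
    (S : forall p : M, tangent p -> tangent p)
    (w : forall p : M, tangent p -> tangent p -> R)
    (L : manifold R n) (iota : L -> M)
    (V' : forall p : M, set (tangent p))
    (S' : forall p : M, tangent p -> tangent p)
    (DV D0 : forall p : M, tangent p -> (forall q : M, tangent q) -> tangent p)
    (DL : forall x : L, tangent x ->
            (forall y : L, tangent (iota y)) -> tangent (iota x)) :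
  locally_lagrangian S w ->
  elliptic S w ->
  lagrangian_submanifold iota w ->
  lagrangian_distribution w V' ->
  complementary V' (vertical S) ->
  inverse_structure S V' S' ->
  connection (@idfun M) (vertical S) DV ->
  preserves_metric (@idfun M) (vertical S) (assoc_metric w S S') DV ->
  connection (@idfun M) (whole (@idfun M)) D0 ->
  extends_vertical S S' DV D0 ->
  connection iota (whole iota) DL ->
  restricts iota D0 DL ->
  exists theta : forall x : L, tangent x -> R,
    [/\ closed_form1 theta,
        is_trace_form iota (assoc_metric w S S') (assoc_J S S') DL theta &
        maslov_mu1 iota S w = deRham_class theta].
Proof.
move=> ll el li ld cVV' iS' cDV gDV cD0 eD0 cDL rDL.
have si := ls_smooth li.
pose sigma (x : L) := w (iota x).
pose J (x : L) := assoc_J S S' (p := iota x).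
pose L0 (x : L) := vertical S (iota x).
have sr x u : scalar (sigma x u) by exact: (w_scalar ll).
have sC x u v : sigma x u v = - sigma x v u by exact: (w_skew ll).
have ssm (x : L) s t : local_section (whole iota) x s ->
    local_section (whole iota) x t ->
    smooth_near (fun y => sigma y (s y) (t y)) x.
  exact: (pull_form2 si (symplectic_form (ll_symplectic ll))).
have cal : calibrated sigma J by exact: (calibrated_assoc ll el ld cVV' iS' si).
have ou0 : orthogonal_unitary sigma J L0 DL.
  exact: (DL_orthogonal_unitary ll el ld cVV' iS' cDV gDV cD0 eD0 cDL rDL si).
have i0 : isotropic sigma L0 by exact: isotropic_vertical ll.
have i1 : isotropic sigma (image_tangent iota) by exact: isotropic_image li.
have f0 x : exists e, framed L0 x e by exact: (framed_vertical ll ld cVV' li).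
have f1 x : exists e, framed (image_tangent iota) x e by exact: (framed_image li).
have lag1 := ls_lagrangian li.
pose D1 := proj_conn sr sC cal i1 f1 DL lag1.
have ou1 : orthogonal_unitary sigma J (image_tangent iota) D1.
  exact: (proj_conn_unitary si sr sC ssm cal i1 f1 ou0 lag1).
have mex x (v : tangent x) : exists r, maslov_at J DL D1 v r.
  have [e fe] := f0 x.
  exact: (maslov_at_ex si cal ou0 ou1 v (nbhs_singleton (framed_cbasis sr sC cal i0 fe))).
(* The values are chosen pointwise; [maslov_at_uniq] fixes them, and the local primitives provide
   smoothness together with closedness. *)
pose theta x (v : tangent x) := projT1 (cid (mex x v)).
have mt x (v : tangent x) : maslov_at J DL D1 v (theta x v) by exact: projT2 (cid (mex x v)).
have clt : closed_form1 theta.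
  apply: closed_of_exact_near => x.
  exact: (maslov_exact_near si sr sC cal i0 i1 f0 f1 x ou0 ou1 mt).
exists theta; split=> //.
- move=> U e lam b [oU le ge] gd x v Ux.
  pose pe (i : 'I_n) (y : L) := push iota (e i y).
  have le' i y : U y -> local_section (image_tangent iota) y (pe i).
    move=> Uy; apply/local_sectionW; split; last by apply: nearW => z; exists (e i z).
    apply: (push_section si); have /(smooth_sectionP (smooth_map_id L) _ oU) := le i.
    exact.
  (* An orthonormal basis of [TL] is unitary because [sigma] vanishes on [TL]; thus it may be used
     to read off the trace. *)
  have uf : unitary_frame sigma J U pe.
    split=> //.
      move=> i; apply/(smooth_sectionP si _ oU) => y Uy.
      by have /local_sectionW[] := le' i y Uy.
    move=> y Uy i j; split; first exact: ge.
    by apply: (i1 y); [exists (e i y)|exists (e j y)].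
  have be := unitary_cbasis sr sC cal uf Ux.
  have [al cd] := conn_diff_ex si cal ou0 ou1 v.
  pose A : 'M[complex R]_n := \matrix_(i, j) Complex 0 (- b i j x v).
  apply: etrans (_ : - (2 * pi)^-1 * Im (\tr A) = _).
    apply: (maslov_at_uniq si cal (mt x v)); exists al, (pe^~ x), A; split=> // i.
    have [_ _ <-] := cd; last by have /local_sectionW[] := le' i x Ux.
    rewrite /D1 (proj_conn_L1 si sr sC cal i1 f1 ou0 lag1 v (le' i x Ux)).
    have -> : DL x v (pe i) = \sum_j (lam i j x v *: pe j x + b i j x v *: J x (pe j x)).
      exact: gd.
    have Lp j : image_tangent iota x (pe j x) by exists (e j x).
    have PD := plinD (lag_proj_linear sr sC cal i1 f1 lag1 (x := x)).
    have PZ := plinZ (lag_proj_linear sr sC cal i1 f1 lag1 (x := x)).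
    rewrite (plin_sum (lag_proj_linear sr sC cal i1 f1 lag1 (x := x))) -sumrB.
    apply: eq_bigr => j _; rewrite PD !PZ.
    rewrite (lag_proj_id sr sC cal i1 f1 lag1 (Lp j)).
    rewrite (lag_proj_J sr sC cal i1 f1 lag1 (Lp j)).
    by rewrite scaler0 addr0 mxE /cact /= scale0r add0r opprD addrA subrr sub0r scaleNr.
  rewrite mulNr -mulrN; congr (_ * _).
  rewrite (raddf_sum (@Im R)) -sumrN.
  by apply: eq_bigr => i _; rewrite mxE /= opprK.
- apply/seteqP; split=> eta.
    move=> [J' [D0' [D1' [theta' [cal' ou0' ou1' mf' [cl' cle [f1' sf1 Ef1]]]]]]].
    have mt' x (v : tangent x) := maslov_form_at si sr sC ssm cal' ou0' ou1' i0 f0 v mf'.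
    have [f Hf] := choice (phase_at_ex sr sC i0 i1 f0 f1 cal cal').
    have Hn := phase_near si sr sC i0 i1 f0 f1 cal cal' _ Hf.
    (* [f1'] is a primitive of [eta - theta'], and [(2 pi)^-1 * f], with [f] the phase from [J] to
       [J'], is one of [theta' - theta]. *)
    split=> //; exists (fun x => f1' x + (2 * pi)^-1 * f x).
      apply: smooth_fun_near => x _; apply: smooth_nearD.
        by exists setT; split=> //; exact: openT.
      apply: smooth_nearM; first exact: smooth_near_cst.
      by have [e [t [A [B [_ _ _ _ [sf _]]]]]] := Hn x.
    move=> x v; have [e [t [A [B [fe ft [sA sB] [tA tB] [sf fE]]]]]] := Hn x.
    have sf1x : smooth_near f1' x by exists setT; split=> //; exact: openT.
    rewrite dfunD //; last by apply: smooth_nearM => //; exact: smooth_near_cst.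
    rewrite dfunM //; last exact: smooth_near_cst.
    rewrite dfun_cst mulr0 addr0 -Ef1 fE mulrBr.
    have := maslov_at_logdet si sr sC cal ou0 ou1 v i0 i1 fe ft sA tA.
    move=> /(maslov_at_uniq si cal (mt x v)) <-.
    have := maslov_at_logdet si sr sC cal' ou0' ou1' v i0 i1 fe ft sB tB.
    move=> /(maslov_at_uniq si cal' (mt' x v)) <-.
    by rewrite addrA subrK.
  (* Conversely [theta] is itself a Maslov form, for [J], [DL] and the projected connection, so its
     de Rham class is one of those collected. *)
  move=> de; exists J, DL, D1, theta; split=> //.
  exact: (maslov_form_of_at si sr sC cal ou0 ou1 mt).
Qed.
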